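(* The triangular Schröder polynomial $S_{m,n,\ell}(q,t,a)$ depends only on the triangular partition $\tau=\tau_{m,n,\ell}$. That is, if $(m,n,\ell)$ and $(m',n',\ell')$ are triples of positive integers with $\gcd(m,n)=\gcd(m',n')=1$, $\ell<mn$, $\ell'<m'n'$ and $\tau_{m,n,\ell}=\tau_{m',n',\ell'}$, then $S_{m,n,\ell}(q,t,a)=S_{m',n',\ell'}(q,t,a)$.
   Context: For coprime positive integers $m,n$ and an integer $0<\ell<mn$, $\tau_{m,n,\ell}=\{(x,y)\in\mathbb{Z}_{\ge1}^2:nx+my\le\ell\}$ (the partition whose boxes, indexed by northeast corners, lie weakly below the line $nx+my=\ell$). Triangular Schröder polynomial. Let $\Gamma_{m,n}=\{nx+my: x,y\in\mathbb{Z}_{\ge0}\}$. $\mathrm{Inv}_{m,n}$ is the set of $\Delta\subset\mathbb{Z}_{\ge0}$ with $\Delta+m\subset\Delta$ and $\Delta+n\subset\Delta$. For such $\Delta$ put $\overline\Delta=\mathbb{Z}_{\ge0}\setminus\Delta$, $n\text{-}\mathrm{gen}(\Delta)=\{k\in\Delta:k-n\notin\Delta\}$, $\mathrm{cogen}_{\ge0}(\Delta)=\{k\in\mathbb{Z}_{\ge0}\setminus\Delta: k+n\in\Delta,\ k+m\in\Delta\}$, $\xi_k(\Delta)=|\{x\in n\text{-}\mathrm{gen}(\Delta): n+k+1\le x\le n+k+m\}|$ for $k\in\mathbb{Z}$, $\mathrm{area}'(\Delta)=|\overline\Delta\cap\mathbb{Z}_{\ge n+m}|$, and $$\mathrm{codinv}'(\Delta)=\sum_{x\in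 n\text{-}\mathrm{gen}(\Delta)}|\overline\Delta\cap\mathbb{Z}_{\ge n+m}\cap[x,x+m-1]|-\binom{\xi_{-1}(\Delta)}{2}.$$ Let $\mathbf{w}(m,n,\ell)=(w_0,\dots,w_{m+n-1})\in\{0,1\}^{m+n}$ with $w_i=1$ iff $i+mn-\ell-(n+m)\in\Gamma_{m,n}$, and let $\mathrm{Inv}_{\mathbf{w}(m,n,\ell)}$ be the set of $\Delta\in\mathrm{Inv}_{m,n}$ such that for $0\le i\le m+n-1$: $i\in\Delta$ iff $w_i=1$. Then $$S_{m,n,\ell}(q,t,a)=t^{|\tau_{m,n,\ell}|}\sum_{\Delta\in\mathrm{Inv}_{\mathbf{w}(m,n,\ell)}}q^{\mathrm{area}'(\Delta)}t^{-\mathrm{codinv}'(\Delta)}\prod_{k\in\mathrm{cogen}_{\ge0}(\Delta)}\bigl(1+at^{-\xi_k(\Delta)}\bigr).$$ *)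

(* Defs.v *)
From HB Require Import structures.
From mathcomp Require Import all_boot all_order all_algebra.
From mathcomp Require Import finmap.
From mathcomp Require Import boolp classical_sets cardinality fsbigop.
From mathcomp Require Import mpoly.

Set Implicit Arguments.
Unset Strict Implicit.
Unset Printing Implicit Defensive.

Import Order.TTheory GRing.Theory Num.Theory.

Local Open Scope classical_set_scope.
Local Open Scope ring_scope.

(* Cardinality of a finite set. Beware that an infinite set gets 0; for
   [0 < l < m * n] every [D] in [Inv_w m n l] is cofinite in the nonnegative
   integers, so all the sets measured below are then finite, and so is
   [Inv_w m n l] itself. The latter matters because [\sum_(i \in A)] and
   [\big[*%R/1]_(i \in A)] over a classical set are trivial when the support of the
   general term is infinite. *)
Definition fcard (T : choiceType) (A : set T) : nat := #|` fset_set A|.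

Definition tau (m n l : nat) : set (nat * nat) :=
  [set p | (1 <= p.1)%N /\ (1 <= p.2)%N /\ (n * p.1 + m * p.2 <= l)%N].

Definition Gamma (m n : nat) : set int :=
  [set k | exists x y : nat, k = n%:Z * x%:Z + m%:Z * y%:Z].

Definition int_ge (b : int) : set int := [set k | b <= k].

Definition Inv (m n : nat) : set (set int) :=
  [set D | D `<=` int_ge 0 /\
    (forall k, D k -> D (k + m%:Z)) /\ (forall k, D k -> D (k + n%:Z))].

Definition co (D : set int) : set int := int_ge 0 `\` D.

Definition ngen (n : nat) (D : set int) : set int :=
  [set k | D k /\ ~ D (k - n%:Z)].

Definition cogen (m n : nat) (D : set int) : set int :=
  [set k | co D k /\ D (k + n%:Z) /\ D (k + m%:Z)].

Definition xi (m n : nat) (D : set int) (k : int) : nat :=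
  fcard (ngen n D `&`
         [set x | n%:Z + k + 1 <= x /\ x <= n%:Z + k + m%:Z]).

Definition area' (m n : nat) (D : set int) : nat :=
  fcard (co D `&` int_ge (n%:Z + m%:Z)).

Definition codinv' (m n : nat) (D : set int) : int :=
  (\sum_(x \in ngen n D)
     (fcard (co D `&` int_ge (n%:Z + m%:Z) `&`
             [set k | x <= k /\ k <= x + m%:Z - 1]))%:Z)
  - ('C(xi m n D (-1), 2))%:Z.

Definition w (m n l : nat) (i : 'I_(m + n)) : bool :=
  `[< Gamma m n (i%:Z + m%:Z * n%:Z - l%:Z - (n%:Z + m%:Z)) >].

Definition Inv_w (m n l : nat) : set (set int) :=
  [set D | Inv m n D /\ forall i : 'I_(m + n), D i%:Z <-> w l i].

(* Negative powers of $t$ occur, so everything takes place in the field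
   Q(q, t, a), the fraction field of Z[q, t, a]. *)
Definition Qqta : fieldType := {fraction {mpoly int[3]}}.

Definition varq : Qqta := tofrac ('X_(0 : 'I_3) : {mpoly int[3]}).
Definition vart : Qqta := tofrac ('X_(1 : 'I_3) : {mpoly int[3]}).
Definition vara : Qqta := tofrac ('X_(2 : 'I_3) : {mpoly int[3]}).

Definition Schroder (m n l : nat) : Qqta :=
  vart ^+ fcard (tau m n l) *
  \sum_(D \in Inv_w m n l)
     varq ^+ area' m n D * vart ^ (- codinv' m n D) *
     \big[*%R/1]_(k \in cogen m n D) (1 + vara * vart ^- xi m n D k).

(* Main.v *)
From HB Require Import structures.
Require Import Defs.
From mathcomp Require Import all_boot all_order all_algebra.
From mathcomp Require Import finmap.
From mathcomp Require Import boolp classical_sets cardinality fsbigop.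
From mathcomp Require Import mpoly.
From mathcomp Require Import zify ring lra.

(** Fix the partition tau cut out by the line.  A module in the index set of
the sum consists of the nonnegative numbers that are not of the form
[l - (n x + m y)] and of those whose point [(x, y)] belongs to a partition [lam]
contained in tau ([Delta], [Delta_surj]).  So the sum runs over these
partitions, and choosing one of the two terms in each factor of the product over
cogenerators amounts to marking some of the corners where a box can be added to
[lam].  Marked partitions are Schroeder paths: words in a south step S, a
diagonal step D (a marked corner) and an east step E, read from [(0, R)] to
[(C, 0)].  The exponent of q is [|tau| - |lam|], and the exponent of t turns
out to be the number of pairs of steps, X before Y, with [Y < X] for the order
[S < D < E], such that Y starts no lower and ends strictly lower than X, where
height is measured by the linear form [n x + m y].  This is [Schroder_words],
which rests on [dinvP_formula] and [Perc_eq].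

Everything on the side of words makes sense for an arbitrary form [A x + B y]
that cuts tau, and the claim becomes that the generating function [ZP] is the
same for all these forms ([ZP_slope]).  Let [ZM] be the variant of [ZP] in
which ties are broken the other way: starts strictly higher, ends no higher.
Rotate the form from [(A, B)] to [(A', B')].  If no lattice vector of the
rectangle changes sides, then every single word has the same statistic with the [ZP]
convention before the rotation and the [ZM] convention after it
([pairs_slope]).  If some vector does change sides, then the form that
vanishes on it is a positive combination of the two given ones, so it cuts tau
as well ([cut_mid]), and one passes through it; induction on the number of
such vectors gives [ZP_ZM_slopes], once [ZP = ZM] is known for each single
form.

That equality, [ZP_ZM], is the heart.  Adding trivial S steps at the start and
E steps at the end, one may assume that both ends of the words have the same
level, so a word is a closed walk on the levels.  The multiset of its steps
(starting level and letter) determines the area, the number of marks, whether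
the path stays inside tau, and also the number of pairs counted by the strict
inequalities alone ([strict_perm]).  What distinguishes [ZP] from [ZM] is then
the number of inversions between letters leaving the same level, versus the
number of inversions between letters arriving at the same level.  Over all
closed walks with a given multiset of steps these two are equidistributed
([tours_dep_arr]).  Indeed a t-analogue of the theorem of de Bruijn, van
Aardenne-Ehrenfest, Smith and Tutte ([best_theorem]) evaluates the first sum as a
product of t-factorials times the determinant of a weighted Laplacian; reading
words backwards, the second sum is of the same kind, and its Laplacian is the
transpose of the first one conjugated by a diagonal matrix of powers of t.
The exponents of that matrix are an explicit function on the levels
([gaugeH]). *)

Set Implicit Arguments.
Unset Strict Implicit.
Unset Printing Implicit Defensive.

Import Order.TTheory GRing.Theory Num.Theory.

Local Open Scope ring_scope.

(** * Walks and a t-analogue of the BEST theorem *)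

Section Walks.
Variables (V : zmodType) (I : finType) (d : I -> V).

Fixpoint edges (z : V) (w : seq I) : seq (V * I) :=
  if w is X :: w' then (z, X) :: edges (z + d X) w' else [::].

Definition endp (z : V) (w : seq I) : V := z + \sum_(X <- w) d X.

(** Counts the pairs of steps X before Y with [F X v Y], where [v] is the
displacement from the start of X to the start of Y. *)
Definition pairs (F : I -> V -> I -> bool) : V -> seq I -> nat :=
  fix loop z w := if w is X :: w'
    then (count (fun e : V * I => F X (e.1 - z)%R e.2) (edges (z + d X)%R w')
          + loop (z + d X)%R w')%N
    else 0%N.

Fixpoint words (n : nat) : seq (seq I) :=
  if n is n'.+1 then [seq X :: w | X <- enum I, w <- words n'] else [:: [::]].

Lemma mem_words n w : (w \in words n) = (size w == n).
Proof.
elim: n w => [|n IH] [|X w] //=.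
- by apply/negbTE/negP => /allpairsP [[Y v] [_ _ /=]].
rewrite eqSS -IH; apply/allpairsP/idP => [[[Y v] [_ /= vw [_ ->]]] //|ww].
by exists (X, w); rewrite mem_enum.
Qed.

Lemma uniq_words n : uniq (words n).
Proof.
elim: n => // n IH /=; apply: allpairs_uniq => //; first exact: enum_uniq.
by move=> [X w] [Y v] /= _ _ [-> ->].
Qed.

Lemma big_words_cons (K : nmodType) n (P : pred (seq I)) (F : seq I -> K) :
  \sum_(w <- words n.+1 | P w) F w =
  \sum_(X : I) \sum_(w <- words n | P (X :: w)) F (X :: w).
Proof.
rewrite big_mkcond /= big_allpairs_dep /= big_enum /=.
by apply: eq_bigr => X _; rewrite [RHS]big_mkcond.
Qed.

End Walks.
Arguments endp {V I}.

Section Best.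
Variables (K : fieldType) (t : K).

Definition qn (k : nat) : K := \sum_(i < k) t ^+ i.
Definition qfact (k : nat) : K := \prod_(i < k) qn i.+1.

Lemma qn0 : qn 0 = 0. Proof. by rewrite /qn big_ord0. Qed.
Lemma qn1 : qn 1 = 1. Proof. by rewrite /qn big_ord1. Qed.
Lemma qnD a b : qn (a + b) = qn a + t ^+ a * qn b.
Proof.
rewrite /qn big_split_ord /=; congr (_ + _); rewrite mulr_sumr.
by apply: eq_bigr => i _; rewrite exprD.
Qed.
Lemma qfact0 : qfact 0 = 1. Proof. by rewrite /qfact big_ord0. Qed.
Lemma qfactS k : qfact k.+1 = qn k.+1 * qfact k.
Proof. by rewrite /qfact big_ord_recr /= mulrC. Qed.

Variables (I : finType) (p : nat).
Notation V := 'I_p.+2.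
Variables (d : I -> V) (r : V) (lt : rel I).

Definition content z w : {ffun V * I -> nat} :=
  [ffun e => count_mem e (edges d z w)].

(** Inversions between letters that leave the same point: the larger letter
leaves first. *)
Definition dep := pairs d (fun X z Y => (z == 0) && lt Y X).

Definition outdeg (c : {ffun V * I -> nat}) (v : V) := (\sum_X c (v, X))%N.
Definition indeg (c : {ffun V * I -> nat}) (v : V) := (\sum_X c ((v - d X)%R, X))%N.

(** The flow condition satisfied by the contents of walks from [u] to [r]. *)
Definition balanced c (u : V) :=
  forall v : V, (outdeg c v + (v == r) = indeg c v + (v == u))%N.

(** The inversions that X creates as the first exit from [v] that remains, times
a t-number for the choice of one of the [c (v, X)] copies of X. *)
Definition firstw (c : {ffun V * I -> nat}) (v : V) X : K :=
  t ^+ (\sum_(Y | lt Y X) c (v, Y)) * qn (c (v, X)).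

(** The same as [firstw] for the last exit from [v]; along a walk that ends at
[r], the last exits from the other points form a tree. *)
Definition lastw (c : {ffun V * I -> nat}) (v : V) X : K :=
  t ^+ (\sum_(Y | lt X Y) c (v, Y)) * qn (c (v, X)).

(** The Laplacian with root [r].  Rows without exits, and the row and column
of the root, are those of the identity, so that one matrix size serves for all
supports. *)
Definition lap c : 'M[K]_p.+2 := \matrix_(v, w)
  if [|| v == r, w == r | outdeg c v == 0%N] then (v == w)%:R
  else (v == w)%:R * qn (outdeg c v) - \sum_(X | v + d X == w) lastw c v X.

Definition walk_gf n u c : K :=
  \sum_(w <- words I n | content u w == c) t ^+ dep u w.

Definition rem_edge (c : {ffun V * I -> nat}) e0 : {ffun V * I -> nat} :=
  [ffun e => c e - (e == e0)]%N.

Lemma content_cons u X w :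
  content u (X :: w) = [ffun e => (e == (u, X)) + content (u + d X) w e]%N.
Proof. by apply/ffunP => e; rewrite !ffunE /= [X in (X + _)%N]/= eq_sym. Qed.

Lemma content_consE u X w c : (content u (X :: w) == c) =
  (0 < c (u, X))%N && (content (u + d X) w == rem_edge c (u, X)).
Proof.
rewrite content_cons; apply/eqP/andP => [<-|[c0 /eqP E]].
  rewrite !ffunE eqxx; split=> //; apply/eqP/ffunP => e.
  by rewrite !ffunE addKn.
apply/ffunP => e; rewrite ffunE E ffunE.
by case: eqP => [->|_] //=; rewrite ?subn0 // addnBA ?add1n ?subSS ?subn0.
Qed.

Lemma rem_edgeK (c : {ffun V * I -> nat}) e0 e : (0 < c e0)%N -> c e = (rem_edge c e0 e + (e == e0))%N.
Proof. by move=> c0; rewrite ffunE; case: eqP => [->|_]; rewrite ?subn0 ?addn0 ?subnK. Qed.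

Hypothesis lt_irr : irreflexive lt.
Hypothesis chain_lt : forall c : I -> nat,
  \sum_X t ^+ (\sum_(Y | lt Y X) c Y) * qn (c X) = qn (\sum_X c X).
Hypothesis chain_gt : forall c : I -> nat,
  \sum_X t ^+ (\sum_(Y | lt X Y) c Y) * qn (c X) = qn (\sum_X c X).

Lemma count_star (u : V) (P : pred I) (s : seq (V * I)) :
  count (fun e : V * I => (e.1 - u == 0) && P e.2) s = (\sum_(Y | P Y) count_mem (u, Y) s)%N.
Proof.
elim: s => [|[v Y] s IH] /=; first by rewrite big1.
rewrite big_split /= -IH; congr (_ + _)%N; rewrite subr_eq0.
under [X in _ = X]eq_bigr do rewrite xpair_eqE.
case: (eqVneq v u) => [_|_] /=; last by rewrite big1.
case PY: (P Y); last by rewrite big1 // => Z PZ; case: eqP => // E; rewrite E PZ in PY.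
by rewrite (bigD1 Y) //= eqxx big1 // => Z /andP[_ /negPf]; rewrite eq_sym => ->.
Qed.

Lemma dep_cons u X w c : content u (X :: w) = c ->
  dep u (X :: w) = (\sum_(Y | lt Y X) c (u, Y) + dep (u + d X)%R w)%N.
Proof.
move=> <-; rewrite /dep /= (count_star u (fun Y => lt Y X)); congr (_ + _)%N.
apply: eq_bigr => Y ltYX; rewrite content_cons !ffunE xpair_eqE eqxx /=.
by case: eqP ltYX => [->|//]; rewrite lt_irr.
Qed.

(** Splitting off the first step: it is responsible for all the inversions
with smaller letters that leave the same point later. *)
Lemma walk_gf_rec n u c : walk_gf n.+1 u c =
  \sum_(X | (0 < c (u, X))%N) t ^+ (\sum_(Y | lt Y X) c (u, Y)) *
     walk_gf n (u + d X) (rem_edge c (u, X)).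
Proof.
rewrite /walk_gf big_words_cons [RHS]big_mkcond; apply: eq_bigr => X _.
rewrite (eq_bigl _ _ (fun w => content_consE u X w c)).
case: ifP => c0; last by rewrite big_pred0_eq.
rewrite mulr_sumr; apply: eq_bigr => w /eqP E.
rewrite (@dep_cons u X w c) ?exprD //.
by apply/eqP; rewrite content_consE c0 E eqxx.
Qed.

Lemma rem_edge_sum (J : finType) (P : pred J) (g : J -> V * I) (c : {ffun V * I -> nat}) e0 :
  (0 < c e0)%N ->
  (\sum_(j | P j) c (g j) = \sum_(j | P j) rem_edge c e0 (g j) + \sum_(j | P j) (g j == e0))%N.
Proof. by move=> c0; rewrite -big_split; apply: eq_bigr => j _; apply: rem_edgeK. Qed.

Lemma outdeg_rem (c : {ffun V * I -> nat}) (u : V) X v : (0 < c (u, X))%N ->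
  outdeg c v = (outdeg (rem_edge c (u, X)) v + (v == u))%N.
Proof.
move=> c0; rewrite /outdeg (rem_edge_sum predT (fun X => (v, X)) c0); congr (_ + _)%N.
rewrite (bigD1 X) //= big1 ?addn0 => [|Y /negPf nY]; rewrite xpair_eqE ?nY ?andbF //.
by rewrite eqxx andbT.
Qed.

Lemma indeg_rem (c : {ffun V * I -> nat}) (u : V) X v : (0 < c (u, X))%N ->
  indeg c v = (indeg (rem_edge c (u, X)) v + (v == (u + d X)%R))%N.
Proof.
move=> c0; rewrite /indeg (rem_edge_sum predT (fun X => (v - d X, X)%R) c0); congr (_ + _)%N.
rewrite (bigD1 X) //= big1 ?addn0 => [|Y /negPf nY]; rewrite xpair_eqE ?nY ?andbF //.
by rewrite eqxx andbT subr_eq.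
Qed.

Lemma balanced_rem (c : {ffun V * I -> nat}) (u : V) X : (0 < c (u, X))%N -> balanced c u ->
  balanced (rem_edge c (u, X)) (u + d X).
Proof.
move=> c0 bal v; have := bal v.
rewrite (outdeg_rem v c0) (indeg_rem v c0); lia.
Qed.

Lemma qprod_rem (c : {ffun V * I -> nat}) e0 : (0 < c e0)%N ->
  \prod_e qfact (c e) = qn (c e0) * \prod_e qfact (rem_edge c e0 e).
Proof.
move=> c0; rewrite (bigD1 e0) //= [in RHS](bigD1 e0) //= mulrA; congr (_ * _).
  by rewrite ffunE eqxx subn1 -[in LHS](prednK c0) qfactS prednK.
by apply: eq_bigr => e /negPf ne; rewrite ffunE ne subn0.
Qed.

Lemma firstw0 (c : {ffun V * I -> nat}) (u : V) X : (0 < c (u, X))%N = false -> firstw c u X = 0.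
Proof. by case E: (c (u, X)) => // _; rewrite /firstw E qn0 mulr0. Qed.

Lemma lastw0 (c : {ffun V * I -> nat}) (u : V) X : (0 < c (u, X))%N = false -> lastw c u X = 0.
Proof. by case E: (c (u, X)) => // _; rewrite /lastw E qn0 mulr0. Qed.

(** Removing a first exit X and removing a last exit Y commute.  Relative to the
product of the two weights, either order loses one power of t exactly when
[Y < X]: the inversion between these two exits would be counted twice. *)
Lemma first_last (c : {ffun V * I -> nat}) (u : V) X Y : (0 < c (u, X))%N -> (0 < c (u, Y))%N ->
  firstw c u X * lastw (rem_edge c (u, X)) u Y =
  lastw c u Y * firstw (rem_edge c (u, Y)) u X.
Proof.
move=> cX cY; rewrite /firstw /lastw.
have s1 : (\sum_(Z | lt Y Z) c (u, Z) = \sum_(Z | lt Y Z) rem_edge c (u, X) (u, Z) + lt Y X)%N.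
  rewrite (rem_edge_sum _ (fun X => (u, X)) cX); congr (_ + _)%N.
  under eq_bigr do rewrite xpair_eqE eqxx /=.
  case E: (lt Y X); last by rewrite big1 // => Z; case: eqP => // ->; rewrite E.
  by rewrite (bigD1 X) //= eqxx big1 // => Z /andP[_ /negPf ->].
have s2 : (\sum_(Z | lt Z X) c (u, Z) = \sum_(Z | lt Z X) rem_edge c (u, Y) (u, Z) + lt Y X)%N.
  rewrite (rem_edge_sum _ (fun X => (u, X)) cY); congr (_ + _)%N.
  under eq_bigr do rewrite xpair_eqE eqxx /=.
  case E: (lt Y X); last by rewrite big1 // => Z; case: eqP => // ->; rewrite E.
  by rewrite (bigD1 Y) //= eqxx big1 // => Z /andP[_ /negPf ->].
have s3 : qn (c (u, X)) * qn (rem_edge c (u, X) (u, Y)) =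
  qn (c (u, Y)) * qn (rem_edge c (u, Y) (u, X)).
  rewrite !ffunE !xpair_eqE !eqxx /= [Y == X]eq_sym.
  by case: (eqVneq X Y) => [->//|_]; rewrite !subn0 mulrC.
by rewrite s1 s2 !exprD mulrACA s3; ring.
Qed.
Lemma first_last_sum (c : {ffun V * I -> nat}) (u : V) k Y : outdeg c u = k.+1 ->
  \sum_X firstw c u X * lastw (rem_edge c (u, X)) u Y = qn k * lastw c u Y.
Proof.
move=> ck; case cY: (0 < c (u, Y))%N; last first.
  rewrite (lastw0 cY) mulr0 big1 // => X _; rewrite (lastw0 (u := u)) ?mulr0 //.
  by move: cY; rewrite ffunE; case: (c _).
have dk : outdeg (rem_edge c (u, Y)) u = k.
  by have := outdeg_rem u cY; rewrite ck eqxx addn1 => -[].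
rewrite -dk /outdeg -chain_lt mulr_suml; apply: eq_bigr => X _.
case cX: (0 < c (u, X))%N; first by rewrite first_last // mulrC.
rewrite (firstw0 cX) mul0r (_ : rem_edge _ _ (u, X) = 0%N) ?qn0 ?mulr0 ?mul0r //.
by rewrite ffunE; move: cX; case: (c _).
Qed.

Lemma lap_row_rem (c : {ffun V * I -> nat}) (u v : V) X w : (0 < c (u, X))%N ->
  v != u -> lap (rem_edge c (u, X)) v w = lap c v w.
Proof.
move=> c0 vu; rewrite !mxE.
have -> : outdeg (rem_edge c (u, X)) v = outdeg c v.
  by rewrite (outdeg_rem v c0) (negPf vu) addn0.
have E Y : rem_edge c (u, X) (v, Y) = c (v, Y).
  by rewrite ffunE xpair_eqE (negPf vu) subn0.
congr (if _ then _ else _ - _); apply: eq_bigr => Y _.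
rewrite /lastw E; congr (t ^+ _ * _); exact: eq_bigr.
Qed.

(** Averaging the row of [u] over the choice of the first exit multiplies
it by a t-number: this follows from [first_last_sum] entry by entry. *)
Lemma lap_row_avg (c : {ffun V * I -> nat}) (u w : V) k : u != r -> outdeg c u = k.+2 ->
  \sum_X firstw c u X * lap (rem_edge c (u, X)) u w = qn k.+1 * lap c u w.
Proof.
move=> ur ck; rewrite [in RHS]mxE (negPf ur) ck /=.
rewrite (eq_bigr (fun X => firstw c u X * (if w == r then (u == w)%:R else
   (u == w)%:R * qn k.+1 - \sum_(Y | u + d Y == w) lastw (rem_edge c (u, X)) u Y))); last first.
  move=> X _; case cX: (0 < c (u, X))%N; last by rewrite (firstw0 cX) !mul0r.
  rewrite mxE (negPf ur) (_ : outdeg _ _ = k.+1) ?orbF //.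
  by have := outdeg_rem u cX; rewrite ck eqxx addn1 => -[].
have tot : \sum_X firstw c u X = qn k.+2 by rewrite chain_lt -/(outdeg c u) ck.
rewrite orbF; case: (eqVneq w r) => [wr|_].
  by rewrite wr (negPf ur) mulr0 big1 // => X _; rewrite mulr0.
under eq_bigr do rewrite mulrBr.
rewrite sumrB -mulr_suml tot mulrBr; congr (_ - _); first by ring.
under [X in X = _]eq_bigr do rewrite mulr_sumr.
rewrite exchange_big /= mulr_sumr; apply: eq_bigr => Y _.
exact: first_last_sum.
Qed.

Lemma cofactor_rem (c : {ffun V * I -> nat}) (u : V) X w : (0 < c (u, X))%N ->
  cofactor (lap (rem_edge c (u, X))) u w = cofactor (lap c) u w.
Proof.
move=> c0; rewrite /cofactor; congr (_ * \det _); apply/matrixP => i j.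
rewrite [LHS]mxE [LHS]mxE [RHS]mxE [RHS]mxE.
by apply: lap_row_rem => //; rewrite eq_sym neq_lift.
Qed.

(** Removing an exit from [u] changes only the row of [u], so the averaging
of rows passes to determinants by expansion along that row. *)
Lemma det_lap_step (c : {ffun V * I -> nat}) (u : V) k : u != r -> outdeg c u = k.+2 ->
  \sum_X firstw c u X * \det (lap (rem_edge c (u, X))) = qn k.+1 * \det (lap c).
Proof.
move=> ur ck; rewrite (expand_det_row (lap c) u) mulr_sumr.
rewrite (eq_bigr (fun X => \sum_w firstw c u X * lap (rem_edge c (u, X)) u w *
    cofactor (lap c) u w)).
  rewrite exchange_big /=; apply: eq_bigr => w _.
  by rewrite mulrA -(lap_row_avg w ur ck) mulr_suml.
move=> X _; case cX: (0 < c (u, X))%N.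
  rewrite (expand_det_row _ u) mulr_sumr; apply: eq_bigr => w _.
  by rewrite cofactor_rem // mulrA.
by rewrite (firstw0 cX) mul0r big1 // => w _; rewrite !mul0r.
Qed.

(** When [u] has one exit and no entry, its column is a unit vector before
and after the removal. *)
Lemma det_lap_exit (c : {ffun V * I -> nat}) (u : V) X : u != r -> (0 < c (u, X))%N ->
  outdeg c u = 1%N -> indeg c u = 0%N ->
  \det (lap (rem_edge c (u, X))) = \det (lap c).
Proof.
move=> ur cX o1 i0.
have nin v Y : v + d Y = u -> c (v, Y) = 0%N.
  move=> E; move/eqP: i0; rewrite /indeg sum_nat_eq0 => /forallP /(_ Y).
  by rewrite -E addrK => /eqP.
have colu v : lap c v u = (v == u)%:R.
  rewrite mxE; case: ifP => // /norP[_ /norP[_ _]].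
  rewrite big1 ?subr0 => [|Y /eqP E]; last by rewrite (lastw0 (u := v)) // (nin v Y E).
  by case: eqP => [->|_]; rewrite ?mul0r // o1 qn1 mulr1.
have colu' v : lap (rem_edge c (u, X)) v u = (v == u)%:R.
  case: (eqVneq v u) => [->|vu]; last by rewrite lap_row_rem // colu (negPf vu).
  have o0 : outdeg (rem_edge c (u, X)) u = 0%N.
    by have := outdeg_rem u cX; rewrite o1 eqxx addn1 => -[].
  by rewrite mxE o0 !eqxx !orbT.
rewrite (expand_det_col _ u) [RHS](expand_det_col _ u).
rewrite (bigD1 u) //= [in RHS](bigD1 u) //= colu colu' eqxx !mul1r cofactor_rem //.
by congr (_ + _); rewrite !big1 // => v /negPf vu; rewrite ?colu ?colu' vu mul0r.
Qed.

(** If no step leaves the root, no walk can use the remaining steps; the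
Laplacian is singular because it annihilates the indicator vector of the points
with exits. *)
Lemma det_lap_unreached (c : {ffun V * I -> nat}) : balanced c r -> outdeg c r = 0%N ->
  (0 < \sum_e c e)%N -> \det (lap c) = 0.
Proof.
move=> bal o0 c0; apply/eqP; rewrite -det_tr; apply/det0P.
exists (\row_v (outdeg c v != 0%N)%:R).
  apply/eqP => /rowP E.
  have [[v X] cv] : exists e, (0 < c e)%N.
    apply/existsP; rewrite -[X in is_true X]negbK negb_exists; apply/negP => /forallP H.
    by move: c0; rewrite big1 // => e _; apply/eqP; rewrite -leqn0 leqNgt H.
  have := E v; rewrite !mxE; case: eqP => [z|_ /eqP]; last by rewrite oner_eq0.
  by move: cv; rewrite (eqP (_ : c (v, X) == 0%N)) //; move/eqP: z; rewrite sum_nat_eq0 => /forallP /(_ X).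
apply/rowP => v; rewrite !mxE.
case: (boolP ((v == r) || (outdeg c v == 0%N))) => Hv.
  rewrite big1 // => w _; rewrite !mxE.
  case: (eqVneq v w) => [<-|vw].
    by case: (eqVneq v r) Hv => [->|_ /= /eqP ->]; rewrite ?o0 ?eqxx ?mul0r.
  by case/orP: Hv => ->; rewrite ?orbT /= mulr0.
move/norP: Hv => [vr ov].
rewrite (eq_bigr (fun w => (v == w)%:R * qn (outdeg c v) -
    \sum_(X | v + d X == w) lastw c v X)).
  rewrite sumrB -mulr_suml.
  rewrite (bigD1 v) //= eqxx big1 ?addr0 ?mul1r; last by move=> w /negPf; rewrite eq_sym => ->.
  rewrite (exchange_big_dep predT) //= /outdeg -chain_gt -sumrB big1 // => X _.
  by rewrite (big_pred1 (v + d X)) ?subrr // => w; rewrite eq_sym.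
move=> w _; rewrite !mxE (negPf vr) (negPf ov) orbF /=.
have tgt X : v + d X = w -> (0 < c (v, X))%N -> outdeg c w != 0%N.
  move=> E cX; have := bal w; move=> /addIn ->; rewrite /indeg (bigD1 X) //= -E addrK.
  by rewrite addn_eq0 negb_and -lt0n cX.
case: (eqVneq (outdeg c w) 0%N) => [ow|ow].
  rewrite mul0r; case: (eqVneq v w) => [vw|_]; first by rewrite vw ow eqxx in ov.
  rewrite mul0r sub0r big1 ?oppr0 // => X /eqP E; apply: lastw0; apply/negbTE/negP => cX.
  by have := tgt X E cX; rewrite ow.
by rewrite mul1r; case: (eqVneq w r) ow => [->|//]; rewrite o0.
Qed.

(** Induction on the walk, by removing its first step.  If it starts at the
root, the determinant is unchanged and the weights [firstw] add up to a
t-number by the chain identity; if it starts elsewhere, the t-number comes from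
[det_lap_step], which is why one factor less appears at such a point.  The
limiting cases are [det_lap_exit], when the walk leaves its starting point for
good, and [det_lap_unreached]. *)
Theorem best_theorem n u c : balanced c u -> (\sum_e c e = n)%N ->
  walk_gf n u c * \prod_e qfact (c e) =
  (\prod_v qfact (outdeg c v - (v != r))) * \det (lap c).
Proof.
elim: n u c => [|n IH] u c bal tot.
  have c0 e : c e = 0%N.
    by apply/eqP; move/eqP: tot; rewrite sum_nat_eq0 => /forallP /(_ e).
  have o0 v : outdeg c v = 0%N by rewrite /outdeg big1.
  rewrite /walk_gf /= big_cons big_nil /= (_ : content u [::] == c) ?expr0 ?addr0 ?mul1r; last first.
    by apply/eqP/ffunP => e; rewrite ffunE c0.
  rewrite !big1 => [|v _|e _]; rewrite ?o0 ?c0 ?qfact0 //.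
  rewrite mul1r (_ : lap c = 1%:M) ?det1 //.
  by apply/matrixP => v w; rewrite !mxE o0 eqxx !orbT.
have -> : walk_gf n.+1 u c * \prod_e qfact (c e) =
    \sum_X firstw c u X * ((\prod_v qfact (outdeg c v - (v == u) - (v != r))) *
      \det (lap (rem_edge c (u, X)))).
  rewrite walk_gf_rec big_mkcond mulr_suml; apply: eq_bigr => X _.
  case: ifP => cX; last by rewrite (firstw0 cX) !mul0r.
  rewrite (qprod_rem cX) mulrACA (IH _ _ (balanced_rem cX bal)).
    rewrite -/(firstw c u X); congr (_ * (_ * _)); apply: eq_bigr => v _.
    by rewrite (outdeg_rem v cX) addnK.
  apply/eqP; rewrite -eqSS -tot; apply/eqP.
  rewrite (rem_edge_sum predT id cX) -addn1; congr (_ + _)%N.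
  by rewrite (bigD1 (u, X)) //= eqxx big1 // => e /negPf ->.
case: (eqVneq (outdeg c u) 0%N) => ou.
  have ur : u = r.
    by apply/eqP; have := bal u; rewrite ou eqxx; case: (u == r) => //; lia.
  rewrite -ur in bal *; rewrite det_lap_unreached ?tot -?ur // mulr0 big1 // => X _.
  by rewrite (firstw0 (u := u)) ?mul0r //; move/eqP: ou; rewrite sum_nat_eq0 => /forallP /(_ X) /eqP ->.
have pref : \prod_v qfact (outdeg c v - (v == u) - (v != r)) =
    qfact (outdeg c u - 1 - (u != r)) * \prod_(v | v != u) qfact (outdeg c v - (v != r)).
  rewrite (bigD1 u) //= eqxx; congr (_ * _).
  by apply: eq_bigr => v /negPf ->; rewrite subn0.
under [X in X = _]eq_bigr do rewrite mulrCA.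
rewrite -mulr_sumr pref [in RHS](bigD1 u) //= {pref}.
case: (eqVneq u r) => [ur|ur] /=.
  rewrite mulrAC [RHS]mulrAC; congr (_ * _).
  rewrite subn0.
  have -> : \sum_X firstw c u X * \det (lap (rem_edge c (u, X))) =
            \sum_X firstw c u X * \det (lap c).
    apply: eq_bigr => X _; case cX: (0 < c (u, X))%N; last by rewrite (firstw0 cX) !mul0r.
    congr (_ * \det _); apply/matrixP => v w; case: (eqVneq v u) => [->|vu].
      by rewrite !mxE ur eqxx.
    exact: lap_row_rem.
  rewrite -mulr_suml chain_lt -/(outdeg c u) mulrA; congr (_ * _).
  by rewrite subn0; case E: (outdeg c u) ou => [//|k] _; rewrite subn1 qfactS mulrC.
rewrite mulrAC [RHS]mulrAC; congr (_ * _).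
case E: (outdeg c u) ou => [//|[|k]] _; last first.
  by rewrite /= !subn1 /= (det_lap_step ur E) mulrA qfactS; congr (_ * _); rewrite mulrC.
rewrite /= !subn1 /= qfact0 !mul1r.
have i0 : indeg c u = 0%N by have := bal u; rewrite E (negPf ur) eqxx; lia.
have -> : \sum_X firstw c u X * \det (lap (rem_edge c (u, X))) =
          \sum_X firstw c u X * \det (lap c).
  apply: eq_bigr => X _; case cX: (0 < c (u, X))%N; last by rewrite (firstw0 cX) !mul0r.
  by rewrite det_lap_exit.
by rewrite -mulr_suml chain_lt -/(outdeg c u) E qn1 mul1r.
Qed.
End Best.

(** * Closed walks: departures and arrivals *)

Section WalkTheory.
Variables (V : zmodType) (I : finType) (d : I -> V).
Implicit Types (z v : V) (w : seq I).

Lemma endp_cons z X w : endp d z (X :: w) = endp d (z + d X) w.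
Proof. by rewrite /endp big_cons addrA. Qed.

Lemma endp_nil z : endp d z [::] = z.
Proof. by rewrite /endp big_nil addr0. Qed.

Lemma edges_cat z w1 w2 :
  edges d z (w1 ++ w2) = edges d z w1 ++ edges d (endp d z w1) w2.
Proof.
elim: w1 z => [|X w1 IH] z /=; first by rewrite endp_nil.
by rewrite IH endp_cons.
Qed.

Lemma edges_rcons z w X : edges d z (rcons w X) = rcons (edges d z w) (endp d z w, X).
Proof. by rewrite -cats1 edges_cat cats1. Qed.

Lemma map_snd_edges z w : [seq e.2 | e <- edges d z w] = w.
Proof. by elim: w z => //= X w IH z; rewrite IH. Qed.

Lemma size_edges z w : size (edges d z w) = size w.
Proof. by rewrite -[in RHS](map_snd_edges z w) size_map. Qed.

Lemma pairs_rcons (F : I -> V -> I -> bool) z w X : pairs d F z (rcons w X) =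
  (pairs d F z w + count (fun e : V * I => F e.2 (endp d z w - e.1)%R X) (edges d z w))%N.
Proof.
elim: w z => [|Y w IH] z //=; rewrite IH edges_rcons -cats1 count_cat /= endp_cons.
by rewrite addn0; lia.
Qed.

Lemma perm_edges_endp z w w' : perm_eq (edges d z w) (edges d z w') ->
  endp d z w = endp d z w'.
Proof.
move/(perm_map snd); rewrite !map_snd_edges => pw; congr (z + _); exact: perm_big.
Qed.

(** Every visit of a walk to [v] is entered and left, except at the ends. *)
Lemma flow_balance z w v :
  (count (fun e : V * I => e.1 == v) (edges d z w) + (v == endp d z w) =
   count (fun e : V * I => (e.1 + d e.2)%R == v) (edges d z w) + (v == z))%N.
Proof.
elim: w z => [|X w IH] z /=; first by rewrite endp_nil.
rewrite endp_cons; have := IH (z + d X); rewrite (eq_sym v (z + d X)) (eq_sym v z).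
by move=> E; rewrite -addnA E [RHS]addnC; congr (_ + _)%N; rewrite addnC.
Qed.

End WalkTheory.

Section Reversal.
Variables (V : zmodType) (I : finType) (d : I -> V).
Let nd X := - d X.

Lemma endp_rev z w : endp nd (endp d z w) (rev w) = z.
Proof.
have -> : endp nd (endp d z w) (rev w) = endp nd (endp d z w) w.
  by congr (_ + _); apply: perm_big; rewrite perm_rev.
by rewrite /endp sumrN addrK.
Qed.

Lemma edges_rev z w : edges nd (endp d z w) (rev w) =
  rev [seq (e.1 + d e.2, e.2) | e <- edges d z w].
Proof.
elim: w z => [|X w IH] z //=; rewrite !rev_cons edges_rcons endp_cons IH.
by rewrite endp_rev.
Qed.

(** Reversing a walk exchanges the inversions of departures with those of
arrivals. *)
Lemma pairs_rev (lt : rel I) z w :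
  pairs nd (fun X y Y => (y == 0) && lt X Y) (endp d z w) (rev w) =
  pairs d (fun X y Y => (y + d Y == d X) && lt Y X) z w.
Proof.
elim: w z => [|X w IH] z //=; rewrite rev_cons pairs_rcons endp_cons IH.
rewrite addnC; congr (_ + _)%N; rewrite endp_rev edges_rev count_rev count_map.
apply: eq_count => -[v Y] /=; congr (_ && _).
by rewrite subr_eq0 eq_sym addrAC subr_eq addrC (addrC (d X)).
Qed.
End Reversal.

Section Content.
Variables (I : finType) (p : nat).
Notation V := 'I_p.+2.
Variables (d : I -> V) (r : V).
Let nd X := - d X.
Notation step e := (e.1 + d e.2, e.2).

Lemma content_perm (f : I -> V) u w w' :
  (content f u w == content f u w') = perm_eq (edges f u w) (edges f u w').
Proof.
apply/eqP/idP => [E|/permP E]; last by apply/ffunP => e; rewrite !ffunE E.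
apply/allP => e _ /=; apply/eqP.
by move/ffunP: E => /(_ e); rewrite !ffunE.
Qed.

Lemma sum_content (f : I -> V) u w : (\sum_e content f u w e)%N = size w.
Proof.
rewrite (eq_bigr (fun e => count_mem e (edges f u w))) -?(size_edges f u w);
  last by move=> e _; rewrite ffunE.
elim: (edges f u w) => [|e s IH] /=; first by rewrite big1.
rewrite big_split /= IH (bigD1 e) //= eqxx big1 // => e' /negPf.
by rewrite eq_sym => ->.
Qed.

Lemma outdeg_content (f : I -> V) u w v :
  outdeg (content f u w) v = count (fun e : V * I => e.1 == v) (edges f u w).
Proof.
rewrite /outdeg (eq_bigr (fun X => count_mem (v, X) (edges f u w))); last by move=> X _; rewrite ffunE.
have := count_star v predT (edges f u w); rewrite /= => <-.
by apply: eq_count => e /=; rewrite andbT subr_eq0.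
Qed.

Definition stepinv (e : V * I) := (e.1 - d e.2, e.2).
Lemma stepK : cancel (fun e : V * I => step e) stepinv.
Proof. by case=> v X; rewrite /stepinv /= addrK. Qed.
Lemma stepinvK : cancel stepinv (fun e : V * I => step e).
Proof. by case=> v X; rewrite /stepinv /= subrK. Qed.

Lemma content_rev w e : endp d r w = r ->
  content nd r (rev w) e = content d r w (stepinv e).
Proof.
move=> cl; rewrite !ffunE -[X in edges _ X _]cl edges_rev count_rev count_map.
apply: eq_count => e' /=.
by rewrite -[in LHS](stepinvK e) (inj_eq (can_inj stepK)).
Qed.

Lemma indeg_content w v :
  indeg d (content d r w) v = count (fun e : V * I => e.1 + d e.2 == v) (edges d r w).
Proof.
rewrite /indeg.
rewrite (eq_bigr (fun X => count_mem (v, X) [seq step e | e <- edges d r w])).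
  have := count_star v predT [seq step e | e <- edges d r w]; rewrite /= => <-.
  by rewrite count_map; apply: eq_count => e /=; rewrite andbT subr_eq0.
move=> X _; rewrite ffunE count_map; apply: eq_count => e' /=.
by rewrite -[in RHS](stepinvK (v, X)) (inj_eq (can_inj stepK)).
Qed.

Lemma balanced_content w : endp d r w = r -> balanced d r (content d r w) r.
Proof.
move=> cl v; rewrite outdeg_content indeg_content.
by have := flow_balance d r w v; rewrite cl.
Qed.

End Content.

Section Tours.
Variables (K : fieldType) (t : K).
Hypothesis t_neq0 : t != 0.
Hypothesis qn_neq0 : forall k, qn t k.+1 != 0.
Variables (I : finType) (p : nat).
Notation V := 'I_p.+2.
Variables (d : I -> V) (r : V) (lt : rel I).
Hypothesis lt_irr : irreflexive lt.
Hypothesis chain_lt : forall c : I -> nat,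
  \sum_X t ^+ (\sum_(Y | lt Y X) c Y) * qn t (c X) = qn t (\sum_X c X).
Hypothesis chain_gt : forall c : I -> nat,
  \sum_X t ^+ (\sum_(Y | lt X Y) c Y) * qn t (c X) = qn t (\sum_X c X).
Let nd X := - d X.
Let gt : rel I := fun X Y => lt Y X.
Notation step e := (e.1 + d e.2, e.2).

Lemma big_words_rev n (P : pred (seq I)) (F : seq I -> K) :
  \sum_(w <- words I n | P w) F w = \sum_(w <- words I n | P (rev w)) F (rev w).
Proof.
rewrite -[RHS](big_map rev P F); apply: perm_big; apply: uniq_perm.
- exact: uniq_words.
- by rewrite map_inj_uniq ?uniq_words //; exact: (can_inj revK).
move=> w; rewrite mem_words -{2}[w]revK mem_map ?mem_words ?size_rev //.
exact: (can_inj revK).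
Qed.

Variable w0 : seq I.
Hypothesis closed_w0 : endp d r w0 = r.
Variable H : V -> nat.
Let c := content d r w0.
Hypothesis gauge : forall (v : V) X, (0 < c (v, X))%N ->
  (\sum_(Y | lt X Y) c (v, Y) + H v =
   \sum_(Y | lt Y X) c ((v + d X - d Y)%R, Y) + H (v + d X)%R)%N.

Let c' := content nd r (rev w0).

Lemma cE' v X : c' (v, X) = c (v - d X, X).
Proof. exact: content_rev. Qed.

Lemma closed_rev : endp nd r (rev w0) = r.
Proof. by rewrite -{1}closed_w0 endp_rev. Qed.

Lemma outdegE' v : outdeg c' v = outdeg c v.
Proof.
have bal := balanced_content closed_w0; move: (bal v) => /addIn ->.
by apply: eq_bigr => X _; rewrite cE'.
Qed.

Lemma indeg_c v : indeg d c v = outdeg c v.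
Proof. by move: (balanced_content closed_w0 v) => /addIn ->. Qed.

Lemma content0 (b : {ffun V * I -> nat}) v X : outdeg b v = 0%N -> b (v, X) = 0%N.
Proof. by move/eqP; rewrite sum_nat_eq0 => /forallP /(_ X) /eqP. Qed.

(** The Laplacian of the reversed walk is the transpose of the Laplacian, up
to the gauge [H]. *)
Lemma lap_gauge v w :
  t ^+ H w * lap t d r lt c w v = t ^+ H v * lap t nd r gt c' v w.
Proof.
rewrite !mxE [w == v]eq_sym.
case: (boolP ((v == r) || (w == r))) => [E|/norP[/negPf vr /negPf wr]].
  rewrite orbA [(w == r) || _]orbC E /= orbA E /=.
  by case: eqP => [->|_]; rewrite ?mulr0.
rewrite vr wr /= outdegE'.
have noedge u1 u2 X : u1 + d X = u2 -> outdeg c u1 = 0%N \/ outdeg c u2 = 0%N -> c (u1, X) = 0%N.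
  move=> E [] o0; first exact: content0.
  apply/eqP; move/eqP: o0; rewrite -indeg_c sum_nat_eq0 => /forallP /(_ X).
  by rewrite -E addrK.
have tgtE X : (v + nd X == w) = (w + d X == v) by rewrite subr_eq eq_sym.
have last0 X : w + d X == v -> c (w, X) = 0%N -> lastw t lt c w X = 0 /\ lastw t gt c' v X = 0.
  move=> /eqP E c0; split; apply: lastw0; first by rewrite c0.
  by rewrite cE' -E addrK c0.
have sums0 : outdeg c w = 0%N \/ outdeg c v = 0%N ->
   \sum_(X | w + d X == v) lastw t lt c w X = 0 /\
   \sum_(X | v + nd X == w) lastw t gt c' v X = 0.
  move=> o0; split; apply: big1 => X; rewrite ?tgtE => /eqP E;
  by have [? ?] := last0 X (introT eqP E) (noedge _ _ _ E o0).
case: (eqVneq v w) => [vw|vw].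
  subst w; rewrite !mul1r; case: ifP => // /eqP ov.
  congr (_ * (_ - _)); rewrite (eq_bigl _ _ tgtE); apply: eq_bigr => X /eqP E.
  case cX: (0 < c (v, X))%N; last first.
    by have [|-> ->] := last0 X (introT eqP E); first by move: cX; case: (c _).
  have := gauge cX; rewrite E => /addIn Hg.
  have vX : v - d X = v by rewrite -{1}E addrK.
  rewrite /lastw cE' vX; congr (t ^+ _ * qn t _).
  by rewrite Hg; apply: eq_bigr => Y _; rewrite cE'.
rewrite !mul0r !sub0r.
have [ow|ow] := eqVneq (outdeg c w) 0%N.
  by have [_ ->] := sums0 (or_introl ow); rewrite oppr0 if_same !mulr0.
have [ov|ov] := eqVneq (outdeg c v) 0%N.
  by have [-> _] := sums0 (or_intror ov); rewrite oppr0 !mulr0.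
rewrite !mulrN; congr (- _); rewrite !mulr_sumr (eq_bigl _ _ tgtE).
apply: eq_bigr => X /eqP E.
case cX: (0 < c (w, X))%N; last first.
  by have [|-> ->] := last0 X (introT eqP E); rewrite ?mulr0 //; move: cX; case: (c _).
have wX : v - d X = w by rewrite -E addrK.
rewrite /lastw !mulrA -!exprD cE' wX; congr (t ^+ _ * _).
rewrite [LHS]addnC (gauge cX) E addnC; congr (_ + _)%N.
by apply: eq_bigr => Y _; rewrite cE'.
Qed.

Lemma det_lap_gauge : \det (lap t d r lt c) = \det (lap t nd r gt c').
Proof.
pose D := diag_mx (\row_v t ^+ H v).
have D0 : \det D != 0.
  by rewrite det_diag; apply/prodf_neq0 => v _; rewrite mxE expf_neq0.
apply: (mulfI D0); rewrite -det_mulmx.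
transitivity (\det ((lap t nd r gt c')^T *m D)); last by rewrite det_mulmx det_tr mulrC.
congr (\det _); apply/matrixP => v w.
rewrite mul_diag_mx mul_mx_diag mxE [in RHS]mxE [in RHS]mxE.
by rewrite [X in X * _]mxE [X in _ = _ * X]mxE lap_gauge mulrC.
Qed.

(** Both sums are values of [walk_gf], for the walk and for its reversal with
the opposite order of letters.  In the formula of [best_theorem] the
t-factorials agree because a closed walk enters a point as often as it leaves
it, and the determinants agree by [det_lap_gauge]. *)
Theorem tours_dep_arr n :
  \sum_(w <- words I n | perm_eq (edges d r w) (edges d r w0))
     t ^+ pairs d (fun X z Y => (z == 0) && lt Y X) r w =
  \sum_(w <- words I n | perm_eq (edges d r w) (edges d r w0))
     t ^+ pairs d (fun X z Y => (z + d Y == d X) && lt Y X) r w.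
Proof.
have [nw|nw] := eqVneq n (size w0); last first.
  have E w : w \in words I n -> perm_eq (edges d r w) (edges d r w0) = false.
    rewrite mem_words => /eqP sw; apply/negbTE/negP => /perm_size.
    by rewrite !size_edges sw => E; rewrite E eqxx in nw.
  by rewrite big_seq_cond [RHS]big_seq_cond !big_pred0 // => w; case wn: (w \in _) => //=; rewrite E.
have arrE : \sum_(w <- words I n | perm_eq (edges d r w) (edges d r w0))
     t ^+ pairs d (fun X z Y => (z + d Y == d X) && lt Y X) r w = walk_gf t nd gt n r c'.
  rewrite /walk_gf [RHS]big_words_rev; apply: eq_big => w; last first.
    by move=> pw; rewrite /dep -[in RHS](closed_w0) -(perm_edges_endp pw) pairs_rev.
  rewrite -content_perm; apply/eqP/eqP => E.
    have cl : endp d r w = r.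
      by rewrite -[RHS]closed_w0; apply: perm_edges_endp; rewrite -content_perm E.
    by apply/ffunP => e; rewrite !content_rev // E.
  have cl : endp d r w = r.
    have : endp nd r (rev w) = r.
      by rewrite -[RHS]closed_rev; apply: perm_edges_endp; rewrite -content_perm E.
    have Es : \sum_(X <- rev w) nd X = - \sum_(X <- w) d X.
      by rewrite -sumrN; apply: perm_big; rewrite perm_rev.
    rewrite /endp Es => /eqP.
    by rewrite -subr_eq0 addrAC subrr sub0r oppr_eq0 => /eqP ->; rewrite addr0.
  apply/ffunP => e; move/ffunP: E => /(_ (step e)).
  by rewrite !content_rev // stepK.
rewrite arrE; have -> : \sum_(w <- words I n | perm_eq (edges d r w) (edges d r w0))
     t ^+ pairs d (fun X z Y => (z == 0) && lt Y X) r w = walk_gf t d lt n r c.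
  by rewrite /walk_gf; apply: eq_bigl => w; rewrite content_perm.
have q0 b : \prod_(e : V * I) qfact t (b e) != 0.
  by apply/prodf_neq0 => e _; apply/prodf_neq0 => i _.
apply: (mulIf (q0 c)).
rewrite (best_theorem lt_irr chain_lt chain_gt (balanced_content closed_w0)) ?sum_content //.
have -> : \prod_e qfact t (c e) = \prod_e qfact t (c' e).
  rewrite (reindex (stepinv d)) /=; last by exists (fun e => step e) => e _; rewrite ?stepK ?stepinvK.
  by apply: eq_bigr => -[v X] _; rewrite cE'.
rewrite (best_theorem (d := nd) (lt := gt) lt_irr chain_gt chain_lt (balanced_content closed_rev));
  last by rewrite sum_content size_rev.
  rewrite det_lap_gauge; congr (_ * _); apply: eq_bigr => v _.
  by rewrite outdegE'.
Qed.
End Tours.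

(** * Walks on integers with three steps *)

Definition lS : 'I_3 := @Ordinal 3 0 isT.
Definition lD : 'I_3 := @Ordinal 3 1 isT.
Definition lE : 'I_3 := @Ordinal 3 2 isT.

Variant letter_spec : 'I_3 -> Type :=
| LetterS : letter_spec lS | LetterD : letter_spec lD | LetterE : letter_spec lE.

Lemma letterP X : letter_spec X.
Proof.
case: X => -[|[|[|//]]] i.
- by rewrite (_ : Ordinal i = lS); [constructor | apply: val_inj].
- by rewrite (_ : Ordinal i = lD); [constructor | apply: val_inj].
- by rewrite (_ : Ordinal i = lE); [constructor | apply: val_inj].
Qed.

Lemma big3 (M : nmodType) (P : pred 'I_3) (F : 'I_3 -> M) :
  \sum_(Y | P Y) F Y = (if P lS then F lS else 0) + (if P lD then F lD else 0)
     + (if P lE then F lE else 0).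
Proof.
rewrite big_mkcond !big_ord_recl big_ord0 /= addr0 addrA.
by congr (_ + _ + _); congr (if P _ then F _ else _); apply: val_inj.
Qed.

Definition dn (X : 'I_3) : bool := (X < 2)%N.
Definition rt (X : 'I_3) : bool := (0 < X)%N.

(** The increment along a step of the form [A x + B y]. *)
Definition disp (A B : nat) (X : 'I_3) : int :=
  (if rt X then A%:Z else 0) - (if dn X then B%:Z else 0).

Definition lt_letter : rel 'I_3 := fun X Y => (X < Y)%N.

Section Chain.
Variables (K : fieldType) (t : K).

(** A t-number of a sum splits into blocks, one for each letter, in any order
of the letters; likewise in [chain_gt3]. *)
Lemma chain_lt3 (c : 'I_3 -> nat) :
  \sum_X t ^+ (\sum_(Y | lt_letter Y X) c Y) * qn t (c X) = qn t (\sum_X c X).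
Proof.
rewrite !(big3 (M := K)) !(big3 (M := nat)) /lt_letter /= !qnD !add0r !addr0 ?exprD; ring.
Qed.
Lemma chain_gt3 (c : 'I_3 -> nat) :
  \sum_X t ^+ (\sum_(Y | lt_letter X Y) c Y) * qn t (c X) = qn t (\sum_X c X).
Proof.
rewrite !(big3 (M := K)) !(big3 (M := nat)) /lt_letter /=.
rewrite -[(c lS + c lD + c lE)%R]/(c lS + c lD + c lE)%N.
have -> : (c lS + c lD + c lE = c lE + (c lD + c lS))%N by lia.
rewrite !qnD !add0r ?addr0 ?exprD; ring.
Qed.
End Chain.

(** The gauge counts steps on such progressions; a shift by [n] changes one of
them by a single point ([inrayB]). *)
Definition inray (n : nat) (z : int) : bool := (0 <= z) && (n%:Z %| z)%Z.

Lemma inrayB n z : (0 < n)%N -> (inray n z : nat) = ((z == 0) + inray n (z - n%:Z))%N.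
Proof.
move=> n0; rewrite /inray.
have -> : (n%:Z %| z - n%:Z)%Z = (n%:Z %| z)%Z by rewrite rpredBr ?dvdzz.
case: (eqVneq z 0) => [->|z0]; first by rewrite lexx dvdz0 (_ : (0 <= 0 - n%:Z) = false) //; lia.
case dz: (n%:Z %| z)%Z; rewrite ?andbF ?andbT //.
have [k E] : exists k, z = k * n%:Z by move/dvdzP: dz => [k ->]; exists k.
subst z; have k0 : k != 0 by apply: contraNneq z0 => ->; rewrite mul0r.
have n0' : 0 < n%:Z by lia.
have -> : k * n%:Z - n%:Z = (k - 1) * n%:Z by ring.
by rewrite add0n !pmulr_lge0 //; congr nat_of_bool; lia.
Qed.

Ltac atoms_lia := repeat match goal with
  | |- context [count ?f ?s] => let n := fresh in set n := (count f s); clearbody n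
  | |- context [nat_of_bool ?b] => let n := fresh in set n := (nat_of_bool b); clearbody n
  end; lia.

Section IntGauge.
Variables (A B : nat).
Hypotheses (A_gt0 : (0 < A)%N).
Let d := disp A B.

Definition cnt (s : seq (int * 'I_3)) (x : int) X : nat := count_mem (x, X) s.

(** The gauge has to satisfy a relation for each letter X leaving [x].  For E
it reads [H x = H (x + A) + c (x + A + B, S) + c (x + B, D)], and summing this
along the progression [x], [x + A], ... gives the function below. *)
Definition gaugeH (s : seq (int * 'I_3)) (x : int) : nat :=
  count (fun e => (e.2 == lS) && inray A (e.1 - x - B%:Z - A%:Z)
               || (e.2 == lD) && inray A (e.1 - x - B%:Z)) s.

Lemma gaugeH_up s x :
  (gaugeH s x = gaugeH s (x + A%:Z) + cnt s (x + A%:Z + B%:Z) lS + cnt s (x + B%:Z) lD)%N.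
Proof.
elim: s => [//|[y Y] s IH]; rewrite /gaugeH /cnt /= .
move: IH; rewrite /gaugeH /cnt !xpair_eqE.
case: (letterP Y) => /=; rewrite ?andbF ?andbT ?orbF /=.
- have := inrayB (y - x - B%:Z - A%:Z) A_gt0.
  rewrite (_ : y - (x + A%:Z) - B%:Z - A%:Z = y - x - B%:Z - A%:Z - A%:Z); last by ring.
  rewrite (_ : (y - x - B%:Z - A%:Z == 0) = (y == x + A%:Z + B%:Z)); last by apply/eqP/eqP; lia.
  atoms_lia.
- have := inrayB (y - x - B%:Z) A_gt0.
  rewrite (_ : y - (x + A%:Z) - B%:Z = y - x - B%:Z - A%:Z); last by ring.
  rewrite (_ : (y - x - B%:Z == 0) = (y == x + B%:Z)); last by apply/eqP/eqP; lia.
  atoms_lia.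
- atoms_lia.
Qed.

(** The relation for S is not built into the definition of the gauge: it
follows by recording when the walk enters and leaves the progression that
starts at [x + A].  The two [inray] terms account for the ends of the walk, and
cancel for a closed walk. *)
Lemma gaugeH_down z w x :
  (cnt (edges d z w) x lD + cnt (edges d z w) x lE + gaugeH (edges d z w) x
     + inray A (z - x - A%:Z)%R =
   gaugeH (edges d z w) (x - B%:Z)%R + inray A (endp d z w - x - A%:Z)%R)%N.
Proof.
elim: w z => [|X w IH] z; first by rewrite /= endp_nil.
rewrite endp_cons /=; have := IH (z + d X).
set s := edges _ _ w; rewrite /gaugeH /cnt /=  .
rewrite !xpair_eqE.
case: (letterP X); rewrite /d /disp /= ?andbF ?andbT ?orbF /=.
- rewrite (_ : z + (0 - B%:Z) - x - A%:Z = z - x - B%:Z - A%:Z); last by ring.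
  rewrite (_ : z - (x - B%:Z) - B%:Z - A%:Z = z - x - A%:Z); last by ring.
  atoms_lia.
- rewrite (_ : z + (A%:Z - B%:Z) - x - A%:Z = z - x - B%:Z); last by ring.
  rewrite (_ : z - (x - B%:Z) - B%:Z = z - x); last by ring.
  rewrite (inrayB (z - x)) // subr_eq0; atoms_lia.
- rewrite (_ : z + (A%:Z - 0) - x - A%:Z = z - x); last by ring.
  rewrite (inrayB (z - x)) // subr_eq0; atoms_lia.
Qed.
End IntGauge.

Section Transfer.
Variables (V V' : zmodType) (I : finType) (d : I -> V) (d' : I -> V') (phi : V -> V').
Hypothesis phiD : forall z X, phi (z + d X) = phi z + d' X.

Lemma edges_transfer z w :
  edges d' (phi z) w = [seq (phi e.1, e.2) | e <- edges d z w].
Proof. by elim: w z => //= X w IH z; rewrite -phiD IH. Qed.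

Lemma endp_transfer z w : endp d' (phi z) w = phi (endp d z w).
Proof.
by elim: w z => [|X w IH] z; rewrite ?endp_nil // !endp_cons -phiD IH.
Qed.

Lemma pairs_transfer (F : I -> V -> I -> bool) (F' : I -> V' -> I -> bool) z w :
  {in edges d z w &, forall e e' : V * I,
     F' e.2 (phi e'.1 - phi e.1) e'.2 = F e.2 (e'.1 - e.1) e'.2} ->
  pairs d' F' (phi z) w = pairs d F z w.
Proof.
elim: w z => //= X w IH z H; rewrite -phiD IH; last first.
  by move=> e e' es e's; apply: H; rewrite in_cons ?es ?e's orbT.
congr (_ + _)%N; rewrite edges_transfer count_map; apply: eq_in_count => e es /=.
by rewrite -(H (z, X) e) // in_cons ?eqxx // es orbT.
Qed.
End Transfer.

Section DepArr.
Variables (K : fieldType) (t : K).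
Hypothesis t_neq0 : t != 0.
Hypothesis qn_neq0 : forall k, qn t k.+1 != 0.
Variables (A B : nat).
Hypotheses (A_gt0 : (0 < A)%N).
Let d := disp A B.

Lemma normr_disp X : `|d X| <= (A + B)%:Z.
Proof. by case: (letterP X); rewrite /d /disp /=; lia. Qed.

Lemma edges_range (z : int) w e : e \in edges d z w -> `|e.1 - z| <= (size w * (A + B))%:Z.
Proof.
elim: w z => //= X w IH z; rewrite in_cons => /predU1P[->|/IH] /=.
  by rewrite subrr normr0.
have := normr_disp X; rewrite mulSn => ? ?.
have -> : e.1 - z = (e.1 - (z + d X)) + d X by ring.
by apply: le_trans (ler_normD _ _) _; rewrite PoszD addrC lerD.
Qed.

(** [tours_dep_arr] needs finitely many points, since it uses determinants.
The levels visited by words of bounded length stay in a window, and reduction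
modulo a larger number preserves every comparison that matters. *)
Lemma dep_arr_int n (z0 : int) w0 : endp d z0 w0 = z0 ->
  \sum_(w <- words _ n | perm_eq (edges d z0 w) (edges d z0 w0))
     t ^+ pairs d (fun X z Y => (z == 0) && lt_letter Y X) z0 w =
  \sum_(w <- words _ n | perm_eq (edges d z0 w) (edges d z0 w0))
     t ^+ pairs d (fun X z Y => (z + d Y == d X) && lt_letter Y X) z0 w.
Proof.
move=> cl.
(* Two steps more than the walk has, as the ends of steps are compared as well. *)
pose M := ((size w0).+2 * (A + B))%N.
pose p := (M + M)%N.
pose o : int := M%:Z - z0.
pose phi (z : int) : 'I_p.+2 := (z + o)%:~R.
pose d' X : 'I_p.+2 := (d X)%:~R.
pose psi (v : 'I_p.+2) : int := (val v)%:Z - o.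
have phiD (z : int) X : phi (z + d X) = phi z + d' X by rewrite /phi addrAC rmorphD.
have phiK (z : int) : `|z - z0| <= M%:Z -> psi (phi z) = z.
  move=> zM; have [k kE] : exists k : nat, z + o = k%:Z by exists (absz (z + o)); rewrite /o; lia.
  have kp : (k < p.+2)%N by rewrite /p; lia.
  rewrite /psi /phi kE -pmulrn Zp_nat /= modn_small // -kE; ring.
have phi_inj (x y : int) : `|x - z0| <= M%:Z -> `|y - z0| <= M%:Z -> (phi x == phi y) = (x == y).
  by move=> xM yM; apply/eqP/eqP => [E|->//]; rewrite -(phiK x xM) E phiK.
have permE w : perm_eq (edges d z0 w) (edges d z0 w0) =
               perm_eq (edges d' (phi z0) w) (edges d' (phi z0) w0).
  apply/idP/idP; rewrite !(edges_transfer phiD); first exact: perm_map.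
  move=> pw; have sw : size w = size w0.
    by move/perm_size: pw; rewrite !size_map !size_edges.
  have mapK v : size v = size w0 -> [seq (psi e.1, e.2) | e <- [seq (phi e.1, e.2) | e <- edges d z0 v]] = edges d z0 v.
    move=> sv; rewrite -map_comp -[RHS]map_id; apply/eq_in_map => -[x X] /= /edges_range /= xr.
    rewrite phiK //; apply: le_trans xr _; rewrite sv /M; lia.
  by have := perm_map (fun e => (psi e.1, e.2)) pw; rewrite !mapK.
have range w (x : int) X : perm_eq (edges d z0 w) (edges d z0 w0) ->
    (x, X) \in edges d z0 w -> `|x - z0| <= (size w0 * (A + B))%:Z.
  move=> pw /edges_range /=; suff -> : size w = size w0 by [].
  by move/perm_size: pw; rewrite !size_edges.
have depE w : perm_eq (edges d z0 w) (edges d z0 w0) ->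
  pairs d (fun X z Y => (z == 0) && lt_letter Y X) z0 w =
  pairs d' (fun X z Y => (z == 0) && lt_letter Y X) (phi z0) w.
  move=> pw; symmetry; apply: (pairs_transfer phiD) => -[x X] [y Y] xs ys /=.
  have := range _ _ _ pw xs; have := range _ _ _ pw ys => ry rx.
  by congr (_ && _); rewrite !subr_eq0 phi_inj // /M; lia.
have arrE w : perm_eq (edges d z0 w) (edges d z0 w0) ->
  pairs d (fun X z Y => (z + d Y == d X) && lt_letter Y X) z0 w =
  pairs d' (fun X z Y => (z + d' Y == d' X) && lt_letter Y X) (phi z0) w.
  move=> pw; symmetry; apply: (pairs_transfer phiD) => -[x X] [y Y] xs ys /=.
  have := range _ _ _ pw xs; have := range _ _ _ pw ys => ry rx.
  congr (_ && _); rewrite addrAC -phiD subr_eq [in RHS]addrAC [in RHS]subr_eq [d' X + _]addrC -phiD.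
  rewrite [d X + x]addrC phi_inj //.
    have := normr_disp Y; have := ler_normD (y - z0) (d Y).
    rewrite (_ : y - z0 + d Y = y + d Y - z0); last by ring.
    rewrite /M; lia.
  have := normr_disp X; have := ler_normD (x - z0) (d X).
  rewrite (_ : x - z0 + d X = x + d X - z0); last by ring.
  rewrite /M; lia.
rewrite (eq_bigr _ (fun w pw => congr1 (GRing.exp t) (depE w pw))).
rewrite [RHS](eq_bigr _ (fun w pw => congr1 (GRing.exp t) (arrE w pw))).
rewrite !(eq_bigl _ _ permE).
(* The gauge on integers, read through the representatives in the window. *)
pose H (v : 'I_p.+2) := gaugeH A B (edges d z0 w0) (psi v).
apply: (@tours_dep_arr _ _ t_neq0 qn_neq0 _ _ _ _ _ _ (chain_lt3 t) (chain_gt3 t) _ _ H).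
- by move=> X; rewrite /lt_letter ltnn.
- by rewrite (endp_transfer phiD) -/d cl.
move=> v X; set c := content _ _ _.
have cE (x : int) Y : `|x - z0| <= M%:Z -> c (phi x, Y) = cnt (edges d z0 w0) x Y.
  move=> xM; rewrite ffunE (edges_transfer phiD) /cnt count_map; apply: eq_in_count => -[y Z] ys /=.
  have := edges_range ys => /= yr.
  by rewrite !xpair_eqE phi_inj //; apply: le_trans yr _; rewrite lez_nat leq_mul2r !leqW ?orbT.
rewrite ffunE -has_count has_pred1 (edges_transfer phiD) => /mapP[[x Y] xs /= [-> ->]].
have xr : `|x - z0| <= (size w0 * (A + B))%:Z := edges_range xs.
have xM (z : int) : `|z - x| <= (A + B)%:Z * 2 -> `|z - z0| <= M%:Z.
  move=> zx; rewrite (_ : z - z0 = (z - x) + (x - z0)); last by ring.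
  apply: le_trans (ler_normD _ _) _; apply: le_trans (lerD zx xr) _.
  rewrite /M; lia.
have phiB (y : int) Z : phi y - d' Z = phi (y - d Z).
  by rewrite -[y in LHS](subrK (d Z)) phiD addrK.
rewrite /H -phiD !(big3 (M := nat)) /lt_letter !phiB.
have e1 := gaugeH_up B A_gt0 (edges d z0 w0).
have e2 := gaugeH_down B A_gt0 z0 w0; rewrite -/d cl in e2.
have {}e2 (y : int) : (cnt (edges d z0 w0) y lD + cnt (edges d z0 w0) y lE + gaugeH A B (edges d z0 w0) y =
   gaugeH A B (edges d z0 w0) (y - B%:Z)%R)%N.
  by move: (e2 y) => /addIn.
have dS : d lS = - B%:Z by rewrite /d /disp /= sub0r.
have dD : d lD = A%:Z - B%:Z by [].
have dE : d lE = A%:Z by rewrite /d /disp /= subr0.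

case: (letterP Y) => /=; rewrite ?dS ?dD ?dE ?add0n ?addn0 ?add0r ?addr0.
- rewrite !cE ?phiK; [|apply: xM; lia..].
  by rewrite e2.
- rewrite !cE ?phiK; [|apply: xM; lia..].
  rewrite (_ : x + (A%:Z - B%:Z) - - B%:Z = x + A%:Z); last by ring.
  have := e1 (x - B%:Z); rewrite -e2 (_ : x - B%:Z + A%:Z = x + (A%:Z - B%:Z)); last by ring.
  rewrite (_ : x + (A%:Z - B%:Z) + B%:Z = x + A%:Z) ?subrK; last by ring.
  move=> E; apply/eqP; rewrite -(eqn_add2l (cnt (edges d z0 w0) x lD)) addnA E.
  by rewrite addnC; apply/eqP; congr (_ + _)%N; rewrite addnC.
- rewrite !cE ?phiK; [|apply: xM; lia..].
  rewrite (_ : x + A%:Z - - B%:Z = x + A%:Z + B%:Z); last by ring.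
  rewrite (_ : x + A%:Z - (A%:Z - B%:Z) = x + B%:Z); last by ring.
  by rewrite e1 -addnA addnC.
Qed.
End DepArr.

(** * The strict inequalities depend on the multiset of steps only *)

Section IPairs.
Variables (V : zmodType) (I : finType) (d : I -> V).

Definition ipairs (F : I -> V -> I -> int) : V -> seq I -> int :=
  fix loop z w := if w is X :: w'
    then \sum_(e <- edges d (z + d X) w') F X (e.1 - z) e.2 + loop (z + d X) w'
    else 0.

Lemma pairs_ipairs (F : I -> V -> I -> bool) z w :
  (pairs d F z w)%:Z = ipairs (fun X y Y => (F X y Y : nat)%:Z) z w.
Proof.
elim: w z => //= X w IH z; rewrite PoszD IH -sum1_count big_mkcond /=.
congr (_ + _); rewrite (big_morph Posz PoszD (erefl _)).
by apply: eq_bigr => e _; case: (F X _ _).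
Qed.

Lemma ipairs_rcons (F : I -> V -> I -> int) z w Y : ipairs F z (rcons w Y) =
  ipairs F z w + \sum_(e <- edges d z w) F e.2 (endp d z w - e.1) Y.
Proof.
elim: w z => [|X w IH] z /=; first by rewrite !big_nil.
rewrite IH edges_rcons -cats1 big_cat big_seq1 /= endp_cons big_cons /=; ring.
Qed.

Lemma sum_edges_telescope (g : V -> int) z w :
  \sum_(e <- edges d z w) (g (e.1 + d e.2) - g e.1) = g (endp d z w) - g z.
Proof.
elim: w z => [|X w IH] z; first by rewrite big_nil endp_nil subrr.
by rewrite big_cons IH endp_cons /=; ring.
Qed.

(** A symmetric summand does not see the order of the steps. *)
Lemma ipairs_sym (F : I -> V -> I -> int) z w :
  (forall X y Y, F X y Y = F Y (- y) X) ->
  ipairs F z w *+ 2 =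
  \sum_(e <- edges d z w) \sum_(e' <- edges d z w) F e.2 (e'.1 - e.1) e'.2
  - \sum_(e <- edges d z w) F e.2 0 e.2.
Proof.
move=> symF; elim: w z => [|X w IH] z /=; first by rewrite !big_nil subrr.
rewrite mulrnDl IH !big_cons /= subrr; set E := edges _ _ _.
have -> : \sum_(e <- E) \sum_(e' <- (z, X) :: E) F e.2 (e'.1 - e.1) e'.2 =
    \sum_(e <- E) F X (e.1 - z) e.2 +
    \sum_(e <- E) \sum_(e' <- E) F e.2 (e'.1 - e.1) e'.2.
  rewrite -big_split; apply: eq_bigr => e _; rewrite big_cons /=; congr (_ + _).
  by rewrite symF opprB.
by rewrite mulr2n; ring.
Qed.

Lemma ipairs_perm (F : I -> V -> I -> int) z w z' w' :
  (forall X y Y, F X y Y = F Y (- y) X) ->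
  perm_eq (edges d z w) (edges d z' w') -> ipairs F z w = ipairs F z' w'.
Proof.
move=> symF pw; have : ipairs F z w *+ 2 = ipairs F z' w' *+ 2.
  rewrite !(ipairs_sym _ _ symF) (perm_big _ pw) /=; congr (_ - _).
    by apply: eq_bigr => e _; rewrite (perm_big _ pw).
  by rewrite (perm_big _ pw).
lia.
Qed.
End IPairs.

Section Floor.
Variable A : nat.
Hypothesis A_gt0 : (0 < A)%N.

(** The floor of [z / A], cut off at 0 so that its increment over a period is
the indicator function of [0 <= z] ([fl_step]). *)
Definition fl (z : int) : int := if 0 <= z then (z %/ A%:Z)%Z else 0.

Lemma fl_step z : fl (z + A%:Z) = fl z + ((0 <= z)%R : nat)%:Z.
Proof.
rewrite /fl; case: (leP 0 z) => z0.
  rewrite (_ : 0 <= z + A%:Z); last by lia.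
  by rewrite addrC -{1}[A%:Z]mul1r divzMDl ?[1 + _]addrC //; lia.
case: (leP 0 (z + A%:Z)) => zA; last by rewrite addr0.
by rewrite divz_small //; lia.
Qed.

Lemma fl_small z : z < A%:Z -> fl z = 0.
Proof.
by move=> zA; rewrite /fl; case: (leP 0 z) => // z0; rewrite divz_small //; lia.
Qed.

End Floor.

Section Strict.
Variables (A B : nat).
Hypotheses (A_gt0 : (0 < A)%N) (B_gt0 : (0 < B)%N).
Let d := disp A B.
Notation fl := (fl A).
Notation b2z b := ((nat_of_bool b)%:Z).

(** The number of positive multiples of [A] in [(z - B, z]]. *)
Definition theta (z : int) : int := fl z - fl (z - B%:Z).

(** A combination of cut-off floors that is periodic ([Per_step]): hence its
total over the pairs of down steps of a word is a constant, [Perc]. *)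
Definition Per (z : int) : int :=
  fl (z + A%:Z + B%:Z - 1) - fl (z + A%:Z - 1) + fl (- z) - fl (- z - B%:Z).

Lemma Per_step z : Per (z + A%:Z) = Per z.
Proof.
rewrite /Per.
have := fl_step A_gt0 (z + A%:Z + B%:Z - 1); have := fl_step A_gt0 (z + A%:Z - 1).
have := fl_step A_gt0 (- z - A%:Z); have := fl_step A_gt0 (- z - A%:Z - B%:Z).
rewrite (_ : z + A%:Z + B%:Z - 1 + A%:Z = z + A%:Z + A%:Z + B%:Z - 1); last by ring.
rewrite (_ : z + A%:Z - 1 + A%:Z = z + A%:Z + A%:Z - 1); last by ring.
rewrite (_ : - z - A%:Z + A%:Z = - z); last by ring.
rewrite (_ : - z - A%:Z - B%:Z + A%:Z = - z - B%:Z); last by ring.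
rewrite (_ : - (z + A%:Z) = - z - A%:Z); last by ring.
lia.
Qed.

Definition strictF : 'I_3 -> int -> 'I_3 -> bool :=
  fun X z Y => [&& lt_letter Y X, 0 < z & z + d Y < d X].

Definition PerF (X : 'I_3) (z : int) (Y : 'I_3) : int :=
  if dn X && dn Y then Per z else 0.

Definition markF (X : 'I_3) (z : int) (Y : 'I_3) : int :=
  b2z [&& X == lD, Y == lS, - B%:Z < z & z <= 0]
  + b2z [&& X == lS, Y == lD, 0 <= z & z < B%:Z]
  + b2z [&& X == lD, Y == lD, - B%:Z < z & z < B%:Z].

Definition thetaF (X : 'I_3) (z : int) (Y : 'I_3) : int :=
  if dn X && dn Y then theta z + theta (- z) else 0.

Definition gam (z : int) : int := fl (z + A%:Z - 1) - fl (z - B%:Z).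

(** A correction that depends on Y and on the displacement only; in a sum over
the steps before Y its differences telescope. *)
Definition bdry (Y : 'I_3) (z : int) : int :=
  if dn Y then (if Y == lD then b2z (B%:Z <= z) else 0) - gam z else 0.

Ltac fl_lia := repeat match goal with
  | |- context [fl ?z] => let n := fresh in set n := fl z; clearbody n
  end; lia.

(** The indicator of the strict inequalities is a periodic term, minus two
terms that are symmetric in the two steps, plus a telescoping difference. *)
Lemma strict_pointwise X z Y :
  b2z (strictF X z Y) = PerF X z Y - thetaF X z Y - markF X z Y
    + (bdry Y (z - d X) - bdry Y z).
Proof.
have s1 := fl_step A_gt0 (z - 1); have s2 := fl_step A_gt0 (z - A%:Z - B%:Z).
rewrite (_ : z - 1 + A%:Z = z + A%:Z - 1) in s1; last by ring.
rewrite (_ : z - A%:Z - B%:Z + A%:Z = z - B%:Z) in s2; last by ring.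
have s3 := fl_step A_gt0 (z + B%:Z - 1); have s4 := fl_step A_gt0 (z - A%:Z).
rewrite (_ : z + B%:Z - 1 + A%:Z = z + A%:Z + B%:Z - 1) in s3; last by ring.
rewrite subrK in s4.
rewrite /strictF /PerF /thetaF /markF /bdry /gam /Per /theta /d /disp.
move: s1 s2 s3 s4.
case: (letterP X); case: (letterP Y) => /=; rewrite /lt_letter /= ?sub0r ?subr0 ?addr0 ?opprB ?opprK.
- rewrite addrK (_ : z + B%:Z + A%:Z = z + A%:Z + B%:Z); [by move=> _ _ _ _; ring | by ring].
- rewrite addrK (_ : z + B%:Z + A%:Z = z + A%:Z + B%:Z); [fl_lia | by ring].
- by move=> _ _ _ _.
- rewrite (_ : z + (B%:Z - A%:Z) - B%:Z = z - A%:Z); last by ring.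
  rewrite (_ : z + (B%:Z - A%:Z) + A%:Z - 1 = z + B%:Z - 1); last by ring.
  fl_lia.
- rewrite (_ : z + (B%:Z - A%:Z) - B%:Z = z - A%:Z); last by ring.
  rewrite (_ : z + (B%:Z - A%:Z) + A%:Z - 1 = z + B%:Z - 1); last by ring.
  fl_lia.
- by move=> _ _ _ _.
- rewrite subrK; fl_lia.
- rewrite subrK; fl_lia.
- by move=> _ _ _ _.
Qed.

Lemma bdry0 Y : bdry Y 0 = 0.
Proof.
rewrite /bdry /gam !fl_small ?subr0 //; [|lia..].
by case: ifP => // _; case: ifP => // _; rewrite lez_nat leqn0 -[B == 0%N]negbK -lt0n B_gt0.
Qed.

(** The telescoping leaves for each step the value of [bdry] at its
displacement from the start of the word. *)
Lemma strict_formula z w : (pairs d strictF z w)%:Z =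
  ipairs d PerF z w - ipairs d thetaF z w - ipairs d markF z w
  - \sum_(e <- edges d z w) bdry e.2 (e.1 - z).
Proof.
rewrite pairs_ipairs; elim/last_ind: w => [|w Y IH] /=; first by rewrite big_nil.
rewrite !ipairs_rcons IH edges_rcons -cats1 big_cat big_seq1 /=.
rewrite (eq_bigr _ (fun e _ => strict_pointwise e.2 (endp d z w - e.1) Y)).
rewrite big_split /= !sumrB.
set S1 := \sum_(e <- _) PerF _ _ _; set S2 := \sum_(e <- _) thetaF _ _ _.
set S3 := \sum_(e <- _) markF _ _ _; set S0 := \sum_(e <- _) bdry e.2 _.
set S4 := \sum_(e <- _) bdry Y (_ - _ - _); set S5 := \sum_(e <- _) bdry Y _.
have : S4 - S5 = - bdry Y (endp d z w - z).
  have := sum_edges_telescope d (fun u => bdry Y (endp d z w - u)) z w.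
  rewrite subrr bdry0 add0r => <-; rewrite -sumrB.
  by apply: eq_bigr => e _; rewrite /= [- (e.1 + _)]opprD addrA.
lia.
Qed.

Lemma thetaF_sym X z Y : thetaF X z Y = thetaF Y (- z) X.
Proof. by rewrite /thetaF andbC opprK addrC. Qed.

Lemma markF_sym X z Y : markF X z Y = markF Y (- z) X.
Proof.
by rewrite /markF; case: (letterP X); case: (letterP Y) => //=; lia.
Qed.

(** The total of [Per] over the pairs of down steps of any word with [R] of
them: modulo [A] the levels of the down steps are fixed, each being lower than
the one before by [B]. *)
Fixpoint Perc (R : nat) : int :=
  if R is R'.+1 then \sum_(j < R') Per (- (j.+1 * B)%:Z) + Perc R' else 0.

Lemma sum_Per a z w : \sum_(e <- edges d z w) (if dn e.2 then Per (e.1 - a) else 0) =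
  \sum_(j < count dn w) Per (z - a - (j * B)%:Z).
Proof.
elim: w z => [|X w IH] z /=; first by rewrite big_nil big_ord0.
rewrite big_cons IH /=; have shift k : Per (z + A%:Z - k) = Per (z - k).
  by rewrite addrAC Per_step.
case: (letterP X); rewrite /= /d /disp /= ?add0n ?add1n ?add0r ?subr0 ?sub0r.
- rewrite big_ord_recl mul0n subr0; congr (_ + _); apply: eq_bigr => j _.
  by congr Per; rewrite /= mulSn PoszD; ring.
- rewrite big_ord_recl mul0n subr0; congr (_ + _); apply: eq_bigr => j _.
  rewrite -[RHS]Per_step; congr Per; rewrite /= mulSn PoszD; ring.
- by apply: eq_bigr => j _; rewrite -[RHS]Per_step; congr Per; ring.
Qed.

Lemma ipairs_PerF z w : ipairs d PerF z w = Perc (count dn w).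
Proof.
elim: w z => //= X w IH z; rewrite IH.
case: (boolP (dn X)) => dX; last first.
  by rewrite add0n big1 ?add0r // => e _; rewrite /PerF (negPf dX).
rewrite add1n /=; congr (_ + _).
rewrite (eq_bigr (fun e => if dn e.2 then Per (e.1 - z) else 0)); last first.
  by move=> e _; rewrite /PerF dX.
rewrite sum_Per; apply: eq_bigr => j _.
rewrite [z + d X]addrC addrK; case: (letterP X) dX => //= _; rewrite /d /disp /=.
  by congr Per; rewrite mulSn PoszD; ring.
by rewrite -[RHS]Per_step; congr Per; rewrite mulSn PoszD; ring.
Qed.

(** In [strict_formula] the first term is a constant, the next two are
symmetric and the last is a sum over single steps. *)
Lemma strict_perm z w w' : perm_eq (edges d z w) (edges d z w') ->
  pairs d strictF z w = pairs d strictF z w'.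
Proof.
move=> pw; apply/eqP; rewrite -eqz_nat !strict_formula !ipairs_PerF.
rewrite (ipairs_perm thetaF_sym pw) (ipairs_perm markF_sym pw) (perm_big _ pw) /=.
move/(perm_map snd): pw; rewrite !map_snd_edges => /seq.permP ->.
exact: eqxx.
Qed.
End Strict.

(** * Schroeder words and their generating functions *)

(** A sum of products may be compared class by class when the first factor is
constant on classes. *)
Lemma sum_by_classes (K : pzSemiRingType) (T : eqType) (r : rel T) (G f g : T -> K) (s : seq T) :
  equivalence_rel r ->
  {in s &, forall x y, r x y -> G x = G y} ->
  {in s, forall x, \sum_(y <- s | r x y) f y = \sum_(y <- s | r x y) g y} ->
  \sum_(x <- s) G x * f x = \sum_(x <- s) G x * g x.
Proof.
move=> /equivalence_relP[rR rE].
have [n] := ubnP (size s); elim: n s => // n IH [|x s] /=; first by rewrite !big_nil.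
rewrite ltnS => sn HG Hfg; set s0 := x :: s.
rewrite (bigID (r x)) [RHS](bigID (r x)) /=; congr (_ + _).
  rewrite big_seq_cond [RHS]big_seq_cond.
  rewrite (eq_bigr (fun y => G x * f y)); last first.
    by move=> y /andP[ys rxy]; rewrite (HG x y) // mem_head.
  rewrite [RHS](eq_bigr (fun y => G x * g y)); last first.
    by move=> y /andP[ys rxy]; rewrite (HG x y) // mem_head.
  by rewrite -!mulr_sumr -!big_seq_cond Hfg // mem_head.
rewrite -!(big_filter s0 (fun y => ~~ r x y)).
apply: IH.
- rewrite /s0 /= rR /=; apply: leq_ltn_trans sn; rewrite size_filter; exact: count_size.
- by move=> y z; rewrite !mem_filter => /andP[_ ys] /andP[_ zs]; apply: HG.
move=> y; rewrite mem_filter => /andP[nrxy ys]; have := Hfg y ys.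
have E h : \sum_(z <- [seq z <- s0 | ~~ r x z] | r y z) h z = \sum_(z <- s0 | r y z) h z.
  rewrite big_filter_cond; apply: eq_bigl => z; case ryz: (r y z); rewrite ?andbF ?andbT //.
  apply/negP => rxz; case/negP: nrxy; rewrite (rE x z rxz) -(rE y z ryz); exact: rR.
by rewrite !E.
Qed.

Section Schroder.
Variables (K : fieldType) (q t a : K).

Definition dpos (X : 'I_3) : (int * int)%type :=
  ((if rt X then 1 else 0), - (if dn X then 1 else 0)).

(** The words of paths from [(0, R)] to [(C, 0)]. *)
Definition paths (R C : nat) : seq (seq 'I_3) :=
  undup [seq w <- flatten [seq words _ n | n <- iota 0 (R + C).+1]
        | (count dn w == R) && (count rt w == C)].

Lemma mem_paths R C w : (w \in paths R C) = (count dn w == R) && (count rt w == C).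
Proof.
rewrite mem_undup mem_filter; apply: andb_idr => /andP[/eqP dR /eqP rC].
apply/flattenP; exists (words _ (size w)); last by rewrite mem_words.
apply: map_f; rewrite mem_iota add0n ltnS -dR -rC -!size_filter.
elim: w {dR rC} => //= X w IH; case: (letterP X) => /=; lia.
Qed.

Lemma uniq_paths R C : uniq (paths R C). Proof. exact: undup_uniq. Qed.

Lemma big_paths_eq (R C R' C' : nat) (P P' : pred (seq 'I_3)) (h : seq 'I_3 -> seq 'I_3)
    (F : seq 'I_3 -> K) : injective h ->
  (forall w, (w \in paths R' C') && P' w <-> exists2 v, (v \in paths R C) && P v & w = h v) ->
  \sum_(w <- paths R' C' | P' w) F w = \sum_(v <- paths R C | P v) F (h v).
Proof.
move=> h_inj H; rewrite -big_filter -[RHS]big_filter -(big_map h predT).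
apply: perm_big; apply: uniq_perm; rewrite ?map_inj_uniq ?filter_uniq ?uniq_paths //.
move=> w; rewrite mem_filter andbC; apply/idP/mapP => [/H[v Hv ->]|[v Hv ->]].
  by exists v => //; rewrite mem_filter andbC.
by apply/H; exists v => //; rewrite mem_filter andbC in Hv.
Qed.

Variable T : nat -> nat -> bool.

Definition pts (R : nat) (w : seq 'I_3) : seq ((int * int) * 'I_3) := edges dpos (0, R%:Z) w.

(** A down step that starts at [(x, y)] is the right end of a row of [x] boxes
at height [y]; the last box has north-east corner [(x, y)]. *)
Definition fits (R : nat) (w : seq 'I_3) : bool :=
  all (fun e => dn e.2 ==> ((e.1.1 == 0) || T (absz e.1.1) (absz e.1.2))) (pts R w).

Definition area (R : nat) (w : seq 'I_3) : nat :=
  \sum_(e <- pts R w | dn e.2) absz e.1.1.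

(** Two conventions for ties: the first accepts equal starting levels, the
second equal final levels. *)
Definition dinvP A B : 'I_3 -> int -> 'I_3 -> bool :=
  fun X z Y => [&& lt_letter Y X, 0 <= z & z + disp A B Y < disp A B X].
Definition dinvM A B : 'I_3 -> int -> 'I_3 -> bool :=
  fun X z Y => [&& lt_letter Y X, 0 < z & z + disp A B Y <= disp A B X].

Variable N : nat.
Definition weight R w : K := q ^+ (N - area R w) * a ^+ count_mem lD w.
Definition ZP A B R C : K :=
  \sum_(w <- paths R C | fits R w) weight R w * t ^+ pairs (disp A B) (dinvP A B) 0 w.
Definition ZM A B R C : K :=
  \sum_(w <- paths R C | fits R w) weight R w * t ^+ pairs (disp A B) (dinvM A B) 0 w.

Lemma pairs_shift (V : zmodType) (I : finType) (d : I -> V) F z z' w :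
  pairs d F z w = pairs d F z' w.
Proof.
have H (u v : V) X : (u + d X + v) = (u + v) + d X by rewrite addrAC.
have -> : z = z' + (z - z') by rewrite addrC subrK.
apply: (@pairs_transfer _ _ _ d d (fun u => u + (z - z'))) => [u X|e e' _ _]; first exact: H.
by rewrite opprD addrACA subrr addr0.
Qed.

Definition level (A B : nat) (p : (int * int)%type) : int := A%:Z * p.1 + B%:Z * p.2.

Lemma level_disp A B p X : level A B (p + dpos X) = level A B p + disp A B X.
Proof.
by case: p => x y; rewrite /level /dpos /disp /=; case: (letterP X) => /=; ring.
Qed.

Lemma edges_level A B R w : edges (disp A B) (level A B (0, R%:Z)) w =
  [seq (level A B e.1, e.2) | e <- pts R w].
Proof. exact: (edges_transfer (level_disp A B)). Qed.

Lemma endp_dpos x y w : endp dpos (x, y) w = (x + (count rt w)%:Z, y - (count dn w)%:Z).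
Proof.
elim: w x y => [|X w IH] x y; first by rewrite endp_nil /= !addr0 ?subr0.
rewrite endp_cons IH /=; case: (letterP X) => /=; congr (_, _); rewrite ?PoszD; ring.
Qed.

Lemma path_range (x y : int) w e : e \in edges dpos (x, y) w ->
  [&& x <= e.1.1, e.1.1 + (if rt e.2 then 1 else 0) <= x + (count rt w)%:Z,
      e.1.2 <= y & y - (count dn w)%:Z <= e.1.2 - (if dn e.2 then 1 else 0)].
Proof.
elim: w x y => //= X w IH x y; rewrite in_cons => /predU1P[->|] /=.
  by case: (letterP X) => /=; lia.
by move/IH; rewrite /dpos; case: (letterP X) => /=; lia.
Qed.

Lemma sum_heights (f : int -> int) (x y : int) w :
  \sum_(e <- edges dpos (x, y) w | dn e.2) f e.1.2 = \sum_(j < count dn w) f (y - j%:Z).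
Proof.
elim: w x y => [|X w IH] x y; first by rewrite big_nil big_ord0.
rewrite big_cons /=; case: (letterP X); rewrite /= IH /=.
- rewrite add1n big_ord_recl subr0; congr (_ + _); apply: eq_bigr => j _.
  by congr f; rewrite /= /bump /=; lia.
- rewrite add1n big_ord_recl subr0; congr (_ + _); apply: eq_bigr => j _.
  by congr f; rewrite /= /bump /=; lia.
- by rewrite add0n; apply: eq_bigr => j _; congr f; lia.
Qed.

Lemma pts_dn R C w e : w \in paths R C -> e \in pts R w -> dn e.2 -> 0 <= e.1.1 /\ 1 <= e.1.2.
Proof.
rewrite mem_paths => /andP[/eqP dR _] /path_range /and4P[h1 _ _ h2] dX.
by move: h2; rewrite dX dR subrr subr_ge0; split.
Qed.

Section LevelContent.
Variables (A B R C c : nat).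
Hypotheses (A_gt0 : (0 < A)%N) (B_gt0 : (0 < B)%N).
Hypothesis cutT : forall x y, (0 < x)%N -> (0 < y)%N -> T x y = (A * x + B * y <= c)%N.
Let d := disp A B.
Let z0 := level A B (0, R%:Z).

Definition excess (z : int) : int := Num.max (z - c%:Z) 0.

(** A down step at height [y] has excess at least that of [(0, y)], with
equality exactly if it is allowed by [T].  As each height carries one down step,
a path fits if and only if the total excess is the least possible. *)
Lemma fitsE w : w \in paths R C -> fits R w =
  (\sum_(e <- edges d z0 w | dn e.2) excess e.1 == \sum_(j < R) excess (B%:Z * (R%:Z - j%:Z))).
Proof.
move=> ww; have dR : count dn w = R by move: ww; rewrite mem_paths => /andP[/eqP].
rewrite edges_level big_map /=.
have := sum_heights (fun y => excess (B%:Z * y)) 0 R%:Z w; rewrite dR -/(pts R w) => <-.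
rewrite -subr_eq0 -sumrB big_seq_cond psumr_eq0; last first.
  move=> [[x y] X] /andP[es dX]; have [/= x0 y0] := pts_dn ww es dX.
  have {}x0 : 0 <= A%:Z * x by rewrite mulr_ge0.
  by rewrite /excess /level /=; lia.
apply: eq_in_all => -[[x y] X] es /=; rewrite es /=; case dX: (dn X) => //=.
have [/= x0 y0] := pts_dn ww es dX.
have {x0} [i ->] : exists i : nat, x = i%:Z by exists (absz x); lia.
have {y0 es} [j jE] : exists j : nat, y = j.+1%:Z by exists (absz y).-1; lia.
subst y; rewrite /excess /level /=.
case: i => [|i]; first by rewrite eqxx mulr0 add0r subrr eqxx.
rewrite /= cutT //; apply/idP/idP; nia.
Qed.

(** The heights of the down steps are fixed, so the total of their levels is
the area up to a constant. *)
Lemma areaE w : w \in paths R C -> A%:Z * (area R w)%:Z =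
  \sum_(e <- edges d z0 w | dn e.2) e.1 - \sum_(j < R) B%:Z * (R%:Z - j%:Z).
Proof.
move=> ww; have dR : count dn w = R by move: ww; rewrite mem_paths => /andP[/eqP].
rewrite edges_level big_map /=.
have := sum_heights (fun y => B%:Z * y) 0 R%:Z w; rewrite dR -/(pts R w) => <-.
rewrite -sumrB /area (big_morph Posz PoszD (erefl _)) mulr_sumr.
rewrite big_seq_cond [RHS]big_seq_cond; apply: eq_bigr => -[[x y] X] /andP[es dX].
by have [/= x0 _] := pts_dn ww es dX; rewrite /level /=; lia.
Qed.

Let r (w w' : seq 'I_3) := perm_eq (edges d z0 w) (edges d z0 w').

Lemma r_equiv : equivalence_rel r.
Proof.
apply/equivalence_relP; split=> [w|w w' E w'']; first exact: perm_refl.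
by rewrite /r; apply/idP/idP => E'; apply: perm_trans E'; rewrite // perm_sym.
Qed.

Lemma r_count w w' (P : pred 'I_3) : r w w' -> count P w = count P w'.
Proof. by move/(perm_map snd); rewrite !map_snd_edges => /seq.permP ->. Qed.

Lemma r_weight : {in paths R C &, forall w w', r w w' ->
  (if fits R w then weight R w else 0) = (if fits R w' then weight R w' else 0)}.
Proof.
move=> w w' ww ww' rww'; rewrite !fitsE // (perm_big _ rww') /=.
case: ifP => // _; rewrite /weight (r_count _ rww') (_ : area R w = area R w') //.
have := areaE ww; rewrite (perm_big _ rww') /= -areaE //.
have A0 : A%:Z != 0 by lia.
by move/(mulfI A0) => -[].
Qed.

(** The multiset of steps determines the length and the ends of a word. *)
Lemma class_words w (F : seq 'I_3 -> K) : w \in paths R C ->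
  \sum_(v <- paths R C | r w v) F v = \sum_(v <- words _ (size w) | r v w) F v.
Proof.
move=> ww; rewrite -big_filter -[RHS]big_filter; apply: perm_big; apply: uniq_perm.
- by rewrite filter_uniq ?uniq_paths.
- by rewrite filter_uniq ?uniq_words.
move=> v; rewrite !mem_filter /r perm_sym; apply: andb_id2l => pvw.
rewrite mem_words mem_paths !(r_count _ pvw) -mem_paths ww; apply/esym/eqP.
by move/perm_size: pvw; rewrite !size_edges.
Qed.

Lemma pairsD (V : zmodType) (I : finType) (f : I -> V) (F G H : I -> V -> I -> bool) z w :
  (forall X y Y, (F X y Y = G X y Y + H X y Y :> nat)%N) ->
  pairs f F z w = (pairs f G z w + pairs f H z w)%N.
Proof.
move=> FGH; elim: w z => //= X w IH z; rewrite IH addnACA; congr (_ + _)%N.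
by elim: (edges _ _ _) => //= e s ->; rewrite FGH addnACA.
Qed.

Lemma dinvPE w : pairs d (dinvP A B) 0 w =
  (pairs d (strictF A B) z0 w + pairs d (fun X (z : int) Y => (z == 0) && lt_letter Y X) z0 w)%N.
Proof.
rewrite (pairs_shift _ _ 0 z0); apply: pairsD => X y Y.
rewrite /dinvP /strictF /lt_letter /disp.
by case: (letterP X); case: (letterP Y) => //=; case: (ltgtP 0 y) => //=; lia.
Qed.

Lemma dinvME w : pairs d (dinvM A B) 0 w =
  (pairs d (strictF A B) z0 w
   + pairs d (fun X (z : int) Y => ((z + d Y)%R == d X) && lt_letter Y X) z0 w)%N.
Proof.
rewrite (pairs_shift _ _ 0 z0); apply: pairsD => X y Y.
rewrite /dinvM /strictF /lt_letter /d /disp.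
by case: (letterP X); case: (letterP Y) => //=; lia.
Qed.

Hypothesis t_neq0 : t != 0.
Hypothesis qn_neq0 : forall k, qn t k.+1 != 0.

(** Words are grouped by their multiset of steps.  In a group the weight and
the strict part of the statistic are constant, and the tied parts are
equidistributed by [dep_arr_int]. *)
Lemma ZP_ZM_closed : (R * B = C * A)%N -> ZP A B R C = ZM A B R C.
Proof.
move=> cl; rewrite /ZP /ZM big_mkcond [RHS]big_mkcond /=.
rewrite (eq_bigr (fun w => (if fits R w then weight R w else 0) * t ^+ pairs d (dinvP A B) 0 w));
  last by move=> w _; case: ifP; rewrite ?mul0r.
rewrite [RHS](eq_bigr (fun w => (if fits R w then weight R w else 0) * t ^+ pairs d (dinvM A B) 0 w));
  last by move=> w _; case: ifP; rewrite ?mul0r.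
apply: (sum_by_classes r_equiv r_weight) => w ww; rewrite !class_words //.
have clw : endp d z0 w = z0.
  rewrite (endp_transfer (level_disp A B)) endp_dpos; move: ww; rewrite mem_paths => /andP[/eqP -> /eqP ->].
  by rewrite /z0 /level /=; lia.
under eq_bigr => v rvw do rewrite dinvPE (strict_perm A_gt0 B_gt0 rvw) exprD.
under [RHS]eq_bigr => v rvw do rewrite dinvME (strict_perm A_gt0 B_gt0 rvw) exprD.
rewrite -!mulr_sumr; congr (_ * _).
exact: dep_arr_int.
Qed.
End LevelContent.
End Schroder.

(** * Independence of the rectangle and of the slope *)

Lemma dposS n : (0, n.+1%:Z) + dpos lS = (0, n%:Z).
Proof. by apply/eqP; rewrite xpair_eqE /=; lia. Qed.

Section Pad.
Variables (K : fieldType) (q t a : K) (T : nat -> nat -> bool) (N : nat).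
Variables (A B : nat) (F : 'I_3 -> int -> 'I_3 -> bool).
Hypothesis ltF : forall X z Y, F X z Y -> lt_letter Y X.

Definition Zgen R C : K :=
  \sum_(w <- paths R C | fits T R w) weight q a N R w * t ^+ pairs (disp A B) F 0 w.

Lemma first_dn (x y : int) w : (0 < count dn w)%N ->
  exists e, [/\ e \in edges dpos (x, y) w, dn e.2, e.1.2 = y & x <= e.1.1].
Proof.
elim: w x y => //= X w IH x y; case dX: (dn X) => c0.
  by exists ((x, y), X); rewrite mem_head.
have [e [es de ey ex]] := IH (x + (if rt X then 1 else 0)) (y - 0) c0.
exists e; rewrite in_cons /dpos dX es orbT; split=> //; first by rewrite ey subr0.
by apply: le_trans ex; rewrite lerDl; case: ifP.
Qed.

(** A path cannot turn right above the partition, so an extra row at the top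
forces an initial S; an initial S is in no inversion, being the smallest
letter. *)
Lemma Zgen_padS R C : (0 < R)%N -> (forall x y, (0 < x)%N -> T x y -> (y < R)%N) ->
  Zgen R.+1 C = Zgen R C.
Proof.
move=> R0 TR; rewrite /Zgen (big_paths_eq (h := cons lS) (R := R) (C := C) (P := fits T R)).
- apply: eq_bigr => v _; congr (q ^+ (N - _) * _ * t ^+ _).
  + by rewrite /area /pts /= big_cons /= add0n dposS.
  + rewrite /= (pairs_shift _ _ _ 0) -[RHS]add0n; congr (_ + _)%N.
    apply/eqP; rewrite -[_ == _]negbK -lt0n -has_count; apply/negP => /hasP[e _ /ltF].
    by rewrite /lt_letter.
- by move=> v v' [].
have fitsS v : fits T R.+1 (lS :: v) = fits T R v.
  by rewrite /fits /pts [edges _ _ _]/= dposS.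
have absurd (x y : int) v : 1 <= x -> R%:Z <= y -> (0 < count dn v)%N ->
    ~~ all (fun e => dn e.2 ==> ((e.1.1 == 0) || T (absz e.1.1) (absz e.1.2))) (edges dpos (x, y) v).
  move=> x1 yR c0; apply/negP => /allP H.
  have [e [/H /[swap] -> /= + ey ex]] := first_dn x y c0.
  case/orP => [/eqP|/TR]; first by lia.
  by rewrite ey; lia.
move=> w; split; last first.
  move=> [v + ->]; rewrite !mem_paths => /andP[/andP[/eqP dR /eqP rC] fv].
  by rewrite fitsS fv /= dR rC !eqxx.
case: w => [|X v]; first by rewrite mem_paths.
rewrite mem_paths => /andP[/andP[/= dR rC] fv]; case: (letterP X) dR rC fv => /=.
- by move=> dR rC; rewrite fitsS => fv; exists v => //; rewrite mem_paths fv -(eqP rC) -eqSS -add1n dR /= eqxx.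
- by move=> dR _; rewrite /fits /pts /= => fv; exfalso; move: fv; apply/negP/absurd => /=; lia.
- by move=> dR _; rewrite /fits /pts /= => fv; exfalso; move: fv; apply/negP/absurd => /=; lia.
Qed.

(** Dually, an extra column forces a final E, which is the largest letter. *)
Lemma Zgen_padE R C : (0 < C)%N -> (forall x y, (0 < x)%N -> T x y -> (x < C)%N) ->
  Zgen R C.+1 = Zgen R C.
Proof.
move=> C0 TC; rewrite /Zgen (big_paths_eq (h := fun v => rcons v lE) (R := R) (C := C) (P := fits T R)).
- apply: eq_bigr => v _; rewrite /weight -cats1 count_cat /= !addn0; congr (q ^+ (N - _) * _ * t ^+ _).
  + by rewrite /area /pts cats1 edges_rcons -cats1 big_cat big_cons big_nil /= addn0.
  + rewrite cats1 pairs_rcons -[RHS]addn0; congr (_ + _)%N.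
    apply/eqP; rewrite -[_ == _]negbK -lt0n -has_count; apply/negP => /hasP[e _ /ltF].
    by case: (letterP e.2).
- by move=> v v' /rcons_inj[].
have fitsE v : fits T R (rcons v lE) = fits T R v.
  by rewrite /fits /pts edges_rcons all_rcons.
move=> w; rewrite mem_paths; split; last first.
  move=> [v + ->]; rewrite mem_paths => /andP[/andP[/eqP dR /eqP rC] fv].
  by rewrite fitsE fv -cats1 !count_cat dR rC /= !addn0 addn1 !eqxx.
case/lastP: w => [|v X]; first by rewrite /= andbF.
rewrite -cats1 !count_cat /= cats1 !addn0 => /andP[/andP[dR rC] fv].
case: (letterP X) dR rC fv => /=.
- move=> _ rC; rewrite /fits /pts edges_rcons all_rcons endp_dpos /= add0r => /andP[+ _].
  case/orP => [/eqP|/TC]; lia.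
- move=> _ rC; rewrite /fits /pts edges_rcons all_rcons endp_dpos /= add0r => /andP[+ _].
  case/orP => [/eqP|/TC]; lia.
move=> dR rC; rewrite fitsE => fv; exists v => //; rewrite mem_paths fv andbT; lia.
Qed.

Lemma Zgen_pad R C i j : (0 < R)%N -> (0 < C)%N ->
  (forall x y, (0 < x)%N -> T x y -> (x < C)%N && (y < R)%N) ->
  Zgen (R + i) (C + j) = Zgen R C.
Proof.
move=> R0 C0 TRC; have padS k : Zgen (R + k) (C + j) = Zgen R (C + j).
  elim: k => [|k <-]; first by rewrite addn0.
  rewrite addnS; apply: Zgen_padS; first lia.
  by move=> x y x0 /(TRC _ _ x0); lia.
rewrite padS; elim: j {padS} => [|k <-]; first by rewrite addn0.
rewrite addnS; apply: Zgen_padE; first lia.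
by move=> x y x0 /(TRC _ _ x0); lia.
Qed.
End Pad.

(** Applied to the starts of two steps.  A vector on which the first form is
nonnegative is positive for the second one, which is steeper; the converse is
the absence of a critical vector. *)
Lemma slope_start (A B A' B' i j : nat) : (0 < A)%N -> (0 < B)%N -> (A * B' < A' * B)%N ->
  ~~ ((A * i < B * j)%N && (B' * j < A' * i)%N) -> (0 < i)%N ->
  (B * j <= A * i)%N = (B' * j < A' * i)%N.
Proof.
move=> A0 B0 lt nc i0; apply/idP/idP => H; last by lia.
by rewrite -(ltn_pmul2l B0); nia.
Qed.

(** Applied to the ends of two steps, where the strict inequality is the first
one. *)
Lemma slope_end (A B A' B' i j : nat) : (0 < A)%N -> (0 < B)%N -> (0 < B')%N -> (A * B' < A' * B)%N ->
  ~~ ((A * i < B * j)%N && (B' * j < A' * i)%N) -> (0 < i + j)%N ->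
  (A * i < B * j)%N = (A' * i <= B' * j)%N.
Proof.
move=> A0 B0 B'0 lt nc ij; apply/idP/idP => H; first by lia.
case: i nc ij H => [|i] nc ij H; first by rewrite muln0; nia.
rewrite -(ltn_pmul2l B'0); nia.
Qed.

Section Slopes.
Variables (K : fieldType) (q t a : K).
Hypothesis t_neq0 : t != 0.
Hypothesis qn_neq0 : forall k, qn t k.+1 != 0.
Variables (T : nat -> nat -> bool) (N R C : nat).
Hypotheses (R_gt0 : (0 < R)%N) (C_gt0 : (0 < C)%N).
Hypothesis boundT : forall x y, (0 < x)%N -> T x y -> (x < C)%N && (y < R)%N.

(** The form [A x + B y] separates the boxes of [T], given by their north-east
corners, from the others. *)
Definition cut A B := [/\ (0 < A)%N, (0 < B)%N & exists c, forall x y,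
  (0 < x)%N -> (0 < y)%N -> T x y = (A * x + B * y <= c)%N].

Notation Zplus A B := (ZP q t a T N A B R C).
Notation Zminus A B := (ZM q t a T N A B R C).

(** Enlarging the rectangle to one with [R * B = C * A] closes the walks. *)
Lemma ZP_ZM A B : cut A B -> Zplus A B = Zminus A B.
Proof.
case=> A0 B0 [c cutT].
have ltP X z Y : dinvP A B X z Y -> lt_letter Y X by case/and3P.
have ltM X z Y : dinvM A B X z Y -> lt_letter Y X by case/and3P.
(* The closed rectangle has sides [A * (R + C)] and [B * (R + C)]. *)
have leR : (R <= A * (R + C))%N by nia.
have leC : (C <= B * (R + C))%N by nia.
rewrite -[LHS](Zgen_pad q t a N A B ltP (A * (R + C) - R) (B * (R + C) - C) R_gt0 C_gt0 boundT).
rewrite -[RHS](Zgen_pad q t a N A B ltM (A * (R + C) - R) (B * (R + C) - C) R_gt0 C_gt0 boundT).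
rewrite !subnKC //; apply: (ZP_ZM_closed q a N A0 B0 cutT t_neq0 qn_neq0); nia.
Qed.

(** The vectors of the rectangle, [p.1] to the east and [p.2] to the south,
on which the two forms have opposite signs. *)
Definition critical (A B A' B' : nat) : {set 'I_C.+1 * 'I_R.+1} :=
  [set p : 'I_C.+1 * 'I_R.+1 | (A * p.1 < B * p.2)%N && (B' * p.2 < A' * p.1)%N].

(** Without critical vectors a weak inequality for the first slope is a strict
one for the second, and conversely, since the second form is larger on vectors
on which the first one vanishes. *)
Lemma pairs_slope (A B A' B' : nat) w :
  (0 < A)%N -> (0 < B)%N -> (0 < B')%N -> (A * B' < A' * B)%N -> critical A B A' B' = finset.set0 ->
  (count dn w <= R)%N -> (count rt w <= C)%N ->
  pairs (disp A B) (dinvP A B) 0 w = pairs (disp A' B') (dinvM A' B') 0 w.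
Proof.
move=> A0 B0 B'0 lt nc.
have ncE i j : (i <= C)%N -> (j <= R)%N -> ~~ ((A * i < B * j)%N && (B' * j < A' * i)%N).
  rewrite -ltnS => iC; rewrite -ltnS => jR; apply/negP => H.
  by have := finset.in_set0 (Ordinal iC, Ordinal jR); rewrite -nc inE /= H.
have lev0 A1 B1 F v : pairs (disp A1 B1) F 0 v =
    pairs dpos (fun X p Y => F X (level A1 B1 p) Y) (0, 0) v.
  rewrite -[X in pairs _ _ X](_ : level A1 B1 (0, 0) = 0); last by rewrite /level !mulr0 addr0.
  apply: (pairs_transfer (level_disp A1 B1)) => -[[x y] X] [[x' y'] Y] _ _ /=.
  by congr F; rewrite /level /=; ring.
rewrite !lev0; elim: w (0, 0) => //= X w IH p dR rC; rewrite IH; [|lia..].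
congr (_ + _)%N; apply: eq_in_count => -[[x y] Y]; case: p => px py.
move/(path_range (x := px + (dpos X).1) (y := py + (dpos X).2)) => /= rg.
rewrite /dinvP /dinvM; case ltYX: (lt_letter Y X) => //=.
have [i iE] : exists i : nat, x - px = i%:Z.
  by exists (absz (x - px)); move: rg; case: (rt X); lia.
have [j jE] : exists j : nat, py - y = j%:Z.
  by exists (absz (py - y)); move: rg; case: (dn X); lia.
have levE A1 B1 : level A1 B1 (x - px, y - py) = (A1 * i)%N%:Z - (B1 * j)%N%:Z.
  by rewrite /level /= iE -[y - py]opprB jE mulrN -!PoszM.
rewrite !levE.
have rX : rt X by move: ltYX; case: (letterP X).
have i0 : (0 < i)%N by move: rg; rewrite rX; lia.
pose i' := (i + rt Y - 1)%N; pose j' := (j + dn Y - dn X)%N.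
have jX : (dn X <= j)%N by move: rg; case: (dn X); lia.
have ij' : (0 < i' + j')%N.
  by rewrite /i' /j'; move: ltYX jX i0; case: (letterP X); case: (letterP Y) => //=; lia.
have iC : (i <= C)%N by move: rg rC; rewrite rX; case: (rt Y); lia.
have jR : (j <= R)%N by move: rg dR; case: (dn X); case: (dn Y); lia.
have i'C : (i' <= C)%N by rewrite /i'; move: rg rC; rewrite rX; case: (rt Y); lia.
have j'R : (j' <= R)%N by rewrite /j'; move: rg dR; case: (dn X); case: (dn Y); lia.
have s1 := slope_start A0 B0 lt (ncE i j iC jR) i0.
have s2 := slope_end A0 B0 B'0 lt (ncE i' j' i'C j'R) ij'.
have e1 (A1 : nat) : (A1 * i')%N%:Z = (A1 * i)%N%:Z + (if rt Y then A1%:Z else 0) - A1%:Z.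
  have iE' : (i + rt Y = i' + 1)%N by rewrite /i'; lia.
  rewrite -[X in _ + X - _](_ : (A1 * rt Y)%N%:Z = _); last by case: (rt Y); rewrite ?muln1 ?muln0.
  by rewrite -PoszD -mulnDr iE' mulnDr muln1 PoszD addrK.
have e2 (B1 : nat) : (B1 * j')%N%:Z = (B1 * j)%N%:Z + (if dn Y then B1%:Z else 0) - (if dn X then B1%:Z else 0).
  have jE' : (j + dn Y = j' + dn X)%N by rewrite /j'; lia.
  rewrite -[X in _ + X - _](_ : (B1 * dn Y)%N%:Z = _); last by case: (dn Y); rewrite ?muln1 ?muln0.
  rewrite -[X in _ - X](_ : (B1 * dn X)%N%:Z = _); last by case: (dn X); rewrite ?muln1 ?muln0.
  by rewrite -PoszD -mulnDr jE' mulnDr PoszD addrK.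
congr (_ && _); first by rewrite subr_ge0 subr_gt0 lez_nat ltz_nat.
rewrite /disp rX.
rewrite -subr_lt0 -[X in _ = X]subr_le0.
transitivity ((A * i')%N%:Z - (B * j')%N%:Z < 0).
  by congr (_ < 0); rewrite (e1 A) (e2 B); ring.
transitivity ((A' * i')%N%:Z - (B' * j')%N%:Z <= 0).
  by rewrite subr_lt0 subr_le0 ltz_nat lez_nat.
by congr (_ <= 0); rewrite (e1 A') (e2 B'); ring.
Qed.

(** The form that vanishes on a critical vector is a positive combination of
the two given forms, so the same combination of the two thresholds works for
it. *)
Lemma cut_mid (A B A' B' i j : nat) : cut A B -> cut A' B' ->
  (A * i < B * j)%N -> (B' * j < A' * i)%N -> cut j i.
Proof.
move=> [A0 B0 [c cT]] [A'0 B'0 [c' cT']] h h'.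
(* Up to the factor [A' * B - A * B'], the form is [al (A, B) + be (A', B')]. *)
pose al := (A' * i - B' * j)%N; pose be := (B * j - A * i)%N.
have D0 : (0 < A' * B - A * B')%N.
  have : (A * i * (B' * j) < B * j * (A' * i))%N by apply: ltn_mul.
  nia.
pose D := (A' * B - A * B')%N.
have eA : (al * A + be * A' = D * j)%N by rewrite /al /be /D; nia.
have eB : (al * B + be * B' = D * i)%N by rewrite /al /be /D; nia.
split; [nia | nia |].
exists ((al * c + be * c') %/ D)%N => x y x0 y0.
rewrite leq_divRL // mulnC.
have -> : (D * (j * x + i * y) = al * (A * x + B * y) + be * (A' * x + B' * y))%N.
  by rewrite mulnDr !mulnA -eA -eB; ring.
have al0 : (0 < al)%N by rewrite subn_gt0.
have := cT x y x0 y0; have := cT' x y x0 y0; case: (T x y) => h1 h2; apply/esym.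
  by rewrite leq_add // leq_mul2l -?h1 -?h2 orbT.
apply/negbTE; rewrite -ltnNge; apply: leq_ltn_trans (_ : al * c + be * (A' * x + B' * y) < _)%N.
  by rewrite leq_add2l leq_mul2l; lia.
by rewrite ltn_add2r ltn_mul2l al0 /=; lia.
Qed.

(** Passing through the direction of a critical vector [(i, j)] splits the
rotation into two rotations with fewer critical vectors, as [(i, j)] itself is
not critical for either of them. *)
Lemma ZP_ZM_slopes (A B A' B' : nat) : cut A B -> cut A' B' -> (A * B' < A' * B)%N -> Zplus A B = Zminus A' B'.
Proof.
have [n] := ubnP #|critical A B A' B'|; elim: n A B A' B' => // n IH A B A' B'.
rewrite ltnS => cn cAB cAB' lt; have [A0 B0 _] := cAB; have [A'0 B'0 _] := cAB'.
case: (set_0Vmem (critical A B A' B')) => [c0|[[i j]]].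
  rewrite /ZP /ZM big_seq_cond [RHS]big_seq_cond; apply: eq_bigr => w.
  rewrite mem_paths => /andP[/andP[/eqP dR /eqP rC] _].
  by rewrite (pairs_slope A0 B0 B'0 lt c0) ?dR ?rC.
rewrite inE /= => /andP[h1 h2]; have cm := cut_mid cAB cAB' h1 h2.
have ltc (S : {set 'I_C.+1 * 'I_R.+1}) : S \subset critical A B A' B' -> (i, j) \notin S -> (#|S| < n)%N.
  move=> sS nS; apply: leq_trans cn; apply: proper_card; rewrite properE sS.
  by apply/subsetPn; exists (i, j); rewrite // inE /= h1 h2.
have [j0 i0 _] := cm.
have -> : Zplus A B = Zminus j i.
  apply: IH => //; last by rewrite [(j * B)%N]mulnC.
  apply: ltc; last by rewrite inE /= [(j * i)%N]mulnC ltnn andbF.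
  by apply/fintype.subsetP => -[x y]; rewrite !inE /= => /andP[-> u] /=; nia.
rewrite -(ZP_ZM cm); apply: IH => //; last by rewrite mulnC.
apply: ltc; last by rewrite inE /= [(j * i)%N]mulnC ltnn.
by apply/fintype.subsetP => -[x y]; rewrite !inE /= => /andP[u ->]; rewrite andbT; nia.
Qed.
End Slopes.

(** * Words, rows and marked corners *)

Section Rows.

(** The abscissas of the down steps, from the top row to the bottom row. *)
Fixpoint xs (x : nat) (w : seq 'I_3) : seq nat :=
  if w is X :: w' then
    (if dn X then cons x else id) (xs (x + rt X) w')
  else [::].

Fixpoint word_of_rows (C x : nat) (r : seq nat) : seq 'I_3 :=
  if r is y :: r' then nseq (y - x) lE ++ lS :: word_of_rows C y r' else nseq (C - x) lE.

Definition binary (w : seq 'I_3) : bool := lD \notin w.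

Lemma size_xs x w : size (xs x w) = count dn w.
Proof. by elim: w x => //= X w IH x; case: (dn X) => /=; rewrite IH. Qed.

Lemma xs_path x w : path leq x (xs x w).
Proof.
elim: w x => //= X w IH x; have := IH (x + rt X)%N; case: (dn X) => /=; last first.
  by move=> H; apply: (path_le leq_trans _ H); exact: leq_addr.
by rewrite leqnn /= => H; apply: (path_le leq_trans _ H); exact: leq_addr.
Qed.

Lemma word_of_rows_xs C x u : binary u -> (x + count rt u = C)%N -> word_of_rows C x (xs x u) = u.
Proof.
elim: u x => [|X u IH] x /=; first by rewrite addn0 => _ ->; rewrite subnn.
rewrite /binary in_cons negb_or => /andP[+ bu]; case: (letterP X) => //= _ H.
  by rewrite subnn /= addn0 IH //; lia.
have := IH (x + 1)%N bu; rewrite -addnA => /(_ H); have := xs_path (x + 1) u.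
case: (xs _ _) => [|y r] /=.
  by move=> _ E; rewrite -E (_ : C - x = (C - (x + 1)).+1)%N //; lia.
by move=> /andP[xy _] E; rewrite -E (_ : y - x = (y - (x + 1)).+1)%N //; lia.
Qed.

Lemma word_of_rows_binary C x r : binary (word_of_rows C x r).
Proof.
by elim: r x => [|y r IH] x; rewrite /binary /= ?mem_cat ?in_cons ?negb_or mem_nseq /= ?andbF //=; apply: IH.
Qed.

Lemma xs_nseqE k x w : xs x (nseq k lE ++ w) = xs (x + k) w.
Proof. by elim: k x => [|k IH] x /=; rewrite ?addn0 // IH addn1 addSnnS. Qed.

Lemma xs_word_of_rows C x r : path leq x r -> xs x (word_of_rows C x r) = r.
Proof.
elim: r x => [|y r IH] x /=; first by rewrite -[nseq _ _]cats0 xs_nseqE.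
by move=> /andP[xy yr]; rewrite xs_nseqE /= addn0 subnKC // IH.
Qed.

Lemma count_dn_word_of_rows C x r : count dn (word_of_rows C x r) = size r.
Proof.
by elim: r x => [|y r IH] x /=; rewrite ?count_cat count_nseq //= IH mul0n.
Qed.

Lemma count_rt_word_of_rows C x r : path leq x r -> all (leq^~ C) r -> (x <= C)%N ->
  (x + count rt (word_of_rows C x r) = C)%N.
Proof.
elim: r x => [|y r IH] x /=; first by rewrite count_nseq mul1n; lia.
move=> /andP[xy yr] /andP[yC rC] _; rewrite count_cat count_nseq /= mul1n add0n.
by rewrite addnA subnKC // IH.
Qed.

(** Rows are numbered from the bottom, while [xs] starts at the top; rows that
are absent have length 0. *)
Definition row (r : seq nat) (j : nat) : nat := nth 0%N (rev r) j.

Lemma row_cons x r j : row (x :: r) j = if (j < size r)%N then row r j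
  else if j == size r then x else 0%N.
Proof. by rewrite /row rev_cons nth_rcons size_rev. Qed.

Lemma sum_rows (M : nmodType) (f : int -> int -> M) (x y : nat) w : count dn w = y ->
  \sum_(e <- edges dpos (x%:Z, y%:Z) w | dn e.2) f e.1.1 e.1.2 =
  \sum_(j < y) f (row (xs x w) j)%:Z j.+1%:Z.
Proof.
elim: w x y => [|X w IH] x y /=; first by move=> <-; rewrite big_nil big_ord0.
rewrite big_cons /=.
have next : (x%:Z, y%:Z) + dpos X = ((x + rt X)%N%:Z, (y%:Z - (dn X : nat)%:Z)).
  by rewrite /dpos; case: (letterP X) => /=; congr (_, _); rewrite /=; lia.
rewrite next; case dX: (dn X); rewrite ?add0n => yE; last first.
  by rewrite subr0 IH.
rewrite -yE add1n (_ : _ - _ = (count dn w)%:Z) /=; last by lia.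
rewrite IH // big_ord_recr /= addrC; congr (_ + _).
  by apply: eq_bigr => j _; rewrite row_cons size_xs ltn_ord.
by rewrite row_cons size_xs ltnn eqxx.
Qed.

End Rows.

Section Marks.
Variables (K : comPzRingType) (a : K) (g : (int * int)%type -> K).

(** A diagonal step stands for a marked S E corner. *)
Fixpoint unmark (w : seq 'I_3) : seq 'I_3 :=
  if w is X :: w' then (if X == lD then [:: lS, lE & unmark w'] else X :: unmark w') else [::].

Fixpoint markings (u : seq 'I_3) : seq (seq 'I_3) :=
  if u is X :: u' then
    [seq X :: w | w <- markings u'] ++
    (if u' is Y :: u'' then
       (if (X == lS) && (Y == lE) then [seq lD :: w | w <- markings u''] else [::])
     else [::])
  else [:: [::]].

Fixpoint corners (p : (int * int)%type) (u : seq 'I_3) : seq (int * int) :=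
  if u is X :: u' then
    (if (X == lS) && (head lS u' == lE) then cons p else id) (corners (p + dpos X) u')
  else [::].

Lemma count_unmark w : count dn (unmark w) = count dn w /\ count rt (unmark w) = count rt w.
Proof.
elim: w => //= X w [IHd IHr]; case: (letterP X) => /=; rewrite IHd IHr; lia.
Qed.

Lemma unmark_binary w : binary (unmark w).
Proof.
rewrite /binary; elim: w => //= X w IH.
by case: (letterP X) => /=; rewrite ?in_cons //= negb_or /=.
Qed.

Lemma xs_unmark x w : xs x (unmark w) = xs x w.
Proof.
by elim: w x => //= X w IH x; case: (letterP X) => /=; rewrite IH ?addn0 ?addn1.
Qed.

Lemma dD : dpos lD = dpos lS + dpos lE.
Proof. by apply/eqP; rewrite xpair_eqE. Qed.

Lemma mem_markings u w : binary u -> (w \in markings u) = (unmark w == u).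
Proof.
have [k] := ubnP (size u); elim: k u w => // k IH [|X u] w.
  by case: w => [|X w] //= _ _; case: ifP.
rewrite ltnS => uk; rewrite /binary in_cons negb_or eq_sym => /andP[XD bu] /=.
case: w => [|Y w].
  rewrite mem_cat; apply/negbTE; rewrite negb_or; apply/andP; split; first by apply/mapP => -[].
  by case: u {uk bu} => // Z u; case: ifP => // _; apply/mapP => -[].
rewrite mem_cat /=.
have memS : (Y :: w \in [seq X :: v | v <- markings u]) = (Y == X) && (w \in markings u).
  apply/mapP/andP => [[v vu [-> ->]]|[/eqP -> wu]]; first by rewrite eqxx.
  by exists w.
rewrite memS IH //; case: (eqVneq Y lD) => [->|YD] /=.
  rewrite [lD == X]eq_sym (negPf XD) /=.
  case: u uk bu {memS} => [|Z u] /= uk bu; first by rewrite in_nil eqseq_cons andbF.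
  rewrite !eqseq_cons [lS == X]eq_sym [lE == Z]eq_sym.
  move: bu; rewrite /binary in_cons negb_or => /andP[_ bu].
  case: (X == lS) => //=; case: (Z == lE) => //=.
  rewrite mem_map; last by move=> ? ? [].
  by apply: IH => //; lia.
rewrite eqseq_cons; case: (Y == X) => //=.
  rewrite (_ : (_ \in _) = false) ?orbF //; case: u {uk bu memS} => // Z u.
  case: ifP => // _; apply/negbTE/mapP => -[v _ [YD']]; by rewrite YD' in YD.
case: u {uk bu memS} => // Z u.
case: ifP => // _; apply/negbTE/mapP => -[v _ [YD']]; by rewrite YD' in YD.
Qed.

Lemma uniq_markings u : binary u -> uniq (markings u).
Proof.
have [k] := ubnP (size u); elim: k u => // k IH [|X u] //=.
rewrite ltnS => uk; rewrite /binary in_cons negb_or eq_sym => /andP[XD bu] /=.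
rewrite cat_uniq map_inj_uniq; last by move=> ? ? [].
rewrite IH //=; case: u uk bu => [|Y u] //= uk bu.
case: ifP => // _; rewrite map_inj_uniq; last by move=> ? ? [].
rewrite IH ?andbT; [|lia|by move: bu; rewrite /binary in_cons negb_or => /andP[]].
apply/hasPn => _ /mapP[v _ ->]; apply/mapP => -[v' _ [XD']].
by rewrite -XD' in XD.
Qed.

(** Each S E corner is either kept or replaced by D.  Corners do not overlap,
and a D takes its weight from the point where the S of the corner started, so
the sum over markings factors. *)
Lemma sum_marks p u : binary u ->
  \sum_(w <- markings u) \prod_(e <- edges dpos p w | e.2 == lD) (a * g e.1) =
  \prod_(c <- corners p u) (1 + a * g c).
Proof.
have [k] := ubnP (size u); elim: k u p => // k IH [|X u] p.
  by move=> _ _ /=; rewrite big_seq1 !big_nil.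
rewrite ltnS => uk; rewrite /binary in_cons negb_or eq_sym => /andP[XD bu] /=.
rewrite big_cat /= big_map.
under eq_bigr => w _ do rewrite big_cons /= (negPf XD).
rewrite IH //; case: u uk bu => [|Y u] uk bu; first by rewrite big_nil addr0 andbF.
rewrite [head _ _]/=; case: ifP => [/andP[/eqP -> /eqP YE]|_]; last by rewrite big_nil addr0.
subst Y; rewrite big_map.
under [X in _ + X]eq_bigr => w _ do rewrite big_cons /=.
rewrite -mulr_sumr IH; [|by rewrite /= in uk; lia|by move: bu; rewrite /binary in_cons negb_or => /andP[]].
by rewrite big_cons dD addrA /=; ring.
Qed.
End Marks.

(** * Modules and partitions *)

Section Semigroup.
Variables (m n : nat).
Hypotheses (m_gt0 : (0 < m)%N) (n_gt0 : (0 < n)%N) (co_mn : coprime m n).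

Lemma coprime_mul_eq (i j : nat) : (n * i = m * j)%N -> (m %| i)%N /\ (n %| j)%N.
Proof.
move=> E; split.
  by rewrite -(Gauss_dvdr _ co_mn) E dvdn_mulr.
by rewrite -(@Gauss_dvdr n m) 1?coprime_sym // -E dvdn_mulr.
Qed.

(** Below [m * n] no two points of the quadrant have the same level. *)
Lemma rep_uniq (l x y x' y' : nat) : (l < m * n)%N -> (n * x + m * y <= l)%N ->
  (n * x + m * y = n * x' + m * y')%N -> x = x' /\ y = y'.
Proof.
move=> ltl; wlog le_xx' : x y x' y' / (x <= x')%N => [W|] lel E.
  case: (leqP x x') => [h|/ltnW h]; first exact: W.
  by have [|-> ->] := W x' y' x y h _ (esym E); first by rewrite -E.
have [|dv _] := @coprime_mul_eq (x' - x) (y - y'); first by nia.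
suff xx : x = x' by split=> //; nia.
have x'm : (x' < m)%N by nia.
case E0: (x' - x)%N dv => [|k] dv; first lia.
have := dvdn_leq (ltn0Sn _) dv; lia.
Qed.

(** The symmetry of a numerical semigroup with two coprime generators. *)
Lemma Gamma_dual (z : int) :
  Gamma m n z <-> ~ Gamma m n (m%:Z * n%:Z - m%:Z - n%:Z - z).
Proof.
split=> [[x [y ->]] [x' [y' E]]|].
  have E' : (m * n = n * (x + x').+1 + m * (y + y').+1)%N by lia.
  have d1 : (m %| (x + x').+1)%N.
    by rewrite -(Gauss_dvdr _ co_mn) -(@dvdn_addl (m * (y + y').+1) m) ?dvdn_mulr // -E' dvdn_mulr.
  have d2 : (n %| (y + y').+1)%N.
    rewrite -(@Gauss_dvdr n m) 1?coprime_sym // -(@dvdn_addr (n * (x + x').+1) n) ?dvdn_mulr //.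
    by rewrite -E' dvdn_mull.
  have := dvdn_leq (ltn0Sn _) d1; have := dvdn_leq (ltn0Sn _) d2; nia.
have [u [v uv]] : exists u v : int, u * m%:Z + v * n%:Z = 1.
  have [u [v uv]] := Bezoutz m%:Z n%:Z; exists u, v; rewrite uv.
  by move: co_mn; rewrite /coprime => /eqP; rewrite /gcdz /= => ->.
have m0 : m%:Z != 0 by lia.
pose x := ((v * z) %% m%:Z)%Z; pose y := u * z + n%:Z * ((v * z) %/ m%:Z)%Z.
have zE : z = n%:Z * x + m%:Z * y.
  have := divz_eq (v * z) m%:Z; rewrite -/x => E.
  move: E; rewrite /y; move: (divz _ _) => k E.
  transitivity ((u * m%:Z + v * n%:Z) * z); first by rewrite uv mul1r.
  by transitivity (u * m%:Z * z + n%:Z * (v * z)); [ring | rewrite E; ring].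
have x0 : 0 <= x by rewrite modz_ge0.
have xm : x < m%:Z by have := ltz_mod (v * z) m0; rewrite -/x; lia.
case: (leP 0 y) => y0 nG.
  by exists (absz x), (absz y); rewrite !gez0_abs.
case: nG; exists (absz (m%:Z - 1 - x)%R), (absz (- 1 - y)%R).
by rewrite !gez0_abs ?zE; [ring | lia | lia].
Qed.
End Semigroup.

Section Geometry.
Variables (m n l : nat).
Hypotheses (m_gt0 : (0 < m)%N) (n_gt0 : (0 < n)%N) (l_gt0 : (0 < l)%N).
Hypotheses (co_mn : coprime m n) (lt_l : (l < m * n)%N).

(** The number [l - (n x + m y)] represents the point [(x, y)] of the
quadrant; numbers that represent no point belong to every module. *)
Definition Delta (lam : nat -> nat) : set int :=
  [set k | 0 <= k /\ forall x y : nat, k + (n * x + m * y)%N%:Z = l%:Z -> (x < lam y)%N].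

(** Row [y] holds the boxes with south-west corners [(0, y)], ...,
[(lam y - 1, y)]; the second condition says that they belong to the triangular
partition. *)
Definition shape (lam : nat -> nat) : Prop :=
  (forall y, (lam y.+1 <= lam y)%N) /\
  (forall x y, (x < lam y)%N -> (n * x.+1 + m * y.+1 <= l)%N).

(** By duality, the prescribed small elements are those that represent no
point. *)
Lemma wE (i : 'I_(m + n)) : w l i <-> ~ Gamma m n (l%:Z - i%:Z).
Proof.
have D := Gamma_dual m_gt0 n_gt0 co_mn (i%:Z + m%:Z * n%:Z - l%:Z - (n%:Z + m%:Z)).
rewrite (_ : m%:Z * n%:Z - m%:Z - n%:Z - _ = l%:Z - i%:Z) in D; last by ring.
by rewrite /w; split=> [/asboolP/D|/D/asboolP].
Qed.

Lemma Delta_Inv lam : shape lam -> Inv_w m n l (Delta lam).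
Proof.
move=> [anti fit]; split; first split; first by move=> k [].
  split=> k [k0 H]; split; try by lia.
    move=> x y E; apply: leq_trans (anti y); apply: H; lia.
  by move=> x y E; apply: ltnW; apply: H; lia.
move=> i; rewrite wE; split=> [[_ H] [x [y E]]|H].
  have /fit : (x < lam y)%N by apply: H; lia.
  have := ltn_ord i; lia.
split; first by lia.
by move=> x y E; case: H; exists x, y; lia.
Qed.

Lemma Delta_pt lam x y : (n * x + m * y <= l)%N ->
  Delta lam (l%:Z - (n * x + m * y)%N%:Z) <-> (x < lam y)%N.
Proof.
move=> le_l; split=> [[_ H]|lt]; first by apply: H; rewrite subrK.
split; first by rewrite subr_ge0 lez_nat.
move=> x' y' E; have [] := @rep_uniq m n m_gt0 n_gt0 co_mn l x y x' y' => //; last by move=> <- <-.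
by lia.
Qed.

Lemma Delta_co lam (k : int) : 0 <= k ->
  ~ Delta lam k <-> exists x y : nat, k + (n * x + m * y)%N%:Z = l%:Z /\ (lam y <= x)%N.
Proof.
move=> k0; split=> [nD|[x [y [E le]]] [_ /(_ _ _ E)]]; last by lia.
apply: contrapT => nE; apply: nD; split=> // x y E.
by rewrite ltnNge; apply/negP => le; apply: nE; exists x, y.
Qed.

Lemma Delta_inj lam lam' : shape lam -> shape lam' -> Delta lam = Delta lam' -> lam =1 lam'.
Proof.
have H lam1 lam2 : shape lam1 -> Delta lam1 = Delta lam2 -> forall y, (lam1 y <= lam2 y)%N.
  move=> [_ fit] E y; rewrite leqNgt; apply/negP => lt.
  have := fit _ _ lt => le_l.
  have le' : (n * lam2 y + m * y <= l)%N by lia.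
  have := iffRL (Delta_pt lam1 le') lt; rewrite E (Delta_pt lam2 le') ltnn //.
move=> s s' E y; apply/eqP; rewrite eqn_leq (H lam lam') //.
by rewrite (H lam' lam) ?E.
Qed.

(** By induction along [m] and [n].  If [k] is missing and large, so are [k - m]
and [k - n], which represent points; unless one of these can be moved back to a
point for [k], both lie on the axes, and comparing them gives a common multiple
of [m] and [n] below [m * n]. *)
Lemma Inv_co_rep D (k : int) : Inv_w m n l D -> 0 <= k -> ~ D k ->
  exists x y : nat, k + (n * x + m * y)%N%:Z = l%:Z.
Proof.
move=> [[D0 [Dm Dn]] Dw] k0.
have [N kN] := ubnP (absz k); elim: N k k0 kN => // N IH k k0 kN nD.
case: (ltP k (m + n)%N%:Z) => kmn.
  have kb : (absz k < m + n)%N by lia.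
  have kE : (Ordinal kb : nat)%:Z = k by rewrite /= gez0_abs.
  have : ~ w l (Ordinal kb) by rewrite -Dw kE.
  rewrite wE => /contrapT[x [y E]]; exists x, y; rewrite kE in E; lia.
have [x [y E]] : exists x y : nat, (k - m%:Z) + (n * x + m * y)%N%:Z = l%:Z.
  by apply: IH; [lia|lia|move=> /Dm; rewrite subrK].
have [x' [y' E']] : exists x y : nat, (k - n%:Z) + (n * x + m * y)%N%:Z = l%:Z.
  by apply: IH; [lia|lia|move=> /Dn; rewrite subrK].
case: y E => [|y] E; last by exists x, y; lia.
case: x' E' => [|x'] E'; last by exists x', y'; lia.
have E2 : (n * x.+1 = m * y'.+1)%N by lia.
have [/(dvdn_leq (ltn0Sn _)) mx _] := coprime_mul_eq co_mn E2.
exfalso; nia.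
Qed.

(** In each row the points that belong to the module form an initial segment,
by stability under [n]; its length is the row of the partition. *)
Lemma Delta_surj D : Inv_w m n l D -> exists2 lam, shape lam & D = Delta lam.
Proof.
move=> iD; have [[D0 [Dm Dn]] Dw] := iD.
have /boolp.choice[lam lamP] : forall y, exists c, forall x,
    (x < c)%N <-> D (l%:Z - (n * x + m * y)%N%:Z).
  move=> y.
  pose P x := ~~ `[< D (l%:Z - (n * x + m * y)%N%:Z) >].
  have exP : exists x, P x.
    by exists l.+1; apply/asboolPn => /D0; rewrite /int_ge /=; nia.
  exists (ex_minn exP) => x; case: ex_minnP => c /asboolPn nDc cmin; split.
    by rewrite ltnNge => lt; apply: contrapT => nD; case/negP: lt; apply: cmin; apply/asboolPn.
  move=> Dx; rewrite ltnNge; apply/negP => le; apply: nDc.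
  suff DnI j k : D k -> D (k + (n * j)%N%:Z).
    by have := DnI (x - c)%N _ Dx; congr D; nia.
  by elim: j k => [|j IH] k Dk; [rewrite muln0 addr0 | rewrite mulnS PoszD addrA; apply/IH/Dn].
have notw x y (k : int) : k + (n * x + m * y)%N%:Z = l%:Z -> D k -> (m + n)%N%:Z <= k.
  move=> E Dk; rewrite leNgt; apply/negP => kmn.
  have k0 : 0 <= k := D0 _ Dk.
  have kb : (absz k < m + n)%N by lia.
  have kE : (Ordinal kb : nat)%:Z = k by rewrite /= gez0_abs.
  have : w l (Ordinal kb) by rewrite -Dw kE.
  by rewrite wE kE => -[]; exists x, y; lia.
exists lam.
  split=> [y|x y /lamP Dxy].
    rewrite leqNgt; apply/negP => lt.
    have /lamP Dy := lt.
    have : D (l%:Z - (n * lam y + m * y.+1)%N%:Z + m%:Z) by apply: Dm.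
    rewrite (_ : _ + m%:Z = l%:Z - (n * lam y + m * y)%N%:Z); last by rewrite mulnS; lia.
    by move/lamP; rewrite ltnn.
  have := notw x y _ _ Dxy; rewrite subrK => /(_ erefl); rewrite !mulnS; lia.
apply/predeqP => k; split=> [Dk|[k0 H]].
  split; first exact: D0.
  by move=> x y E; apply/lamP; move: Dk; congr D; lia.
apply: contrapT => nD; have [x [y E]] := Inv_co_rep iD k0 nD.
by apply: nD; have /lamP := H _ _ E; congr D; lia.
Qed.
End Geometry.

(** * Statistics of a module in terms of its partition *)

Section FiniteImages.
Variables (J : finType) (P : pred J) (T : choiceType) (f : J -> T).
Hypothesis f_inj : {in P &, injective f}.

Let r := [seq f j | j <- enum P].

Lemma uniq_image : uniq r.
Proof.
rewrite map_inj_in_uniq ?enum_uniq // => x y; rewrite !mem_enum; exact: f_inj.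
Qed.

Lemma mem_image x : x \in r <-> exists2 j, P j & x = f j.
Proof.
split=> [/mapP[j]|[j Pj ->]]; first by rewrite mem_enum => Pj ->; exists j.
by apply: map_f; rewrite mem_enum.
Qed.

Lemma fcard_image (A : set T) : (forall x, A x <-> exists2 j, P j & x = f j) ->
  Defs.fcard A = (\sum_(j | P j) 1)%N.
Proof.
move=> AP; have -> : A = [set` [fset x in r]%fset]%classic.
  apply/predeqP => x; rewrite AP -mem_image /=.
  by split; rewrite in_fset.
rewrite /Defs.fcard set_fsetK card_fseq undup_id ?uniq_image // size_map -cardE.
by rewrite sum1_card.
Qed.

Lemma fsbig_image (R : Type) (idx : R) (op : Monoid.com_law idx) (A : set T) (F : T -> R) :
  (forall j, P j -> A (f j)) ->
  (forall x, A x -> F x = idx \/ exists2 j, P j & x = f j) ->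
  \big[op/idx]_(x \in A) F x = \big[op/idx]_(j | P j) F (f j).
Proof.
move=> PA AF; rewrite (@fsbigE _ _ _ _ A r) ?uniq_image //.
- rewrite big_map big_enum_cond /=; apply: eq_bigl => j.
  by apply: andb_idr => /PA Afj; apply/mem_set.
- by move=> x /=; rewrite mem_image => -[j /PA + ->].
by move=> x /AF[//|]; rewrite -mem_image => ->.
Qed.
End FiniteImages.

(** The intervals [(m y, m y + m]] tile [(0, m R]]. *)
Lemma sum_strips (m R p : nat) : (\sum_(y < R) ((m * y < p) && (p <= m * y.+1)) = ((0 < p) && (p <= m * R)))%N.
Proof.
elim: R => [|k IH]; first by rewrite big_ord0; case: p => //= p; rewrite muln0.
rewrite big_ord_recr /= IH; have : (m * k <= m * k.+1)%N by rewrite leq_mul2l leqnSn orbT.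
by case: (leqP p (m * k)) => h1 h2; rewrite ?andbF ?addn0 ?andbT /=; lia.
Qed.

Section Counting.
Variables (m n l : nat).
Hypotheses (m_gt0 : (0 < m)%N) (n_gt0 : (0 < n)%N) (l_gt0 : (0 < l)%N).
Hypotheses (co_mn : coprime m n) (lt_l : (l < m * n)%N).
Variables (R M : nat).
Hypotheses (ltR : (l < R)%N) (ltM : (l < M)%N).
Variable lam : nat -> nat.
Hypothesis shp : shape m n l lam.

Notation D := (Delta m n l lam).

(** The level of the north-east corner of a box. *)
Definition boxlev (x y : nat) : nat := (n * x.+1 + m * y.+1)%N.

(** The level at which the down step in row [y] starts. *)
Definition rowlev (y : nat) : nat := (n * lam y + m * y.+1)%N.

(** The number of down steps of the boundary of the partition that pass from a
level at least [p] to a level below [p]. *)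
Definition crossings (p : nat) : nat :=
  (\sum_(y < R) ((rowlev y < p + m) && (p <= rowlev y)))%N.

Let box := ('I_R * 'I_M)%type.
Let outer : pred box := fun b => (lam b.1 <= b.2)%N && (boxlev b.2 b.1 <= l)%N.
Let boxk (b : box) : int := l%:Z - (n * b.2 + m * b.1)%N%:Z.

Lemma boxk_inj : {in outer &, injective boxk}.
Proof.
move=> [y x] [y' x'] /andP[_ /= le1] /andP[_ /= le2]; rewrite /boxk /= => E.
have le : (n * x + m * y <= l)%N by move: le1; rewrite /boxlev; lia.
have [|xx yy] := @rep_uniq m n m_gt0 n_gt0 co_mn l x y x' y' lt_l le; first lia.
by congr (_, _); apply: val_inj.
Qed.

(** The missing numbers that are at least [n + m] represent the south-west
corners of the boxes of tau outside the partition. *)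
Lemma fcard_outer (W : set int) :
  Defs.fcard (co D `&` int_ge (n%:Z + m%:Z) `&` W)%classic =
  (\sum_(y < R) \sum_(x < M) ((lam y <= x) && (boxlev x y <= l) &&
     `[< W (l%:Z - (n * x + m * y)%N%:Z)%R >]))%N.
Proof.
pose PW (b : box) := outer b && `[< W (boxk b) >].
rewrite (@fcard_image _ PW _ boxk); first last.
- move=> k; split=> [[[[k0 nD] kge] Wk]|[[y x] /andP[/andP[/= le1 le2] /asboolP Wk] ->]].
    have [x [y [E le]]] := iffLR (Delta_co m_gt0 n_gt0 l_gt0 co_mn lt_l lam k0) nD.
    rewrite /int_ge /= in kge.
    have yR : (y < R)%N by nia.
    have xM : (x < M)%N by nia.
    exists (Ordinal yR, Ordinal xM); rewrite /boxk /=; last by lia.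
    rewrite /PW /outer /boxk /boxlev /= le /=.
    by apply/andP; split; [nia|apply/asboolP; rewrite (_ : _ - _ = k) //; lia].
  move: le2; rewrite /boxlev /= => le2.
  rewrite /boxk /=; split=> //; split; last by rewrite /int_ge /=; lia.
  split; first by rewrite /int_ge /=; lia.
  by rewrite (Delta_pt m_gt0 n_gt0 l_gt0 co_mn lt_l); [rewrite ltnNge le1|lia].
- by move=> b b' /andP[? _] /andP[? _]; apply: boxk_inj.
rewrite big_mkcond /= pair_bigA /=; apply: eq_bigr => -[y x] _ /=.
by rewrite /PW /outer /boxk /=; case: ifP.
Qed.

Lemma area'E : area' m n D =
  (\sum_(y < R) \sum_(x < M) ((lam y <= x) && (boxlev x y <= l)))%N.
Proof.
rewrite /area' -[X in Defs.fcard X]setIT fcard_outer.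
apply: eq_bigr => y _; apply: eq_bigr => x _.
by rewrite (_ : `[< _ >] = true) ?andbT //; apply/asboolP.
Qed.

Lemma fcard_tauE : Defs.fcard (tau m n l) = (\sum_(y < R) \sum_(x < M) (boxlev x y <= l))%N.
Proof.
rewrite (@fcard_image _ (fun b : box => boxlev b.2 b.1 <= l)%N _
   (fun b => ((b.2 : nat).+1, (b.1 : nat).+1))); first last.
- move=> [x y]; split=> [[/= x1 [y1 le]]|[[y' x'] /= le [-> ->]] //].
  have yR : (y.-1 < R)%N by nia.
  have xM : (x.-1 < M)%N by nia.
  by exists (Ordinal yR, Ordinal xM); rewrite /boxlev /= ?prednK.
- by move=> [y x] [y' x'] _ _ /= [xx yy]; congr (_, _); apply: val_inj.
by rewrite big_mkcond /= pair_bigA /=; apply: eq_bigr => -[y x] _ /=; case: ifP.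
Qed.

Let rowin : pred 'I_R := fun y => (m * y <= l)%N.
Let rowk (y : 'I_R) : int := l%:Z + n%:Z - (n * lam y + m * y)%N%:Z.

Lemma rowin_le (y : nat) : (m * y <= l)%N -> (n * lam y + m * y <= l)%N.
Proof.
case: shp => _ fit; case E: (lam y) => [|x]; first by rewrite muln0.
by move=> _; have := @fit x y; rewrite E => /(_ (leqnn _)); nia.
Qed.

Lemma rowk_inj : {in rowin &, injective rowk}.
Proof.
move=> y y' /rowin_le le1 /rowin_le le2; rewrite /rowk => E.
have [|_ yy] := @rep_uniq m n m_gt0 n_gt0 co_mn l _ y (lam y') y' lt_l le1; first lia.
exact: val_inj.
Qed.

(** The generators that are at least [n] represent, in each row, the south-west
corner of the last box; for an empty row this point has abscissa -1. *)
Lemma ngenE k : n%:Z <= k -> ngen n D k <-> exists2 y, rowin y & k = rowk y.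
Proof.
case: shp => anti fit kn; split=> [[Dk nDk]|[y yin ->]].
  have kn0 : 0 <= k - n%:Z by lia.
  have [x [y [E le]]] := iffLR (Delta_co m_gt0 n_gt0 l_gt0 co_mn lt_l lam kn0) nDk.
  have yR : (y < R)%N by nia.
  exists (Ordinal yR); first by rewrite /rowin /=; nia.
  rewrite /rowk /=; suff -> : lam y = x by lia.
  apply/eqP; rewrite eqn_leq le /=; case: x E {le} => // x E.
  by case: Dk => _; apply; rewrite mulnS in E; lia.
have le := rowin_le yin; split; last first.
  case=> _ /(_ (lam y) y) H; suff : (lam y < lam y)%N by rewrite ltnn.
  by apply: H; rewrite /rowk; lia.
split; first by rewrite /rowk; lia.
move=> x' y' E.
have [|/= xx yy] := @rep_uniq m n m_gt0 n_gt0 co_mn l (lam y) y x'.+1 y' lt_l le.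
  by move: E; rewrite /rowk mulnS; lia.
by rewrite -yy; lia.
Qed.

(** A generator lies in the window of [xi] exactly if the down step of its row
crosses the level [P]. *)
Lemma xiE P : (P <= l.+1)%N -> xi m n D (l%:Z - P%:Z) = crossings P.
Proof.
move=> Pl; rewrite /xi.
pose PW (y : 'I_R) := rowin y && ((rowlev y < P + m) && (P <= rowlev y))%N.
rewrite (@fcard_image _ PW _ rowk); first last.
- move=> k; split=> [[/= Hk [k1 k2]]|[y /andP[yin /andP[h1 h2]] ->]].
    have kn : n%:Z <= k by lia.
    have [y yin kE] := iffLR (ngenE kn) Hk; exists y => //.
    by rewrite /PW yin /rowlev; move: k1 k2; rewrite kE /rowk mulnS; lia.
  have le := rowin_le yin.
  split; first by apply/ngenE; [rewrite /rowk; lia|exists y].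
  by move: h1 h2; rewrite /rowlev mulnS /rowk /=; split; lia.
- by move=> y y' /andP[? _] /andP[? _]; apply: rowk_inj.
rewrite big_mkcond /crossings; apply: eq_bigr => y _; rewrite /PW.
case yin: (rowin y) => /=; first by case: ifP.
move/negbT: yin; rewrite /rowin -ltnNge => yin.
by rewrite (_ : (_ < _)%N = false) //; rewrite /rowlev mulnS; lia.
Qed.

(** Beyond level [l] the boundary of the partition is the vertical axis. *)
Lemma crossings_above p : (l < p)%N -> crossings p = (p <= m * R)%N.
Proof.
case: shp => _ fit lp.
transitivity (nat_of_bool ((0 < p) && (p <= m * R))%N); last by rewrite (leq_trans _ lp).
rewrite -sum_strips.
apply: eq_bigr => y _; rewrite /rowlev.
case E: (lam y) => [|x].
  by rewrite muln0 add0n mulnS addnC ltn_add2r.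
have := @fit x y; rewrite E => /(_ (leqnn _)) le.
rewrite [(p <= n * _ + _)%N]leqNgt (leq_ltn_trans le lp) andbF.
by rewrite [(p <= m * _)%N]leqNgt (leq_ltn_trans _ lp) ?andbF //; lia.
Qed.

Lemma xi_neg1 : xi m n D (-1) = 1%N.
Proof.
have -> : (-1 : int) = l%:Z - l.+1%:Z by lia.
by rewrite xiE // crossings_above //; nia.
Qed.

(** Exchanging the sums, codinv counts pairs of a box outside the partition
and a down step that crosses its level; the binomial correction vanishes since
[xi] takes the value 1 at -1. *)
Lemma codinv'E : codinv' m n D =
  (\sum_(y < R) \sum_(x < M) ((lam y <= x) && (boxlev x y <= l)) * crossings (boxlev x y))%N%:Z.
Proof.
rewrite /codinv' xi_neg1 subr0.
rewrite (@fsbig_image _ rowin _ rowk rowk_inj); first last.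
- move=> k Hk; case: (leP n%:Z k) => kn; last first.
    left; rewrite fcard_outer big1 // => y _; rewrite big1 // => x _.
    case: (leqP (lam y) x) => //= le1; case: (leqP (boxlev x y) l) => //= le2.
    apply/eqP; rewrite eqb0; apply/asboolPn => -[h1 h2]; move: le2; rewrite /boxlev; lia.
  by right; apply/ngenE.
- by move=> y yin; apply/ngenE; [have := rowin_le yin; rewrite /rowk; lia|exists y].
rewrite -(big_morph Posz PoszD (erefl _)); congr Posz.
under eq_bigr do rewrite fcard_outer.
rewrite exchange_big /=; apply: eq_bigr => y _.
rewrite exchange_big /=; apply: eq_bigr => x _.
rewrite big_mkcond /crossings big_distrr /=; apply: eq_bigr => y' _.
case: (leqP (lam y) x) => //= le1; last by case: ifP; rewrite ?mul0n.
case: (leqP (boxlev x y) l) => //= le2; last by case: ifP; rewrite ?mul0n.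
rewrite mul1n; case yin: (rowin y'); last first.
  move/negbT: yin; rewrite /rowin -ltnNge => yin.
  by rewrite (_ : (_ < _)%N = false) //; rewrite /rowlev mulnS; lia.
congr nat_of_bool; apply/asboolP/idP => [[h1 h2]|/andP[h1 h2]].
  by move: h1 h2; rewrite /rowk /rowlev /boxlev !mulnS; lia.
by move: h1 h2; rewrite /rowk /rowlev /boxlev !mulnS /=; split; lia.
Qed.

Definition is_corner (y : nat) : bool := (y == 0%N) || (lam y < lam y.-1)%N.

Lemma corner_le y : is_corner y -> (n * lam y + m * y <= l)%N.
Proof.
case: shp => _ fit; case: y => [|y]; first by move=> _; apply: rowin_le; rewrite muln0.
by rewrite /is_corner /= => lt; have := fit _ _ lt; rewrite !mulnS; lia.
Qed.

(** Cogenerators represent the south-west corners of the boxes that can be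
added to the partition. *)
Lemma cogenE (K : comPzRingType) (h : int -> K) :
  \big[*%R/1]_(k \in cogen m n D) h k =
  \prod_(y < R | is_corner y) h (l%:Z - (n * lam y + m * y)%N%:Z).
Proof.
case: shp => anti fit.
apply: (@fsbig_image _ (fun y : 'I_R => is_corner y) _
  (fun y : 'I_R => l%:Z - (n * lam y + m * y)%N%:Z)).
- move=> y y' /corner_le le1 /corner_le le2 E.
  have [|_ yy] := @rep_uniq m n m_gt0 n_gt0 co_mn l _ y (lam y') y' lt_l le1; first lia.
  exact: val_inj.
- move=> y cy; have le := corner_le cy; split; last split.
  + split; first by rewrite /int_ge /=; lia.
    by rewrite (Delta_pt m_gt0 n_gt0 l_gt0 co_mn lt_l) ?ltnn.
  + split; first by lia.
    move=> x' y' E; have [|xx yy] := @rep_uniq m n m_gt0 n_gt0 co_mn l (lam y) y x'.+1 y' lt_l le.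
      by rewrite mulnS; lia.
    by rewrite -yy; lia.
  split; first by lia.
  move=> x' y' E; have [|xx yy] := @rep_uniq m n m_gt0 n_gt0 co_mn l (lam y) y x' y'.+1 lt_l le.
    by rewrite mulnS; lia.
  by move: cy; rewrite -xx /is_corner yy.
move=> k [[k0 nDk] [Dn Dm]]; right.
have [x [y [E le]]] := iffLR (Delta_co m_gt0 n_gt0 l_gt0 co_mn lt_l lam k0) nDk.
rewrite /int_ge /= in k0. have yR : (y < R)%N by nia.
(* [k + n] belongs to the module, so [x] is the first missing abscissa. *)
have xE : lam y = x.
  apply/eqP; rewrite eqn_leq le /=; case: x E {le} => // x E.
  by case: Dn => _; apply; rewrite mulnS in E; lia.
exists (Ordinal yR); last by rewrite /= xE; lia.
rewrite /is_corner /= xE; case: y {yR le xE} E => //= y E.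
by case: Dm => _; apply; rewrite mulnS in E; lia.
Qed.
End Counting.

(** * The exponent of t of a word *)

Section OrderedPairs.
Variable T : Type.
Fixpoint opairs (s : seq T) : seq (T * T) :=
  if s is e :: s' then [seq (e, e') | e' <- s'] ++ opairs s' else [::].
End OrderedPairs.

Lemma opairs_map (T T' : Type) (f : T -> T') s :
  opairs [seq f x | x <- s] = [seq (f p.1, f p.2) | p <- opairs s].
Proof. by elim: s => //= x s ->; rewrite map_cat -!map_comp. Qed.

Section OpairsPairs.
Variables (V : zmodType) (I : finType) (d : I -> V).

Lemma ipairs_opairs F z w : ipairs d F z w =
  \sum_(p <- opairs (edges d z w)) F p.1.2 (p.2.1 - p.1.1) p.2.2.
Proof.
by elim: w z => [|X w IH] z /=; rewrite ?big_nil // big_cat big_map IH.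
Qed.

Lemma pairs_opairs F z w : pairs d F z w =
  count (fun p : (V * I) * (V * I) => F p.1.2 (p.2.1 - p.1.1) p.2.2) (opairs (edges d z w)).
Proof.
by elim: w z => [|X w IH] z //=; rewrite count_cat count_map IH.
Qed.
End OpairsPairs.

(** A later step lies weakly to the south-east. *)
Lemma opairs_dpos (p0 : (int * int)%type) w p : p \in opairs (edges dpos p0 w) ->
  [/\ p.1 \in edges dpos p0 w, p.2 \in edges dpos p0 w,
      (if rt p.1.2 then 1 else 0) <= p.2.1.1 - p.1.1.1
    & (if dn p.1.2 then 1 else 0) <= p.1.1.2 - p.2.1.2].
Proof.
elim: w p0 => //= X w IH [x y]; rewrite mem_cat => /orP[/mapP[[[x' y'] Y] es ->] /=|/IH[h1 h2 h3 h4]].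
  have /= := path_range (x := x + (dpos X).1) (y := y + (dpos X).2) es.
  rewrite in_cons eqxx in_cons es orbT => /and4P[r1 _ r2 _].
  by split=> //; [move: r1; case: (rt X) | move: r2; case: (dn X)]; lia.
by rewrite !in_cons h1 h2 !orbT.
Qed.

Lemma pairs_sorted (V : zmodType) (d : 'I_3 -> V) (F : 'I_3 -> V -> 'I_3 -> bool) z w :
  (forall X y Y, F X y Y -> lt_letter Y X) ->
  sorted (fun X Y : 'I_3 => (X <= Y)%N) w -> pairs d F z w = 0%N.
Proof.
move=> ltF; elim: w z => //= X w IH z pw.
rewrite IH ?(path_sorted pw) // addn0; apply/eqP; rewrite -leqn0 leqNgt -has_count.
apply/negP => /hasP[e es /ltF]; rewrite /lt_letter ltnNge.
have := order_path_min (leT := fun X Y : 'I_3 => (X <= Y)%N) (fun _ _ _ => @leq_trans _ _ _) pw.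
move/allP => /(_ e.2); rewrite -{1}(map_snd_edges d (z + d X) w) => -> //.
exact: map_f.
Qed.

(** The floor counts the boxes of a row to the right of [lam], up to a given
level. *)
Lemma fl_count n M lam (z : int) : (0 < n)%N -> (lam <= M)%N -> z <= (n * M)%N%:Z ->
  fl n (z - (n * lam)%N%:Z) = (\sum_(x < M) ((lam <= x) && ((n * x.+1)%N%:Z <= z)%R))%N%:Z.
Proof.
move=> n0; move: {2}(M - lam)%N (erefl (M - lam)%N) => k.
elim: k lam => [|k IH] lam kE le zM.
  have -> : lam = M by lia.
  rewrite fl_small //; last by lia.
  by rewrite big1 // => x _; rewrite leqNgt ltn_ord.
have lt : (lam < M)%N by lia.
have -> : z - (n * lam)%N%:Z = z - (n * lam.+1)%N%:Z + n%:Z by rewrite mulnS; lia.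
rewrite fl_step // IH //; last by lia.
rewrite [in RHS](bigD1 (Ordinal lt)) //= leqnn /= PoszD [RHS]addrC; congr (_ + _).
  rewrite [in LHS](bigD1 (Ordinal lt)) //= ltnn /= add0n; congr Posz.
  apply: eq_bigr => x; rewrite -val_eqE /= => xl.
  by rewrite [in RHS]leq_eqVlt [lam == x]eq_sym (negPf xl).
by rewrite subr_ge0.
Qed.

Section Exponent.
Variables (m n l : nat).
Hypotheses (m_gt0 : (0 < m)%N) (n_gt0 : (0 < n)%N) (l_gt0 : (0 < l)%N).
Hypotheses (co_mn : coprime m n) (lt_l : (l < m * n)%N).
Variables (R C : nat).
Hypotheses (ltR : (l < R)%N) (ltC : (l < C)%N).

Definition inT (x y : nat) : bool := [&& (0 < x)%N, (0 < y)%N & (n * x + m * y <= l)%N].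

Let M := (m * R)%N.
Lemma ltM : (l < M)%N. Proof. by rewrite /M; nia. Qed.

Let lamw (w : seq 'I_3) := row (xs 0 w).

Lemma fits_rows w : w \in paths R C -> fits inT R w =
  [forall j : 'I_R, (lamw w j == 0%N) || inT (lamw w j) j.+1].
Proof.
rewrite mem_paths => /andP[/eqP dR _].
have := sum_rows (fun x y => (~~ ((x == 0) || inT (absz x) (absz y)) : nat)) 0 dR.
rewrite -/(pts R w) => E; apply/idP/idP => H.
  have /eqP : (\sum_(e <- pts R w | dn e.2)
      (~~ ((e.1.1 == 0) || inT (absz e.1.1) (absz e.1.2)) : nat) = 0)%N.
    by apply: big1_seq => e /andP[de es]; move/allP: H => /(_ e es); rewrite de /= => ->.
  rewrite [X in X == _]E sum_nat_eq0 => /forallP F; apply/forallP => j; move: (F j) => /=.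
  by rewrite eqb0 negbK.
have /eqP : (\sum_(e <- pts R w | dn e.2) (~~ ((e.1.1 == 0) || inT (absz e.1.1) (absz e.1.2)) : nat) = 0)%N.
  rewrite [LHS]E big1 // => j _; move/forallP: H => /(_ j) /= Hj.
  by apply/eqP; rewrite eqb0 negbK.
rewrite sum_nat_seq_eq0 => /allP F; apply/allP => e es; apply/implyP => de.
by have := F e es; rewrite de /= eqb0 negbK.
Qed.

Lemma row_default r j : (size r <= j)%N -> row r j = 0%N.
Proof. by move=> sj; rewrite /row nth_default // size_rev. Qed.

Lemma shape_row w : w \in paths R C -> fits inT R w -> shape m n l (lamw w).
Proof.
move=> ww; rewrite fits_rows // => /forallP fw.
have sR : size (xs 0 w) = R by move: ww; rewrite mem_paths size_xs => /andP[/eqP].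
split=> [y|x y lt].
  case: (ltnP y.+1 R) => yR; last by rewrite /lamw row_default ?sR.
  rewrite /lamw /row !nth_rev ?sR; [|lia|lia].
  have := path_sorted (xs_path 0 w) => /(sorted_leq_nth leq_trans leqnn 0%N).
  by apply; rewrite ?inE ?sR; lia.
case: (ltnP y R) => yR; last by move: lt; rewrite /lamw row_default ?sR.
have /= := fw (Ordinal yR); rewrite /inT => /orP[/eqP E|/and3P[_ _ le]]; first by rewrite E in lt.
by apply: leq_trans le; rewrite leq_add2r leq_mul2l lt orbT.
Qed.

(** Levels of distinct points of a short enough window differ, since [m] and
[n] are coprime. *)
Lemma no_tie (i j : nat) : (n * i = m * j)%N -> (i < m)%N -> i = 0%N /\ j = 0%N.
Proof.
move=> E im; have [dv _] := coprime_mul_eq co_mn E.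
case: i dv im E => [|i] dv im E; first by split=> //; nia.
by have := dvdn_leq (ltn0Sn _) dv; lia.
Qed.

Section OneWord.
Variable w : seq 'I_3.
Hypotheses (ww : w \in paths R C) (fw : fits inT R w).
Notation lam := (lamw w).
Notation d := (disp n m).
Let z0 := level n m (0, R%:Z).

Lemma dn_point e : e \in pts R w -> dn e.2 -> exists x y : nat,
  [/\ e.1 = (x%:Z, y.+1%:Z), (x = 0%N \/ (n * x + m * y.+1 <= l)%N), (y < R)%N & (x < m)%N].
Proof.
move=> es de; have := path_range es; have [x0 y1] := pts_dn ww es de.
case: e es de x0 y1 => [[x y] X] es de /= x0 y1 /and4P[_ _ yR _].
have {x0} [i iE] : exists i : nat, x = i%:Z by exists (absz x); lia.
have {y1} [j jE] : exists j : nat, y = j.+1%:Z by exists (absz y).-1; lia.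
have c : i = 0%N \/ (n * i + m * j.+1 <= l)%N.
  move/allP: fw => /(_ _ es); rewrite de /= iE jE => /orP[/eqP|/and3P[_ _]]; first by left; lia.
  by right.
exists i, j; split; rewrite ?iE ?jE //; first lia.
by case: c => [->//|c]; nia.
Qed.

Lemma level_le e : e \in pts R w -> dn e.2 -> level n m e.1 <= z0.
Proof.
move=> es de; have [x [y [-> c yR xm]]] := dn_point es de; rewrite /z0 /level /=.
by case: c => [->|c]; nia.
Qed.

(** No two steps of a path inside the partition that form an inversion start
on the same level. *)
Lemma dep_zero : pairs d (fun X (z : int) Y => (z == 0) && lt_letter Y X) z0 w = 0%N.
Proof.
rewrite pairs_opairs edges_level opairs_map count_map.
apply/eqP; rewrite -leqn0 leqNgt -has_count; apply/negP => /hasP[[[[xe ye] X] [[xf yf] Y]] po /=].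
move=> /andP[/eqP E ltl]; have [/= es es' dx dy] := opairs_dpos po.
have dnY : dn Y by move: ltl; case: (letterP X); case: (letterP Y).
have rtX : rt X by move: ltl; case: (letterP X); case: (letterP Y).
have [x [y [/= [xE yE] c yR xm]]] := dn_point es' dnY.
have /and4P[/= x0 _ _ _] := path_range es.
move: dx dy E; rewrite rtX /level /= => dx dy E.
have [i iE] : exists i : nat, xf - xe = i%:Z by exists (absz (xf - xe)%R); lia.
have [j jE] : exists j : nat, ye - yf = j%:Z.
  by exists (absz (ye - yf)%R); move: dy; case: (dn X); lia.
have E2 : n%:Z * (xf - xe) = m%:Z * (ye - yf) by lia.
have [||i0 _] := @no_tie i j; [|lia|lia].
by move: E2; rewrite iE jE; lia.
Qed.

(** The correction vanishes at or below the initial level, where all down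
steps start. *)
Lemma bdry_zero : \sum_(e <- edges d z0 w) bdry n m e.2 (e.1 - z0) = 0.
Proof.
rewrite edges_level big_map /=; apply: big1_seq => e /andP[_ es].
rewrite /bdry; case de: (dn e.2) => //; move: (level_le es de); move: (level _ _ _) => v le.
rewrite /gam !fl_small //; [|lia..].
by rewrite !subr0; case: ifP => // _; rewrite (_ : (m%:Z <= _) = false) //; lia.
Qed.

Lemma sum_dn (f : int -> int) :
  \sum_(e <- edges d z0 w | dn e.2) f e.1 = \sum_(j < R) f (rowlev m n lam j)%:Z.
Proof.
have dR : count dn w = R by move: ww; rewrite mem_paths => /andP[/eqP].
rewrite edges_level big_map /=.
have := sum_rows (fun x y => f (level n m (x, y))) 0 dR.
rewrite -/(pts R w) => E; rewrite (eq_bigr (fun e => f (level n m (e.1.1, e.1.2)))) ?E.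
  by apply: eq_bigr => j _; rewrite /level /rowlev /=; congr f; lia.
by move=> [[x y] X].
Qed.

Lemma sum_dn2 (f : int -> int -> int) :
  \sum_(e <- edges d z0 w) \sum_(e' <- edges d z0 w) (if dn e.2 && dn e'.2 then f e.1 e'.1 else 0)
  = \sum_(j < R) \sum_(j' < R) f (rowlev m n lam j)%:Z (rowlev m n lam j')%:Z.
Proof.
rewrite -(sum_dn (fun z => \sum_(j' < R) f z (rowlev m n lam j')%:Z)) [RHS]big_mkcond /=.
apply: eq_bigr => e _; case: (dn e.2) => /=; last by rewrite big1.
by rewrite -(sum_dn (f e.1)) [RHS]big_mkcond.
Qed.

(** It depends on the path only through the boxes of tau ([covered_split]). *)
Definition covered : nat :=
  (\sum_(y < R) \sum_(x < M) (lam y <= x) * crossings m n R lam (boxlev m n x y))%N.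

Lemma row_le (y : nat) : (lam y <= M)%N.
Proof.
have [_ fit] := shape_row ww fw; case E: (lam y) => [//|x].
have := @fit x y; rewrite E => /(_ (leqnn _)); have := ltM; nia.
Qed.

Lemma rowlev_le (y : 'I_R) : (rowlev m n lam y <= M)%N.
Proof.
have [_ fit] := shape_row ww fw; rewrite /rowlev; case E: (lam y) => [|x].
  by rewrite muln0 add0n /M leq_mul2l ltn_ord orbT.
by have := @fit x y; rewrite E => /(_ (leqnn _)) le; apply: leq_trans le _; apply: ltnW; exact: ltM.
Qed.

(** The multiples of [n] counted by [theta] are the levels of the boxes to the
right of row [j] that the down step of row [j'] crosses. *)
Lemma theta_count (j j' : 'I_R) :
  theta n m ((rowlev m n lam j')%:Z - (rowlev m n lam j)%:Z) =
  (\sum_(x < M) (lam j <= x) * ((rowlev m n lam j' < boxlev m n x j + m) &&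
     (boxlev m n x j <= rowlev m n lam j')))%N%:Z.
Proof.
have lejM := rowlev_le j'; have lamM := row_le j.
have MnM : (M <= n * M)%N by rewrite leq_pmull.
set s := rowlev m n lam j' in lejM *.
rewrite /theta (_ : s%:Z - (rowlev m n lam j)%:Z = (s%:Z - (m * j.+1)%N%:Z) - (n * lam j)%N%:Z);
  last by rewrite /rowlev; lia.
rewrite (_ : _ - _ - m%:Z = (s%:Z - (m * j.+1)%N%:Z - m%:Z) - (n * lam j)%N%:Z); last by ring.
rewrite !(@fl_count n M) //; [|lia|lia].
apply/eqP; rewrite subr_eq -PoszD eqz_nat -big_split /=; apply/eqP; apply: eq_bigr => x _.
rewrite /boxlev; case: (lam j <= x)%N; last by rewrite mul0n.
rewrite mul1n; move: (n * x.+1)%N (m * j.+1)%N => u v.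
by case: (leqP (u + v) s) => h1; case: (ltnP s (u + v + m)) => h2 /=;
  [rewrite (_ : (_ <= _ - m%:Z) = false) ?addn0 | rewrite (_ : (_ <= _ - m%:Z) = true)
  | rewrite (_ : (_ <= _ - m%:Z) = false) | ]; lia.
Qed.

Lemma theta_sum : \sum_(j < R) \sum_(j' < R)
  theta n m ((rowlev m n lam j')%:Z - (rowlev m n lam j)%:Z) = covered%:Z.
Proof.
rewrite /covered (big_morph Posz PoszD (erefl _)); apply: eq_bigr => j _.
under eq_bigr do rewrite theta_count.
rewrite -(big_morph Posz PoszD (erefl _)) exchange_big /=; congr Posz.
by apply: eq_bigr => x _; rewrite /crossings big_distrr.
Qed.

Lemma thetaE : ipairs d (thetaF n m) z0 w = covered%:Z.
Proof.
have : ipairs d (thetaF n m) z0 w *+ 2 = covered%:Z *+ 2; last by lia.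
rewrite (ipairs_sym _ _ _ (thetaF_sym n m)) [X in _ - X]big1 ?subr0; last first.
  move=> e _; rewrite /thetaF /theta oppr0 !fl_small ?subr0 ?if_same //; lia.
rewrite /thetaF (sum_dn2 (fun u v => theta n m (v - u) + theta n m (- (v - u)))).
under eq_bigr do rewrite big_split.
rewrite big_split /= mulr2n; congr (_ + _); first exact: theta_sum.
rewrite exchange_big -theta_sum; apply: eq_bigr => j _; apply: eq_bigr => j' _.
by rewrite opprB.
Qed.

(** A D and another down step that starts on one of the [m] levels below the
start of the D, or the same with the roles exchanged. *)
Definition markG (X : 'I_3) (z : int) (Y : 'I_3) : int :=
  ([&& X == lD, dn Y, - m%:Z <= z & z < 0] : nat)%:Z
  + ([&& Y == lD, dn X, 0 < z & z <= m%:Z] : nat)%:Z.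

Lemma markG_sym X z Y : markG X z Y = markG Y (- z) X.
Proof.
rewrite /markG addrC; congr (_ + _); congr (Posz (nat_of_bool [&& _, _ & _]));
by apply/idP/idP; lia.
Qed.

(** On the pairs that occur in a path the two descriptions differ only at
ties, which [no_tie] excludes. *)
Lemma mark_pointwise : ipairs d (markF m) z0 w = ipairs d markG z0 w.
Proof.
rewrite !ipairs_opairs edges_level opairs_map !big_map big_seq [RHS]big_seq.
apply: eq_bigr => -[[[xe ye] X] [[xf yf] Y]] po /=.
have [/= es es' dx dy] := opairs_dpos po.
case dnX: (dn X); last by rewrite /markF /markG; move: dnX; case: (letterP X) => // _; case: (letterP Y).
case dnY: (dn Y); last by rewrite /markF /markG; move: dnY; case: (letterP Y) => // _; case: (letterP X).
have [x [y [/= [xE yE] _ _ xm]]] := dn_point es dnX.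
have [x' [y' [/= [xE' yE'] _ _ xm']]] := dn_point es' dnY.
have zE : level n m (xf, yf) - level n m (xe, ye) = (n * (x' - x))%N%:Z - (m * (y - y'))%N%:Z.
  by move: dx dy; rewrite xE yE xE' yE' /level dnX /=; case: (rt X); nia.
have [x'x [yy' dX]] : (x <= x')%N /\ (y' < y)%N /\ (X = lD -> (x < x')%N).
  move: dx dy; rewrite dnX xE yE xE' yE'; split; first by move: dx; case: (rt X); lia.
  by split=> [|XD]; [lia|move: dx; rewrite XD /=; lia].
rewrite zE; move: (x' - x)%N (y - y')%N (subn_gt0 y' y) (subn_gt0 x x') (leq_ltn_trans (leq_subr x x') xm') => i j jy ix im.
have j0 : (0 < j)%N by rewrite jy.
(* The displacements at which the two descriptions disagree. *)
have t1 : (n * i)%N%:Z - (m * j)%N%:Z != 0.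
  by apply/eqP => E; have [|_] := @no_tie i j _ im; lia.
have t2 : (n * i)%N%:Z - (m * j)%N%:Z != m%:Z.
  by apply/eqP => E; have [|_] := @no_tie i j.+1 _ im; rewrite ?mulnS; lia.
have t3 : X = lD -> (n * i)%N%:Z - (m * j)%N%:Z != - m%:Z.
  move=> /dX XD; apply/eqP => E; have [|i0 _] := @no_tie i j.-1 _ im.
    by case: j E {jy t1 t2} j0 => // j E _; rewrite mulnS in E; lia.
  by move: ix; rewrite i0 XD.
move: (_ - _) t1 t2 t3 => z t1 t2 t3.
rewrite /markF /markG; move: t3 dnX dnY; case: (letterP X); case: (letterP Y) => //= t3 _ _.
- by lia.
- by have := t3 erefl; lia.
- by have := t3 erefl; lia.
Qed.

(** The total of [markG] over ordered pairs counts, for each D, the down steps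
that cross the level of its corner. *)
Lemma markE : ipairs d (markF m) z0 w =
  \sum_(e <- pts R w | e.2 == lD)
     (crossings m n R lam (absz (level n m (e.1.1, e.1.2 - 1))))%:Z.
Proof.
rewrite mark_pointwise.
have : ipairs d markG z0 w *+ 2 = (\sum_(e <- pts R w | e.2 == lD)
     (crossings m n R lam (absz (level n m (e.1.1, e.1.2 - 1))))%:Z) *+ 2; last by lia.
rewrite (ipairs_sym _ _ _ markG_sym) [X in _ - X]big1 ?subr0; last first.
  by move=> e _; rewrite /markG ltxx !andbF.
under eq_bigr do rewrite big_split.
rewrite big_split /= mulr2n.
have H : \sum_(e <- edges d z0 w) \sum_(e' <- edges d z0 w)
    ([&& e.2 == lD, dn e'.2, - m%:Z <= e'.1 - e.1 & e'.1 - e.1 < 0] : nat)%:Z =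
  \sum_(e <- pts R w | e.2 == lD)
     (crossings m n R lam (absz (level n m (e.1.1, e.1.2 - 1))))%:Z.
  rewrite edges_level big_map [RHS]big_mkcond /= big_seq [RHS]big_seq.
  apply: eq_bigr => -[[x y] X] es /=; case: eqP => XD; last by rewrite big1.
  have dX : dn X by rewrite XD.
  have [i [j [[-> ->] _ _ _]]] := dn_point es dX.
  have -> : level n m (i%:Z, j.+1%:Z - 1) = (n * i + m * j)%N%:Z by rewrite /level /=; lia.
  rewrite -edges_level -/d -/z0 /crossings (big_morph Posz PoszD (erefl _)).
  rewrite (eq_bigr (fun e' => if dn e'.2 then
     ((- m%:Z <= e'.1 - level n m (i%:Z, j.+1%:Z)) && (e'.1 - level n m (i%:Z, j.+1%:Z) < 0) : nat)%:Z else 0)); last first.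
    by move=> e' _; case: (dn e'.2).
  rewrite -big_mkcond (sum_dn (fun u => ((- m%:Z <= u - level n m (i%:Z, j.+1%:Z)) && (u - level n m (i%:Z, j.+1%:Z) < 0) : nat)%:Z)).
  apply: eq_bigr => k _; congr (Posz (nat_of_bool _)); rewrite /level /=.
  by move: (rowlev _ _ _ _) => s; apply/idP/idP; lia.
congr (_ + _) => //; rewrite -H exchange_big /=.
apply: eq_bigr => e _; apply: eq_bigr => e' _; congr (Posz (nat_of_bool [&& _, _ & _])).
by apply/idP/idP; lia.
Qed.

(** The formula for the strict part applies, as there are no ties; its terms
are identified one by one. *)
Lemma dinvP_formula : (pairs d (dinvP n m) 0 w)%:Z =
  Perc n m R - covered%:Z -
  \sum_(e <- pts R w | e.2 == lD)
     (crossings m n R lam (absz (level n m (e.1.1, e.1.2 - 1))))%:Z.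
Proof.
rewrite (dinvPE R n_gt0 m_gt0) -/d -/z0 dep_zero addn0 strict_formula //.
rewrite bdry_zero subr0 thetaE markE ipairs_PerF //.
by move: ww; rewrite mem_paths => /andP[/eqP ->].
Qed.
End OneWord.
End Exponent.

Section Words.
Variables (m n l : nat).
Hypotheses (m_gt0 : (0 < m)%N) (n_gt0 : (0 < n)%N) (l_gt0 : (0 < l)%N).
Hypotheses (co_mn : coprime m n) (lt_l : (l < m * n)%N).
Variables (R C : nat).
Hypotheses (ltR : (l < R)%N) (ltC : (l < C)%N).

Notation M := (m * R)%N.
Notation N := (Defs.fcard (tau m n l)).
Notation lamw w := (row (xs 0 w)).
Notation T := (inT m n l).

Let lM : (l < M)%N := ltM m_gt0 n_gt0 l_gt0 co_mn lt_l ltR ltC.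

(** The boxes beyond the partition up to level [m R]; each is crossed once,
whatever the path. *)
Definition outside : nat :=
  (\sum_(y < R) \sum_(x < M) ((l < boxlev m n x y) && (boxlev m n x y <= m * R)))%N.

(** The boxes of tau contribute codinv, the others a constant. *)
Lemma covered_split w : w \in paths R C -> fits T R w ->
  (covered m n R w)%:Z = codinv' m n (Delta m n l (lamw w)) + outside%:Z.
Proof.
move=> ww fw; have shp := shape_row m_gt0 n_gt0 l_gt0 co_mn lt_l ltR ltC ww fw.
rewrite (codinv'E m_gt0 n_gt0 l_gt0 co_mn lt_l ltR lM shp) -PoszD; congr Posz.
rewrite /covered /outside -big_split /=; apply: eq_bigr => y _.
rewrite -big_split /=; apply: eq_bigr => x _.
case: (leqP (boxlev m n x y) l) => h; first by rewrite andbT addn0.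
rewrite (crossings_above m_gt0 n_gt0 l_gt0 co_mn lt_l ltR lM shp h) andbF mul0n add0n.
case: (leqP (row _ _) x) => [_|/(shp.2)]; first by rewrite mul1n.
by rewrite -/(boxlev m n x y); lia.
Qed.

(** The constant is found by evaluating [dinvP_formula] at the path of the
empty partition, which has no inversions and no marks. *)
Lemma Perc_eq : Perc n m R = (N + outside)%N%:Z.
Proof.
pose u := nseq R lS ++ nseq C lE.
have xsE : xs 0 u = nseq R 0%N.
  rewrite /u; elim: R => [|k IH] /=; last by rewrite IH.
  by rewrite -[nseq C lE]cats0 xs_nseqE.
have row0 j : lamw u j = 0%N.
  rewrite /row xsE; case: (ltnP j R) => jR; last by rewrite nth_default // size_rev size_nseq.
  by rewrite nth_rev size_nseq // nth_nseq if_same.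
have uw : u \in paths R C by rewrite mem_paths !count_cat !count_nseq /= !mul1n !mul0n addn0 !eqxx.
have fu : fits T R u by rewrite (fits_rows _ _ _ uw); apply/forallP => j; rewrite row0.
have := dinvP_formula m_gt0 n_gt0 l_gt0 co_mn lt_l ltR ltC uw fu.
rewrite pairs_sorted; first last.
- have pE k (X : 'I_3) : path (fun X Y : 'I_3 => (X <= Y)%N) X (nseq k lE).
    by elim: k X => //= k IH X; rewrite IH andbT -ltnS ltn_ord.
  apply: (@path_sorted _ _ lS); rewrite /u.
  by elim: R => [|k IH] /=; [exact: pE | rewrite IH].
- by move=> X z Y /and3P[].
rewrite [X in _ - X]big1_seq ?subr0; last first.
  move=> e /andP[/eqP eD es]; exfalso.
  have : lD \in u.
    by rewrite -eD -(map_snd_edges dpos (0, R%:Z) u); apply: map_f.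
  by rewrite mem_cat !mem_nseq /= !andbF.
move/eqP; rewrite eq_sym subr_eq0 => /eqP ->; congr Posz.
rewrite (fcard_tauE m_gt0 n_gt0 l_gt0 co_mn lt_l ltR lM) /covered /outside -big_split /=.
apply: eq_bigr => y _; rewrite -big_split /=; apply: eq_bigr => x _.
rewrite row0 leq0n mul1n.
have -> : crossings m n R (lamw u) (boxlev m n x y) =
    ((0 < boxlev m n x y) && (boxlev m n x y <= m * R))%N.
  rewrite /crossings -sum_strips; apply: eq_bigr => j _.
  by rewrite /rowlev row0 muln0 add0n mulnS addnC ltn_add2r.
have p0 : (0 < boxlev m n x y)%N by rewrite addn_gt0 muln_gt0 n_gt0.
move: (boxlev _ _ _ _) p0 => p p0; move: lM; move: (m * R)%N => b lb.
by case: (leqP p l) => pl; [rewrite (leq_trans pl (ltnW lb)) p0 | rewrite p0].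
Qed.

(** The exponent of t carried by a word: the size of tau, minus codinv of the
module, minus one value of [xi] for each mark. *)
Lemma dinvP_word w : w \in paths R C -> fits T R w ->
  (pairs (disp n m) (dinvP n m) 0 w)%:Z =
  N%:Z - codinv' m n (Delta m n l (lamw w)) -
  \sum_(e <- pts R w | e.2 == lD)
     (crossings m n R (lamw w) (absz (level n m (e.1.1, e.1.2 - 1))))%:Z.
Proof.
move=> ww fw; rewrite (dinvP_formula m_gt0 n_gt0 l_gt0 co_mn lt_l ltR ltC ww fw).
by rewrite covered_split // Perc_eq PoszD; ring.
Qed.

Lemma area'_word w : w \in paths R C -> fits T R w ->
  area' m n (Delta m n l (lamw w)) = (N - area R w)%N.
Proof.
move=> ww fw; have shp := shape_row m_gt0 n_gt0 l_gt0 co_mn lt_l ltR ltC ww fw.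
have dR : count dn w = R by move: ww; rewrite mem_paths => /andP[/eqP].
rewrite (area'E m_gt0 n_gt0 l_gt0 co_mn lt_l ltR lM).
rewrite (fcard_tauE m_gt0 n_gt0 l_gt0 co_mn lt_l ltR lM).
have -> : area R w = (\sum_(y < R) lamw w y)%N.
  exact: (sum_rows (fun x _ => absz x) 0 dR).
rewrite -[LHS](addnK (\sum_(y < R) lamw w y)); congr (_ - _)%N.
rewrite -big_split; apply: eq_bigr => y _ /=.
have {2}<- : (\sum_(x < M) (x < lamw w y) = lamw w y)%N.
  have := row_le m_gt0 n_gt0 l_gt0 co_mn lt_l ltR ltC ww fw y.
  move: (lamw w y) M => k b kb.
  have -> : (\sum_(x < b) (x < k) = minn b k)%N.
    by elim: b {kb} => [|b IH]; rewrite ?big_ord0 ?min0n // big_ord_recr /= IH; lia.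
  exact/minn_idPr.
rewrite -big_split; apply: eq_bigr => x _ /=.
case: (ltnP x (row (xs 0 w) y)) => [/(shp.2)|_]; last by rewrite addn0.
by rewrite -/(boxlev m n x y) => ->.
Qed.
End Words.

(** * The polynomial as a sum over Schroeder words *)

(** A step S at abscissa [x] is followed by E exactly if the next row is
longer, or, at the bottom, if the right side has not been reached. *)
Lemma head_rt C x u : binary u -> (x + count rt u = C)%N ->
  (head lS u == lE) = (x < head C (xs x u))%N.
Proof.
case: u => [|X u]; first by rewrite addn0 => _ <-; rewrite ltnn.
rewrite /binary in_cons negb_or => /andP[+ bu]; case: (letterP X) => //= _ E.
  by rewrite ltnn.
apply/esym; rewrite eqxx; have := xs_path (x + 1) u; case: (xs _ _) => [|y r] /=; first lia.
by case/andP; lia.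
Qed.

(** The length of the row below, or the right side of the rectangle for the
bottom row: a corner is a row shorter than its wall. *)
Definition wall (C : nat) (r : seq nat) (j : nat) : nat := if j is i.+1 then row r i else C.

Lemma wall_head C r : wall C r (size r) = head C r.
Proof.
by case: r => [|x r] //=; rewrite row_cons ltnn eqxx.
Qed.

Lemma prod_corners (K : comPzRingType) (h : (int * int)%type -> K) C x y u :
  binary u -> count dn u = y -> (x + count rt u = C)%N ->
  \prod_(c <- corners (x%:Z, y%:Z) u) h c =
  \prod_(j < y | (row (xs x u) j < wall C (xs x u) j)%N) h ((row (xs x u) j)%:Z, j.+1%:Z).
Proof.
elim: u x y => [|X u IH] x y; first by move=> _ <- _; rewrite big_nil big_ord0.
rewrite /binary in_cons negb_or => /andP[+ bu].
have next : (x%:Z, y%:Z) + dpos X = ((x + rt X)%N%:Z, (y%:Z - (dn X : nat)%:Z)).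
  by apply/eqP; rewrite xpair_eqE /=; case: (rt X); case: (dn X); lia.
rewrite [corners _ _]/= next; case: (letterP X) => //= _ yE rE; last first.
  by rewrite subr0 IH //; lia.
have bC : (x + count rt u = C)%N by lia.
rewrite -yE add1n addn0 (_ : _ - _ = (count dn u)%:Z); last by lia.
rewrite (head_rt bu bC) [RHS]big_mkcond big_ord_recr -big_mkcond /=.
rewrite row_cons size_xs ltnn eqxx.
have E : \prod_(j < count dn u | (row (x :: xs x u) j < wall C (x :: xs x u) j)%N)
            h ((row (x :: xs x u) j)%:Z, j.+1%:Z) = \prod_(c <- corners (x%:Z, (count dn u)%:Z) u) h c.
  rewrite IH //; apply: eq_big => [j|j _]; last by rewrite row_cons size_xs ltn_ord.
  rewrite row_cons size_xs ltn_ord; congr (_ < _)%N; case: j => -[//|j] /= jlt.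
  by rewrite row_cons size_xs ltnW.
rewrite E -(size_xs x u) (_ : wall C _ _ = wall C (xs x u) (size (xs x u))) ?wall_head ?size_xs; last first.
  rewrite -(size_xs x u); case: (xs x u) => [//|z r] /=.
  by rewrite !row_cons /= ltnSn ltnn eqxx.
by case: ifP => _; rewrite ?mulr1 // big_cons mulrC.
Qed.

Section WordSum.
Variables (m n l : nat).
Hypotheses (m_gt0 : (0 < m)%N) (n_gt0 : (0 < n)%N) (l_gt0 : (0 < l)%N).
Hypotheses (co_mn : coprime m n) (lt_l : (l < m * n)%N).
Variables (R C : nat).
Hypotheses (ltR : (l < R)%N) (ltC : (l < C)%N).
Variables (K : fieldType) (q t a : K).
Hypothesis t_neq0 : t != 0.

Notation N := (Defs.fcard (tau m n l)).
Notation lamw w := (row (xs 0 w)).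
Notation T := (inT m n l).
Let lM : (l < m * R)%N := ltM m_gt0 n_gt0 l_gt0 co_mn lt_l ltR ltC.

Lemma marks_prod (J : Type) (s : seq J) (P : pred J) (c : J -> nat) :
  \prod_(e <- s | P e) (a * t ^- c e) = a ^+ count P s * t ^ (- \sum_(e <- s | P e) (c e)%:Z).
Proof.
elim: s => [|e s IH]; first by rewrite !big_nil oppr0 expr0z mulr1.
rewrite !big_cons /= IH; case: (P e) => //=.
by rewrite exprS opprD expfzDr // exprnN; ring.
Qed.

Definition summand (D : set int) : K :=
  q ^+ area' m n D * t ^ (- codinv' m n D) *
  \big[*%R/1]_(k \in cogen m n D) (1 + a * t ^- xi m n D k).

Definition wordterm (w : seq 'I_3) : K :=
  weight q a N R w * t ^+ pairs (disp n m) (dinvP n m) 0 w.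

Lemma markings_paths u w : binary u -> w \in markings u ->
  [/\ xs 0 w = xs 0 u, (w \in paths R C) = (u \in paths R C) &
    u \in paths R C -> fits T R w = fits T R u].
Proof.
move=> bu; rewrite mem_markings // => /eqP uE.
have xE : xs 0 w = xs 0 u by rewrite -uE xs_unmark.
have wE : (w \in paths R C) = (u \in paths R C).
  by rewrite !mem_paths -uE; have [-> ->] := count_unmark w.
split=> // uw; rewrite !(fits_rows m n l (C := C)) ?wE //.
by apply: eq_forallb => j; rewrite xE.
Qed.

(** The product over cogenerators expands into a sum over markings, by
[sum_marks]. *)
Lemma summandE u : u \in paths R C -> fits T R u -> binary u ->
  t ^+ N * summand (Delta m n l (lamw u)) = \sum_(w <- markings u) wordterm w.
Proof.
move=> uw fu bu; have shp := shape_row m_gt0 n_gt0 l_gt0 co_mn lt_l ltR ltC uw fu.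
have dR : count dn u = R by move: uw; rewrite mem_paths => /andP[/eqP].
have rC : (0 + count rt u = C)%N by move: uw; rewrite mem_paths => /andP[_ /eqP].
pose g (p : int * int) := t ^- crossings m n R (lamw u) (absz (level n m (p.1, p.2 - 1))).
rewrite /summand.
have -> : \big[*%R/1]_(k \in cogen m n (Delta m n l (lamw u)))
    (1 + a * t ^- xi m n (Delta m n l (lamw u)) k) =
    \prod_(c <- corners (0, R%:Z) u) (1 + a * g c).
  rewrite (cogenE m_gt0 n_gt0 l_gt0 co_mn lt_l ltR lM shp).
  rewrite (prod_corners _ bu dR rC); apply: eq_big => [j|j cj].
    rewrite /is_corner /wall; case: j => -[|j] jR //=; apply/esym.
    case E: (lamw u 0%N) => [|x]; first by lia.
    by have := @shp.2 x 0%N; rewrite E => /(_ (ltnSn _)); nia.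
  rewrite (xiE m_gt0 n_gt0 l_gt0 co_mn lt_l ltR lM shp); last first.
    by apply: leqW; apply: (corner_le m_gt0 n_gt0 l_gt0 co_mn lt_l ltR lM shp).
  rewrite /g (_ : level _ _ _ = (n * row (xs 0 u) j + m * j)%N%:Z) // /level /=; lia.
rewrite -(sum_marks _ _ _ bu) !mulr_sumr big_seq [RHS]big_seq.
apply: eq_bigr => w wu; have [xE wE fE] := markings_paths bu wu.
have ww : w \in paths R C by rewrite wE.
have fw : fits T R w by rewrite fE.
rewrite /wordterm /weight.
have := area'_word m_gt0 n_gt0 l_gt0 co_mn lt_l ltR ltC ww fw; rewrite xE => ->.
have := dinvP_word m_gt0 n_gt0 l_gt0 co_mn lt_l ltR ltC ww fw; rewrite xE => dE.
rewrite marks_prod [t ^+ pairs _ _ _ _]exprnP dE.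
rewrite (_ : count _ _ = count_mem lD w); last first.
  by rewrite -[in RHS](map_snd_edges dpos (0, R%:Z) w) count_map.
move: (codinv' _ _ _) (Defs.fcard _) (area R w) (\sum_(_ <- _ | _) _) (count_mem _ _) => cod k ar sm ct.
rewrite [t ^+ k]exprnP !expfzDr //; ring.
Qed.

(** The path of a partition; it fits into the rectangle because [l] is smaller
than both sides. *)
Lemma row_surj lam : shape m n l lam ->
  exists2 u, u \in [seq u <- paths R C | fits T R u && binary u] & lam =1 lamw u.
Proof.
move=> [anti fit].
have lamC j : (lam j <= C)%N.
  by case E: (lam j) => [//|x]; have := fit x j; rewrite E => /(_ (ltnSn _)); nia.
have lam0 j : (R <= j)%N -> lam j = 0%N.
  by case E: (lam j) => [//|x]; have := fit x j; rewrite E => /(_ (ltnSn _)); nia.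
pose r := rev (mkseq lam R).
have pr : path leq 0 r.
  rewrite path_min_sorted; last by apply/allP.
  rewrite /r rev_sorted; apply/(sortedP 0%N) => i; rewrite size_mkseq => iR.
  by rewrite !nth_mkseq //; apply: ltnW.
have rC : all (leq^~ C) r by rewrite all_rev; apply/allP => x /mapP[j _ ->].
have rowE : lam =1 row r.
  move=> j; rewrite /row /r revK; case: (ltnP j R) => jR; first by rewrite nth_mkseq.
  by rewrite nth_default ?size_mkseq // lam0.
exists (word_of_rows C 0 r); last by rewrite xs_word_of_rows.
have uw : word_of_rows C 0 r \in paths R C.
  rewrite mem_paths count_dn_word_of_rows size_rev size_mkseq eqxx /=.
  by rewrite -[count _ _]add0n count_rt_word_of_rows.
rewrite mem_filter uw word_of_rows_binary !andbT (fits_rows _ _ _ uw) xs_word_of_rows //.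
apply/forallP => j; rewrite -rowE /inT; case E: (lam j) => [//|x] /=.
by apply: fit; rewrite E.
Qed.

(** Modules correspond to words without D, and words to markings of these. *)
Lemma word_sum : t ^+ N * \sum_(D \in Inv_w m n l) summand D = ZP q t a T N n m R C.
Proof.
pose U := [seq u <- paths R C | fits T R u && binary u].
have UP u : u \in U -> [/\ u \in paths R C, fits T R u & binary u].
  by rewrite mem_filter => /andP[/andP[? ?] ?].
pose r := [seq Delta m n l (lamw u) | u <- U].
have uU : uniq U by rewrite filter_uniq // uniq_paths.
have shp u : u \in U -> shape m n l (lamw u).
  by move/UP => [uw fu _]; exact: shape_row uw fu.
have inj : {in U &, injective (fun u => Delta m n l (lamw u))}.
  move=> u v uU1 vU; move/(Delta_inj m_gt0 n_gt0 l_gt0 co_mn lt_l (shp u uU1) (shp v vU)) => E.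
  have [uw _ bu] := UP _ uU1; have [vw _ bv] := UP _ vU.
  move: uw vw; rewrite !mem_paths => /andP[/eqP du /eqP ru] /andP[/eqP dv /eqP rv].
  rewrite -(word_of_rows_xs bu (C := C) (x := 0)) // -(word_of_rows_xs bv (C := C) (x := 0)) //; congr word_of_rows.
  apply: (can_inj (@revK _)); apply: (@eq_from_nth _ 0%N); first by rewrite !size_rev !size_xs du.
  by move=> i _; exact: E.
rewrite (@fsbigE _ _ _ _ _ r); first last.
- move=> D iD /negP[].
  have [lam shl DE] := Delta_surj m_gt0 n_gt0 l_gt0 co_mn lt_l iD.
  have [u uU1 uE] := row_surj shl.
  by apply/mapP; exists u => //; rewrite DE; congr Delta; apply/funext.
- move=> D /mapP[u /shp su ->]; exact: Delta_Inv.
- by rewrite map_inj_in_uniq.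
rewrite big_map big_seq_cond (eq_bigl (mem U)); last first.
  move=> u; apply: andb_idr => uU1; apply/mem_set; exact/Delta_Inv/shp.
rewrite mulr_sumr /ZP.
transitivity (\sum_(u <- U) \sum_(w <- paths R C | fits T R w) (if unmark w == u then wordterm w else 0)).
  rewrite [RHS]big_seq; apply: eq_bigr => u uU1; have [uw fu bu] := UP _ uU1.
  rewrite summandE // -big_mkcondr -big_filter; apply: perm_big; apply: uniq_perm.
  - exact: uniq_markings.
  - by rewrite filter_uniq // uniq_paths.
  move=> w; rewrite mem_filter -(mem_markings _ bu); case wu: (w \in markings u); rewrite ?andbF //=.
  by have [_ -> ->] := markings_paths bu wu; rewrite ?uw ?fu.
rewrite exchange_big /= big_seq_cond [RHS]big_seq_cond; apply: eq_bigr => w /andP[ww fw].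
have wm : w \in markings (unmark w) by rewrite mem_markings ?unmark_binary.
have [_ wE fE] := markings_paths (unmark_binary w) wm.
have uw : unmark w \in paths R C by rewrite -wE.
rewrite (bigD1_seq (unmark w)) //=; last by rewrite mem_filter uw -fE // fw unmark_binary.
by rewrite eqxx big1 ?addr0 // => u; rewrite eq_sym => /negPf ->.
Qed.
End WordSum.

(** * Dependence on the partition only *)

(** Evaluation at 1 detects that a polynomial is not 0. *)
Lemma tofrac_neq0 (p : {mpoly int[3]}) : p.@[fun=> 1] != 0 -> tofrac p != 0.
Proof. by rewrite tofrac_eq0; apply: contra => /eqP ->; rewrite meval0. Qed.

Lemma vart_neq0 : vart != 0.
Proof. by apply: tofrac_neq0; rewrite mevalXU oner_eq0. Qed.

Lemma qn_vart_neq0 k : qn vart k.+1 != 0.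
Proof.
rewrite /qn /vart (eq_bigr (fun i : 'I_k.+1 => tofrac ('X_(1 : 'I_3) ^+ i))); last first.
  by move=> i _; rewrite tofracXn.
rewrite -rmorph_sum /=; apply: tofrac_neq0.
rewrite rmorph_sum /= (eq_bigr (fun=> 1)); last first.
  by move=> i _; rewrite rmorphXn /= mevalXU expr1n.
by rewrite sumr_const card_ord pnatr_eq0.
Qed.

(** The rectangle may be any one that is larger than [l] in both directions,
so two triples can be compared inside the same one. *)
Lemma Schroder_words (m n l R C : nat) :
  (0 < m)%N -> (0 < n)%N -> (0 < l)%N -> coprime m n -> (l < m * n)%N ->
  (l < R)%N -> (l < C)%N ->
  Schroder m n l = ZP varq vart vara (inT m n l) (Defs.fcard (tau m n l)) n m R C.
Proof.
move=> m0 n0 l0 co lt ltR ltC.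
exact: (word_sum m0 n0 l0 co lt ltR ltC varq vara vart_neq0).
Qed.

Lemma cut_inT (m n l : nat) : (0 < m)%N -> (0 < n)%N -> cut (inT m n l) n m.
Proof. by move=> m0 n0; split=> //; exists l => x y x0 y0; rewrite /inT x0 y0. Qed.

Lemma inT_tau (m n l x y : nat) : inT m n l x y <-> tau m n l (x, y).
Proof. by split=> [/and3P[]|[? [? ?]]] //; apply/and3P; split. Qed.

(** For different slopes rotate from the smaller to the larger and return to
[ZP] by [ZP_ZM]; coprime pairs with equal slopes are equal. *)
Lemma ZP_slope (T : nat -> nat -> bool) (N R C A B A' B' : nat) :
  (0 < R)%N -> (0 < C)%N ->
  (forall x y, (0 < x)%N -> T x y -> (x < C)%N && (y < R)%N) ->
  cut T A B -> cut T A' B' -> coprime A B -> coprime A' B' ->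
  ZP varq vart vara T N A B R C = ZP varq vart vara T N A' B' R C.
Proof.
move=> R0 C0 bT.
have step A1 B1 A2 B2 : cut T A1 B1 -> cut T A2 B2 -> (A1 * B2 < A2 * B1)%N ->
    ZP varq vart vara T N A1 B1 R C = ZP varq vart vara T N A2 B2 R C.
  move=> c1 c2 lt.
  rewrite (ZP_ZM_slopes varq vara vart_neq0 qn_vart_neq0 N R0 C0 bT c1 c2 lt).
  by rewrite -(ZP_ZM varq vara vart_neq0 qn_vart_neq0 N R0 C0 bT c2).
move=> c1 c2 co co'; case: (ltngtP (A * B') (A' * B)) => [lt|lt|E].
- exact: step.
- by apply/esym; exact: step.
have [A0 _ _] := c1; have [A'0 _ _] := c2.
have AA' : A = A'.
  apply/eqP; rewrite eqn_dvd -(Gauss_dvdl A' co) -E dvdn_mulr //=.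
  by rewrite -(Gauss_dvdl A co') E dvdn_mulr.
have -> : B = B' by apply/eqP; rewrite -(eqn_pmul2l A'0) -E AA'.
by rewrite AA'.
Qed.

Local Close Scope ring_scope.

Theorem corollary1p1 (m n l m' n' l' : nat)
  (m_gt0 : 0 < m) (n_gt0 : 0 < n) (l_gt0 : 0 < l)
  (m'_gt0 : 0 < m') (n'_gt0 : 0 < n') (l'_gt0 : 0 < l')
  (co_mn : coprime m n) (co_mn' : coprime m' n')
  (lt_l : l < m * n) (lt_l' : l' < m' * n')
  (eq_tau : tau m n l = tau m' n' l') :
  Schroder m n l = Schroder m' n' l'.
Proof.
pose R := (l + l').+1.
have lR : l < R by rewrite /R; lia.
have lR' : l' < R by rewrite /R; lia.
rewrite (Schroder_words m_gt0 n_gt0 l_gt0 co_mn lt_l lR lR).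
rewrite (Schroder_words m'_gt0 n'_gt0 l'_gt0 co_mn' lt_l' lR' lR') -eq_tau.
have TE : inT m' n' l' = inT m n l.
  apply/funext => x; apply/funext => y.
  by apply/idP/idP => /inT_tau => [|?]; [rewrite -eq_tau => /inT_tau | apply/inT_tau; rewrite -eq_tau].
rewrite TE; apply: ZP_slope => //.
- by move=> x y x0 /and3P[_ y0 le]; rewrite /R; nia.
- exact: cut_inT.
- by rewrite -TE; exact: cut_inT.
- by rewrite coprime_sym.
- by rewrite coprime_sym.
Qed.
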